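(* Let $A=T(V)/\langle R\rangle$ be a locally finite dimensional nonnegatively graded connected algebra with space of relations $R$, and let $\{J_i\}_{i\in\mathbb{N}_0}$ be the associated collection of graded vector subspaces of $T(V)$. The following statements are equivalent: (i) $A$ is multi-Koszul; (ii) $\mathcal{E}xt_A^i(k,k)\simeq J_i^{\#}$ (as graded vector spaces) for all $i\in\mathbb{N}_0$, where $(-)^{\#}$ denotes the graded dual of a graded vector space.
   Context: Setting. $k$ is a field. $A=\bigoplus_{n\ge 0}A_n$ is a locally finite dimensional nonnegatively graded connected algebra ($A_0=k$, $\dim A_n<\infty$), written $A=T(V)/\langle R\rangle$, where $V\simeq A_{>0}/(A_{>0}\cdot A_{>0})$ is a positively graded vector space with finite dimensional components, $T(V)$ is its tensor algebra with the grading induced from $V$, and $R\subseteq \bigoplus_{n\ge2}V^{\otimes n}$ is a space of relations: a graded subspace with $R\cap(T(V)_{>0}\otimes R\otimes T(V)+T(V)\otimes R\otimes T(V)_{>0})=0$, $T(V)_{>0}=\bigoplus_{n\ge1}V^{\otimes n}$. $\pi:T(V)\to A$ is the projection. $V^{(n)}=V^{\otimes n}$, $V^{(0)}=k$. For subspaces $W_1,\dots,W_m$ of $T(V)$, $W_1\otimes\dots\otimes W_m$ denotes the subspace of $T(V)$ spanned by products $w_1\cdots w_m$; $R^{(i)}=R\otimes\dots\otimes R$ ($i$ factors), $R^{(0)}=k$. The spaces $J_i\subseteq T(V)$. $J_0=k$, $J_2=R$, $J_{2i+1}=(V\otimes J_{2i})\cap(J_{2i}\otimes V)$ for $i\ge0$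 (so $J_1=V$), and for $i\ge1$ $$J_{2(i+1)}=\Big(\sum_{N\ge1}\ \bigcap_{\bar n,\bar m}V^{(m_1)}\otimes J_{2n_1}\otimes\dots\otimes V^{(m_i)}\otimes J_{2n_i}\otimes V^{(m_{i+1})}\Big)\cap R^{(i+1)},$$ where $\bar n=(n_1,\dots,n_i)$ runs over $i$-tuples of nonnegative integers with sum $i$ and $\bar m=(m_1,\dots,m_{i+1})$ over $(i+1)$-tuples of nonnegative integers with sum $N$. They are graded for the grading induced from $V$. Multi-Koszul algebras. $K_{L-R}(A)_i=A\otimes J_i\otimes A$, with $A$-bimodule maps $\delta_i^b:K_{L-R}(A)_i\to K_{L-R}(A)_{i-1}$: if $i=2j+1$ and $\omega=\sum\bar\omega_{(1)}\omega_{(2)}=\sum\omega'_{(1)}\bar\omega'_{(2)}\in J_{2j+1}$ with $\bar\omega_{(1)},\bar\omega'_{(2)}\in V$, $\omega_{(2)},\omega'_{(1)}\in J_{2j}$, then $\delta_i^b(1\otimes\omega\otimes1)=\sum\bar\omega_{(1)}\otimes\omega_{(2)}\otimes1-\sum1\otimes\omega'_{(1)}\otimes\bar\omega'_{(2)}$; if $i=2j\ge2$, then $J_{2j}\subseteq\bigoplus_{N\ge0}\bigcap_{l=0}^N V^{(l)}\otimes J_{2j-1}\otimes V^{(N-l)}$, and writing $\omega=\sum_N\omega^N$ accordingly and $\omega^N=\sum\omega^{N,l}_{(1)}\omega^{N,l}_{(2)}\omega^{N,l}_{(3)}\in V^{(l)}\otimes J_{2j-1}\otimes V^{(N-l)}$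 for each $0\le l\le N$, $\delta_i^b(1\otimes\omega\otimes1)=\sum_N\sum_{l=0}^N\sum\pi(\omega^{N,l}_{(1)})\otimes\omega^{N,l}_{(2)}\otimes\pi(\omega^{N,l}_{(3)})$. The left (resp. right) multi-Koszul complex is $K_{L-R}(A)_\bullet\otimes_A k$ (resp. $k\otimes_A K_{L-R}(A)_\bullet$), augmented to $k$. $A$ is multi-Koszul if the augmented left multi-Koszul complex is a resolution of the trivial left module $k$ (equivalently, the right one is a resolution of the trivial right module $k$). Ext and duals. $\mathcal{H}om_A(N,N')=\bigoplus_{d\in\mathbb{Z}}\hom_A(N,N'[d])$, where $\hom_A$ is the space of degree-preserving $A$-linear maps and $N'[d]_n=N'_{n+d}$; $\mathcal{E}xt_A^i(N,N')=H^i(\mathcal{H}om_A(P_\bullet,N'))$ for a graded projective resolution $P_\bullet$ of $N$. $W^{\#}$ has $n$-th component $(W_{-n})^*$. *)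

(* Defs.v *)
From HB Require Import structures.
From mathcomp Require Import all_boot all_order all_algebra.
From mathcomp Require Import ring_quotient.
From mathcomp Require Import boolp classical_sets.
From mathcomp Require Import finmap.
From mathcomp.multinomials Require Import monalg.

Set Implicit Arguments.
Unset Strict Implicit.
Unset Printing Implicit Defensive.

Import GRing.Theory.

Local Open Scope ring_scope.
Local Open Scope classical_set_scope.
Local Open Scope quotient_scope.

Section Span.
Variables (k : pzRingType) (M : lmodType k).

Inductive span (S : set M) : set M :=
| span_zero : span S 0
| span_add c x y : S x -> span S y -> span S (c *: x + y).

Lemma spanD (S : set M) x y : span S x -> span S y -> span S (x + y).
Proof.
by elim=> [|c u v Su _ IH] Sy; rewrite ?add0r // -addrA; apply: span_add (IH Sy).
Qed.

Lemma spanZ (S : set M) c x : span S x -> span S (c *: x).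
Proof.
elim=> [|d u v Su _ IH]; first by rewrite scaler0; apply: span_zero.
by rewrite scalerDr scalerA; apply: span_add.
Qed.

Lemma sub_span (S : set M) : S `<=` span S.
Proof.
by move=> x Sx; rewrite -[x]addr0 -[x]scale1r; apply: span_add => //; apply: span_zero.
Qed.

Definition is_subspace (S : set M) : Prop :=
  S 0 /\ forall c x y, S x -> S y -> S (c *: x + y).

Definition functional_on (S : set M) : set ({x | S x} -> k) :=
  [set u | forall c (x y z : {x | S x}),
     sval z = c *: sval x + sval y -> u z = c * u x + u y].

End Span.

Arguments functional_on {k M} S.

(* U (x) V over k: the free module on U * V modulo the bilinearity relations. *)
Section Tensor.
Variables (k : fieldType) (U V : lmodType k).

Local Notation F := {malg k[(U * V)%type]}.

Inductive tens_rel : set F :=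
| tens_rel_l c u u' v :
    tens_rel (<< (c *: u + u', v) >> - c *: << (u, v) >> - << (u', v) >>)
| tens_rel_r c u v v' :
    tens_rel (<< (u, c *: v + v') >> - c *: << (u, v) >> - << (u, v') >>).

Definition tens_ker : {pred F} := [pred x | `[< span tens_rel x >]].

Lemma tens_kerP x : reflect (span tens_rel x) (x \in tens_ker).
Proof. exact: asboolP. Qed.

Lemma tens_ker_zmod_closed : zmod_closed tens_ker.
Proof.
split=> [|x y /tens_kerP Sx /tens_kerP Sy]; apply/tens_kerP.
  exact: span_zero.
by rewrite -scaleN1r; apply: spanD => //; apply: spanZ.
Qed.

HB.instance Definition _ := GRing.isZmodClosed.Build F tens_ker tens_ker_zmod_closed.

Definition tens := Quotient.quot tens_ker.

HB.instance Definition _ := GRing.Zmodule.on tens.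
HB.instance Definition _ := EqQuotient.on tens.

Definition tens_scale (c : k) (x : tens) : tens := \pi_tens (c *: repr x).

Lemma tens_scale_pi c x : tens_scale c (\pi_tens x) = \pi_tens (c *: x).
Proof.
apply/eqP; rewrite -Quotient.idealrBE -scalerBr; apply/tens_kerP/spanZ/tens_kerP.
by rewrite Quotient.idealrBE reprK.
Qed.

Lemma tens_pi_surj (v : tens) : exists x, v = \pi_tens x.
Proof. by exists (repr v); rewrite reprK. Qed.

Lemma tens_scaleA a b v : tens_scale a (tens_scale b v) = tens_scale (a * b) v.
Proof. by have [x ->] := tens_pi_surj v; rewrite !tens_scale_pi scalerA. Qed.

Lemma tens_scale1 : left_id 1 tens_scale.
Proof. by move=> v; have [x ->] := tens_pi_surj v; rewrite tens_scale_pi scale1r. Qed.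

Lemma tens_scaleDr : right_distributive tens_scale +%R.
Proof.
move=> c x y; have [{}x ->] := tens_pi_surj x; have [{}y ->] := tens_pi_surj y.
by rewrite -raddfD !tens_scale_pi scalerDr raddfD.
Qed.

Lemma tens_scaleDl v : {morph tens_scale^~ v : a b / a + b}.
Proof.
by move=> a b; have [x ->] := tens_pi_surj v; rewrite !tens_scale_pi scalerDl raddfD.
Qed.

HB.instance Definition _ := GRing.Zmodule_isLmodule.Build k tens
  tens_scaleA tens_scale1 tens_scaleDr tens_scaleDl.

Definition tens_pure (u : U) (v : V) : tens := \pi_tens << (u, v) >>.

Lemma tens_pure_linl c u u' v :
  tens_pure (c *: u + u') v = c *: tens_pure u v + tens_pure u' v.
Proof.
rewrite -[c *: tens_pure u v]/(tens_scale c _) tens_scale_pi -raddfD.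
apply/eqP; rewrite -Quotient.idealrBE opprD addrA.
exact/tens_kerP/sub_span/tens_rel_l.
Qed.

Lemma tens_pure_linr c u v v' :
  tens_pure u (c *: v + v') = c *: tens_pure u v + tens_pure u v'.
Proof.
rewrite -[c *: tens_pure u v]/(tens_scale c _) tens_scale_pi -raddfD.
apply/eqP; rewrite -Quotient.idealrBE opprD addrA.
exact/tens_kerP/sub_span/tens_rel_r.
Qed.

End Tensor.

Notation tensalg k X := {malg k[{fmonom X}]}.

(* V is the graded space with homogeneous basis X, x being of degree deg x; its
   tensor algebra is the algebra of the free monoid on X.  The product of
   subspaces of T(V) plays the role of their tensor product. *)
Section TensorAlgebra.
Variables (k : fieldType) (X : choiceType) (deg : X -> nat).

Local Notation T := (tensalg k X).

Definition word_deg (w : {fmonom X}) : nat := \sum_(x <- w) deg x.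

Definition homog (n : int) : set T :=
  [set x | forall w, w \in msupp x -> (word_deg w)%:Z = n].

Definition tprod (W1 W2 : set T) : set T :=
  span [set w1 * w2 | w1 in W1 & w2 in W2].

Local Notation "W1 \ox W2" := (tprod W1 W2) (at level 40, left associativity).

Definition tscal : set T := span [set 1].

Definition tpow (W : set T) (n : nat) : set T := iter n (tprod W) tscal.

Definition genV : set T := span (range (fun x => << fmu x >>)).

Definition tens_ge (m : nat) : set T :=
  span (\bigcup_(n in [set n | (m <= n)%N]) tpow genV n).

Record space_of_relations (R : set T) : Prop := {
  rel_subspace : is_subspace R;
  rel_graded : forall r, R r -> span (R `&` \bigcup_n homog n) r;
  rel_ge2 : R `<=` tens_ge 2;
  rel_minimal :
    R `&` span ((tens_ge 1 \ox R \ox setT) `|` (setT \ox R \ox tens_ge 1))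
      `<=` [set 0]
}.

(* V^(m_1) \ox E n_1 \ox ... \ox V^(m_i) \ox E n_i \ox V^(m_(i+1)); only used
   when m has one more entry than n. *)
Fixpoint alt_tprod (E : nat -> set T) (m n : seq nat) : set T :=
  match m, n with
  | a :: m', b :: n' => tpow genV a \ox (E b \ox alt_tprod E m' n')
  | a :: _, [::] => tpow genV a
  | [::], _ => tscal
  end.

(* J_(2 (i + 1)) in terms of E n = J_(2 n), n <= i, for i >= 1. *)
Definition J_step (R : set T) (E : nat -> set T) (i : nat) : set T :=
  span (\bigcup_(N in [set N | (1 <= N)%N])
          \bigcap_(mn in [set mn : seq nat * seq nat |
              [/\ size mn.2 = i, sumn mn.2 = i,
                  size mn.1 = i.+1 & sumn mn.1 = N]])
            alt_tprod E mn.1 mn.2)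
  `&` tpow R i.+1.

(* The list J_0, J_2, ..., J_(2 n). *)
Fixpoint J_evens (R : set T) (n : nat) : seq (set T) :=
  match n with
  | 0 => [:: tscal]
  | i.+1 =>
      let s := J_evens R i in
      rcons s (if i == 0%N then R else J_step R (nth set0 s) i)
  end.

Definition J_even (R : set T) (n : nat) : set T := nth set0 (J_evens R n) n.

Definition J (R : set T) (i : nat) : set T :=
  if odd i then (genV \ox J_even R i./2) `&` (J_even R i./2 \ox genV)
  else J_even R i./2.

Lemma size_J_evens R n : size (J_evens R n) = n.+1.
Proof. by elim: n => //= n IH; rewrite size_rcons IH. Qed.

Lemma nth_J_evens R n m : (m <= n)%N -> nth set0 (J_evens R n) m = J_even R m.
Proof.
elim: n => [|n IH]; first by rewrite leqn0 => /eqP->.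
rewrite leq_eqVlt => /predU1P[-> //|le_mn].
by rewrite /= nth_rcons size_J_evens le_mn IH.
Qed.

Lemma J_0E R : J R 0 = tscal.
Proof. by []. Qed.

Lemma J_2E R : J R 2 = R.
Proof. by []. Qed.

Lemma J_oddE R i :
  J R i.*2.+1 = (genV \ox J R i.*2) `&` (J R i.*2 \ox genV).
Proof. by rewrite /J /= odd_double /= uphalf_double doubleK. Qed.

Lemma eq_alt_tprod E E' m n :
  (forall a, (a <= sumn n)%N -> E a = E' a) -> alt_tprod E m n = alt_tprod E' m n.
Proof.
elim: m n => [|a m IH] [|b n] //= eqE.
by rewrite eqE ?leq_addr // IH // => c le_c; rewrite eqE // (leq_trans le_c) ?leq_addl.
Qed.

Lemma J_evenE R i : (0 < i)%N ->
  J R i.+1.*2 = J_step R (fun n => J R n.*2) i.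
Proof.
move=> i_gt0; rewrite /J odd_double doubleK /J_even /= nth_rcons size_J_evens.
rewrite ltnn eqxx -[i == _]negbK -lt0n i_gt0 /= /J_step; congr (span _ `&` _).
apply: eq_bigcupr => N _; apply: eq_bigcapr => -[m n] /= [_ sum_n _ _].
apply: eq_alt_tprod => a; rewrite sum_n => le_ai.
by rewrite odd_double doubleK nth_J_evens.
Qed.

(* Degree d component of the graded dual of a graded subspace W of T(V): the
   linear forms on the component of W of degree - d. *)
Definition hcomp (W : set T) (n : int) : set T := W `&` homog n.

Definition graded_dual (W : set T) (d : int) : set ({x | hcomp W (- d) x} -> k) :=
  functional_on (hcomp W (- d)).

End TensorAlgebra.

Arguments genV {k X}.

Definition is_grading (I : eqType) (M : zmodType) (G : I -> set M) : Prop :=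
  [/\ forall i, G i 0 /\ (forall x y, G i x -> G i y -> G i (x - y)),
      forall x, exists (s : seq I) (f : I -> M),
        (forall i, G i (f i)) /\ x = \sum_(i <- s) f i
    & forall (s : seq I) (f : I -> M), uniq s -> (forall i, G i (f i)) ->
        \sum_(i <- s) f i = 0 -> forall i, i \in s -> f i = 0].

(* Locally finite dimensional nonnegatively graded connected algebras.  The
   augmentation is determined by the other fields: it is the projection onto
   A_0 = k. *)
Record cgalg (k : fieldType) := Cgalg {
  cga_sort :> algType k;
  cga_comp : nat -> set cga_sort;
  cga_eps : {rmorphism cga_sort -> k};
  cga_subspace : forall n, is_subspace (cga_comp n);
  cga_grading : is_grading cga_comp;
  cga_mul : forall m n a b,
    cga_comp m a -> cga_comp n b -> cga_comp (m + n) (a * b);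
  cga_connected : cga_comp 0 = [set c%:A | c in setT];
  cga_locally_finite : forall n, exists s : seq cga_sort, cga_comp n `<=` span [set` s];
  cga_eps_scal : forall c, cga_eps c%:A = c;
  cga_eps_pos : forall n a, (0 < n)%N -> cga_comp n a -> cga_eps a = 0
}.

Record grmod (k : fieldType) (A : cgalg k) := Grmod {
  grmod_sort :> lmodType A;
  grmod_comp : int -> set grmod_sort;
  grmod_grading : is_grading grmod_comp;
  grmod_act : forall m n (a : A) x,
    cga_comp m a -> grmod_comp n x -> grmod_comp (m%:Z + n) (a *: x)
}.

Definition trivial_module (k : fieldType) (A : cgalg k) : Type := k.

Section TrivialModule.
Variables (k : fieldType) (A : cgalg k).

Local Notation triv := (trivial_module A).

HB.instance Definition _ := GRing.Zmodule.copy triv k.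

Definition triv_scale (a : A) (x : triv) : triv := (cga_eps A a * x : k).

Lemma triv_scaleA a b x : triv_scale a (triv_scale b x) = triv_scale (a * b) x.
Proof. by rewrite /triv_scale rmorphM mulrA. Qed.

Lemma triv_scale1 : left_id 1 triv_scale.
Proof. by move=> x; rewrite /triv_scale rmorph1 mul1r. Qed.

Lemma triv_scaleDr : right_distributive triv_scale +%R.
Proof. by move=> a x y; rewrite /triv_scale -mulrDr. Qed.

Lemma triv_scaleDl x : {morph triv_scale^~ x : a b / a + b}.
Proof. by move=> a b; rewrite /triv_scale rmorphD mulrDl. Qed.

HB.instance Definition _ := GRing.Zmodule_isLmodule.Build A triv
  triv_scaleA triv_scale1 triv_scaleDr triv_scaleDl.

Definition triv_comp (n : int) : set triv := [set x | n != 0 -> x = 0].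

Lemma triv_grading : is_grading triv_comp.
Proof.
split=> [n|x|s f uniq_s f_comp sum_f i s_i].
- by split=> // x y x0 y0 n_neq0; rewrite x0 // y0 // subr0.
- exists [:: 0], (fun n => if n == 0 then x else 0); split.
    by move=> n /negPf->.
  by rewrite big_seq1 eqxx.
have [i0|/f_comp //] := eqVneq i 0.
rewrite -sum_f (bigD1_seq i) //= big1 ?addr0 // => j; rewrite i0.
exact: f_comp.
Qed.

Lemma triv_act m n (a : A) x :
  cga_comp m a -> triv_comp n x -> triv_comp (m%:Z + n) (a *: x).
Proof.
move=> Am_a n_x mn_neq0; have [n0|n_neq0] := eqVneq n 0; last first.
  by rewrite n_x // scaler0.
rewrite n0 addr0 in mn_neq0; rewrite [a *: x]/(triv_scale a x) /triv_scale.
by rewrite (cga_eps_pos _ Am_a) ?mul0r // lt0n.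
Qed.

Definition triv_grmod : grmod A := Grmod triv_grading triv_act.

End TrivialModule.

Section Ext.
Variables (k : fieldType) (A : cgalg k).

(* Degree d component of Hom_A(N, N'): the degree-preserving N -> N'[d]. *)
Definition gr_hom (N N' : grmod A) (d : int) (f : N -> N') : Prop :=
  (forall (a : A) x y, f (a *: x + y) = a *: f x + f y) /\
  (forall n x, grmod_comp n x -> grmod_comp (n + d) (f x)).

Definition gr_projective (P : grmod A) : Prop :=
  forall (M N : grmod A) (g : M -> N) (f : P -> N),
    gr_hom 0 g -> (forall y, exists x, g x = y) -> gr_hom 0 f ->
    exists2 h : P -> M, gr_hom 0 h & forall x, g (h x) = f x.

Record gr_proj_resolution (N : grmod A) := GrProjResolution {
  res_mod :> nat -> grmod A;
  res_diff : forall i, res_mod i.+1 -> res_mod i;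
  res_aug : res_mod 0 -> N;
  res_diff_hom : forall i, gr_hom 0 (@res_diff i);
  res_aug_hom : gr_hom 0 res_aug;
  res_projective : forall i, gr_projective (res_mod i);
  res_aug_surj : forall y, exists x, res_aug x = y;
  res_exact0 : forall x, res_aug x = 0 <-> exists y, res_diff y = x;
  res_exact : forall i (x : res_mod i.+1),
    res_diff x = 0 <-> exists y, res_diff y = x
}.

Variables (N N' : grmod A) (P : gr_proj_resolution N).

Definition cocycle (i : nat) (d : int) : set (P i -> N') :=
  [set f | gr_hom d f /\ forall x, f (res_diff x) = 0].

Definition coboundary (i : nat) (d : int) : set (P i -> N') :=
  match i with
  | 0 => [set f | forall x, f x = 0]
  | j.+1 => [set f | exists2 g : P j -> N',
                       gr_hom d g & forall x, f x = g (res_diff x)]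
  end.

(* Ext^i(N, N') computed with P is isomorphic, as a graded vector space, to the
   graded dual of W: in each degree d there is a k-linear map from the cocycles
   onto the dual component whose kernel is the space of coboundaries. *)
Definition Ext_iso_dual (X : choiceType) (deg : X -> nat) (i : nat)
    (W : set (tensalg k X)) : Prop :=
  forall d : int,
  exists phi : (P i -> N') -> ({x | hcomp deg W (- d) x} -> k),
  [/\ forall f, cocycle d f -> graded_dual (phi f),
      forall (c : k) f g, cocycle d f -> cocycle d g ->
        forall x, phi (fun p => c%:A *: f p + g p) x = c * phi f x + phi g x,
      forall u, graded_dual u ->
        exists2 f, cocycle d f & forall x, phi f x = u x
    & forall f, cocycle d f -> (forall x, phi f x = 0) <-> coboundary d f].

End Ext.

Section MultiKoszul.
Variables (k : fieldType) (X : choiceType) (deg : X -> nat).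

Local Notation T := (tensalg k X).

Variables (R : set T) (A : cgalg k) (pi : {lrmorphism T -> A}).

(* pi identifies the graded algebra A with T(V) / <R>. *)
Definition presents : Prop :=
  [/\ forall a, exists x, pi x = a,
      forall x, pi x = 0 <-> tprod (tprod setT R) setT x
    & forall n x, homog deg n%:Z x -> cga_comp n (pi x)].

Definition ATA : lmodType k := tens (tens A T) A.

Definition tri (a : A) (w : T) (b : A) : ATA := tens_pure (tens_pure a w) b.

(* A \ox J_i \ox A, as a subspace of A \ox T(V) \ox A (k is a field). *)
Definition KLR (i : nat) : set ATA :=
  span [set z | exists a w b, J R i w /\ z = tri a w b].

(* K_i . A_{>0}, so that K_i \ox_A k is the quotient of K_i by it. *)
Definition KLR_pos (i : nat) : set ATA :=
  span [set z | exists a w b b',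
          [/\ J R i w, cga_eps A b' = 0 & z = tri a w (b * b')]].

Definition linear_on (M M' : lmodType k) (S : set M) (f : M -> M') : Prop :=
  forall c x y, S x -> S y -> f (c *: x + y) = c *: f x + f y.

(* delta (1 \ox w \ox 1), extended A-bilinearly, for w in J_(2j+1). *)
Definition diff_odd (j : nat) (delta : ATA -> ATA) : Prop :=
  forall (w : T) (s s' : seq (T * T)),
    J R j.*2.+1 w ->
    (forall p, p \in s -> genV p.1 /\ J R j.*2 p.2) ->
    (forall p, p \in s' -> J R j.*2 p.1 /\ genV p.2) ->
    w = \sum_(p <- s) p.1 * p.2 ->
    w = \sum_(p <- s') p.1 * p.2 ->
    forall a b, delta (tri a w b) =
      \sum_(p <- s) tri (a * pi p.1) p.2 b - \sum_(p <- s') tri a p.1 (pi p.2 * b).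

(* delta (1 \ox w \ox 1), extended A-bilinearly, for w in J_(2j+2): w is the sum
   of the wN N, N < B, and s N l is a decomposition of wN N in
   V^(l) \ox J_(2j+1) \ox V^(N-l). *)
Definition diff_even (j : nat) (delta : ATA -> ATA) : Prop :=
  forall (w : T) (B : nat) (wN : nat -> T) (s : nat -> nat -> seq (T * T * T)),
    J R j.*2.+2 w ->
    w = \sum_(N < B) wN N ->
    (forall N l t, (N < B)%N -> (l <= N)%N -> t \in s N l ->
       [/\ tpow genV l t.1.1, J R j.*2.+1 t.1.2
         & tpow genV (N - l) t.2]) ->
    (forall N l, (N < B)%N -> (l <= N)%N ->
       wN N = \sum_(t <- s N l) t.1.1 * t.1.2 * t.2) ->
    forall a b, delta (tri a w b) =
      \sum_(N < B) \sum_(l < N.+1) \sum_(t <- s N l)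
        tri (a * pi t.1.1) t.1.2 (pi t.2 * b).

(* These conditions determine delta i on KLR i for i >= 1; its values elsewhere
   are irrelevant. *)
Definition is_KLR_diff (delta : nat -> ATA -> ATA) : Prop :=
  [/\ forall i, linear_on (KLR i.+1) (delta i.+1),
      forall j, diff_odd j (delta j.*2.+1)
    & forall j, diff_even j (delta j.*2.+2)].

(* The augmentation K_0 \ox_A k = (A \ox k \ox A) \ox_A k -> k. *)
Definition is_KL_aug (aug : ATA -> k^o) : Prop :=
  linear_on (KLR 0) aug /\
  forall a c b, aug (tri a c%:A b) = cga_eps A a * c * cga_eps A b.

(* Exactness of the augmented complex K \ox_A k -> k. *)
Definition KL_resolution (delta : nat -> ATA -> ATA) (aug : ATA -> k^o) : Prop :=
  [/\ forall c, exists2 z, KLR 0 z & aug z = c,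
      forall z, KLR 0 z ->
        (aug z = 0 <-> exists2 y, KLR 1 y & KLR_pos 0 (z - delta 1 y))
    & forall i z, KLR i.+1 z ->
        (KLR_pos i (delta i.+1 z) <->
         exists2 y, KLR i.+2 y & KLR_pos i.+1 (z - delta i.+2 y))].

Definition multi_koszul : Prop :=
  exists delta aug,
    [/\ is_KLR_diff delta, is_KL_aug aug & KL_resolution delta aug].

End MultiKoszul.

(* Main.v *)
Require Import Defs.
From HB Require Import structures.
From mathcomp Require Import all_boot all_order all_algebra.
From mathcomp Require Import boolp classical_sets.
From mathcomp Require Import finmap.
From mathcomp.multinomials Require Import monalg.

(* K_(L-R)(A) (x)_A k is a complex of free modules Q_i = A (x) J_i.  It is minimal
   in a strong sense: every i-cycle lies in A_+ (x) J_i, and the map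
   J_(i+1) -> Z_i / A_+ Z_i to the cycles modulo decomposable cycles is injective.
   Both follow from J_(i+1) <= T_+ J_i, J_(i+2) <= R J_i and the minimality of R.

   Compare Q with a projective resolution P of k, in the range where Q is exact.
   By minimality Hom(Q_i, k) = J_i^#, all cochains vanishing on cycles, so that
   Ext^i(k, k) = J_i^# as soon as Q is exact in degrees < i; this gives (i) => (ii).
   Conversely, if Q is exact in degrees < i, then Hom(Z_i, k) embeds in
   Ext^(i+1)(k, k) = J_(i+1)^# and also maps onto J_(i+1)^# by restriction; since the
   components of J_(i+1) are finite dimensional the restriction is injective, so
   Z_i = J_(i+1) + A_+ Z_i and, by Nakayama, Q is exact in degree i. *)

(* Makes [span] the one of Defs again. *)
Import Defs.

Set Implicit Arguments.
Unset Strict Implicit.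
Unset Printing Implicit Defensive.

Import GRing.Theory Num.Theory.

Local Open Scope ring_scope.
Local Open Scope classical_set_scope.

(** Relations need not be homogeneous for word length, so [A] has no length grading and the
    minimality arguments are carried out in T = T(V). Multiplication T (x) J_i -> T is injective, so
    t s |-> pi(t) (x) s is a well defined map T J_i -> A (x) J_i ([theta]). Its kernel is I J_i,
    where I is the ideal of [R], and under it the differential becomes the inclusion of T J_(i+1) in
    T J_i. The parity of i decides how J_(i+1) is separated from A_+ Z_i. For i even, J_(i+1) <= V
    J_i has only one letter in front of J_i, while A_+ Z_i lifts to T_(>=2) J_i. For i odd, J_(i+1)
    <= R J_(i-1), while A_+ Z_i lifts to T_+ I J_(i-1), and R meets T_+ I + I T_+ in 0. The even
    case rests on Z_i <= A_+ (x) J_i, which comes from the separation one degree lower; so both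
    properties go through one induction. In the converse, (ii) gives just some isomorphism,
    unrelated to the restriction of functionals to J_(i+1). Only a dimension count in each degree is
    possible, and it is finite because letters have positive degrees, finitely many of each. *)

Local Notation "u ** v" := (mmul u v) (at level 40, left associativity).

(** * Spans, subspaces and extension of linear maps *)

Section SpanTheory.
Variables (k : pzRingType) (M : lmodType k).
Implicit Types (S V : set M).

Lemma subspace_span S : is_subspace (span S).
Proof.
split=> [|c x y Sx Sy]; first exact: span_zero.
by apply: spanD Sy; apply: spanZ.
Qed.

Lemma span_min S V : is_subspace V -> S `<=` V -> span S `<=` V.
Proof.
case=> V0 VD SV x; elim=> [//|c u v Su _ Vv].
by apply: VD => //; apply: SV.
Qed.

Lemma span_mono S S' : S `<=` S' -> span S `<=` span S'.
Proof.
move=> SS'; apply: span_min (subspace_span _) _ => x Sx.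
exact/sub_span/SS'.
Qed.

Lemma subspace0 V : is_subspace V -> V 0. Proof. by case. Qed.

Lemma subspaceZ V c x : is_subspace V -> V x -> V (c *: x).
Proof. by case=> V0 VD Vx; rewrite -[_ *: _]addr0; apply: VD. Qed.

Lemma subspaceD V x y : is_subspace V -> V x -> V y -> V (x + y).
Proof. by case=> V0 VD Vx Vy; rewrite -[x]scale1r; apply: VD. Qed.

Lemma subspaceN V x : is_subspace V -> V x -> V (- x).
Proof. by move=> sV Vx; rewrite -scaleN1r; apply: subspaceZ. Qed.

Lemma subspaceB V x y : is_subspace V -> V x -> V y -> V (x - y).
Proof. by move=> sV Vx Vy; apply: subspaceD => //; apply: subspaceN. Qed.

Lemma subspace_sum V (I : eqType) (r : seq I) (P : pred I) (F : I -> M) :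
  is_subspace V -> (forall i, i \in r -> P i -> V (F i)) -> V (\sum_(i <- r | P i) F i).
Proof.
move=> sV VF; rewrite big_seq_cond; elim/big_ind: _ => [|x y|i /andP[]].
- exact: subspace0.
- exact: subspaceD.
- exact: VF.
Qed.

Lemma subspaceI V1 V2 : is_subspace V1 -> is_subspace V2 -> is_subspace (V1 `&` V2).
Proof.
move=> [a b] [c d]; split=> // e x y [x1 x2] [y1 y2].
by split; [apply: b | apply: d].
Qed.

Lemma subspace_preim (N : lmodType k) (f : {linear M -> N}) (V : set N) :
  is_subspace V -> is_subspace (f @^-1` V).
Proof.
move=> [V0 VD]; split=> [|c x y /= Vx Vy] /=; first by rewrite linear0.
by rewrite linearP; apply: VD.
Qed.

Lemma subspace_ker (N : lmodType k) (f : {linear M -> N}) :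
  is_subspace [set x | f x = 0].
Proof.
split=> [|c x y /= fx fy] /=; first by rewrite linear0.
by rewrite linearP fx fy scaler0 addr0.
Qed.

Lemma span_lin_eq (N : lmodType k) (f g : {linear M -> N}) S :
  (forall x, S x -> f x = g x) -> forall x, span S x -> f x = g x.
Proof.
move=> fg x; elim=> [|c u v Su _ IH]; first by rewrite !linear0.
by rewrite !linearP IH fg.
Qed.

Lemma span_linear_image (N : lmodType k) (f : {linear M -> N}) S (V : set N) :
  is_subspace V -> (forall x, S x -> V (f x)) -> forall x, span S x -> V (f x).
Proof. by move=> sV SV; apply: (span_min (subspace_preim f sV)). Qed.

Lemma linear_funE (N : lmodType k) (f : M -> N) :
  (forall c x y, f (c *: x + y) = c *: f x + f y) ->
  exists g : {linear M -> N}, g =1 f.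
Proof.
move=> lin_f; pose g := GRing.isLinear.Build k M N *:%R f lin_f.
by exists (HB.pack_for {linear M -> N} f g).
Qed.

End SpanTheory.

Section LinearExtension.
Variables (k : fieldType) (M M' : lmodType k) (G : set (M * M')).
Hypotheses (sG : is_subspace G) (funG : forall y, G (0, y) -> y = 0).

Let ok (H : set (M * M')) :=
  [/\ is_subspace H, forall y, H (0, y) -> y = 0
    & forall p, H p -> exists z, G (z, p.2)].

Let okG : ok G.
Proof. by split=> // -[x y] Gp; exists x. Qed.

(** Zorn's lemma is applied to the sets whose union with [G] is [ok], so that the empty chain, with
    empty union, is covered as well. *)
Let ok_chain (F : set (set (M * M'))) :
  F `<=` [set H | ok (H `|` G)] -> total_on F subset -> ok ((\bigcup_(X in F) X) `|` G).
Proof.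
move=> okF totF.
have inF X : F X -> (X `|` G) `<=` (\bigcup_(X in F) X) `|` G.
  by move=> FX p [Xp|Gp]; [left; exists X | right].
have common p q : ((\bigcup_(X in F) X) `|` G) p -> ((\bigcup_(X in F) X) `|` G) q ->
    exists2 H, ok H & [/\ H `<=` (\bigcup_(X in F) X) `|` G, H p & H q].
  case=> [[X FX Xp]|Gp] [[Y FY Yq]|Gq].
  - have [XY|YX] := totF _ _ FX FY.
      exists (Y `|` G); first exact: okF.
      by split; [exact: inF | left; apply: XY | left].
    exists (X `|` G); first exact: okF.
    by split; [exact: inF | left | left; apply: YX].
  - exists (X `|` G); first exact: okF.
    by split; [exact: inF | left | right].
  - exists (Y `|` G); first exact: okF.
    by split; [exact: inF | right | left].
  - by exists G => //; split=> // r Gr; right.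
split=> [|y Up|p Up]; last 2 first.
- by have [H [_ funH _] [_ /funH]] := common _ _ Up Up.
- by have [H [_ _ rgH] [_ /rgH]] := common _ _ Up Up.
split=> [|c p q Up Uq]; first by right; apply: subspace0.
have [H [sH _ _] [HU Hp Hq]] := common _ _ Up Uq.
by apply: HU; case: sH => _; apply.
Qed.

(** [G] is the graph of a linear map on a subspace. A maximal graph containing it and taking no new
    values is total, because a missing vector could be sent to 0. Keeping track of the values yields
    projectors. *)
Lemma linear_extension :
  exists f : {linear M -> M'},
    (forall x y, G (x, y) -> f x = y) /\ (forall x, exists z, G (z, f x)).
Proof.
have [A [okA maxA]] := Zorn_bigcup ok_chain.
rewrite /= in okA; set B := A `|` G in okA.
have [sB funB rgB] := okA.
have totB x : exists y, B (x, y).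
  apply: contrapT => noy.
  (* The extension of [B] to the missing vector [x] by the value 0. *)
  pose B' : set (M * M') := [set p | exists z c, B (z, p.2) /\ p.1 = z + c *: x].
  have BB' : B `<=` B'.
    by move=> [z y] Bp; exists z, 0; split=> //=; rewrite scale0r addr0.
  apply: (maxA B'); last first.
    have eqB : B' `|` G = B'.
      by apply/seteqP; split=> [p [//|Gp]|p]; [apply/BB'; right | left].
    rewrite /= eqB; split.
    - split=> [|c [u v] [u' v'] [/= z [e [Bz ->]]] [/= z' [e' [Bz' ->]]]].
        exact: (BB' _ (subspace0 sB)).
      exists (c *: z + z'), (c * e + e'); split=> /=.
        by case: sB => _ /(_ c _ _ Bz Bz').
      by rewrite scalerDr scalerDl !scalerA addrACA.
    - move=> y [/= z [c [Bz]]].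
      have [->|c0] := eqVneq c 0.
        by rewrite scale0r addr0 => z0; apply: funB; rewrite z0.
      (* If [c] is nonzero, [x] is a multiple of [z] and so already has an image, against [noy]. *)
      move=> /eqP; rewrite eq_sym addrC addr_eq0 => /eqP cx; case: noy.
      exists ((- c^-1) *: y); have := subspaceZ (- c^-1) sB Bz.
      suff -> : - c^-1 *: (z, y) = (x, - c^-1 *: y) by [].
      by congr pair => /=; rewrite -[in LHS](opprK z) -cx scalerN scaleNr opprK scalerA mulVf ?scale1r.
    by move=> [u y] [/= z [c [Bz _]]]; have := rgB _ Bz.
  split; first by move=> p Ap; apply: BB'; left.
  move=> B'A; case: noy; exists 0; left; apply: B'A.
  exists 0, 1; split=> /=; first exact: (subspace0 sB).
  by rewrite scale1r add0r.
have [f fP] := choice totB.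
have Bu x y z : B (x, y) -> B (x, z) -> y = z.
  move=> By Bz; apply/eqP; rewrite -subr_eq0; apply/eqP/funB.
  by have := subspaceB sB By Bz; rewrite -[_ - _]/(x - x, y - z) subrr.
have [g gf] : exists g : {linear M -> M'}, g =1 f.
  apply: linear_funE => c x y; apply: Bu (fP _) _.
  by case: sB => _ /(_ c _ _ (fP x) (fP y)).
exists g; split=> [x y Gxy|x]; rewrite gf.
  by apply: Bu (fP x) _; right.
exact: rgB (fP x).
Qed.

End LinearExtension.

(** The graph extended is the identity of [S]; as no new values appear, the extension maps into
    [S]. *)
Lemma linear_projector (k : fieldType) (M : lmodType k) (S : set M) :
  is_subspace S ->
  exists p : {linear M -> M}, (forall x, S x -> p x = x) /\ (forall x, S (p x)).
Proof.
move=> [S0 SD]; pose G : set (M * M) := [set p | S p.1 /\ p.2 = p.1].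
have [||f [fG Gf]] := @linear_extension _ M M G.
- by split=> //= c [x y] [x' y'] [/= Sx ->] [/= Sx' ->]; split=> //=; apply: SD.
- by move=> y [].
exists f; split=> x; first by move=> Sx; apply: fG.
by have [z [/= Sz ->]] := Gf x.
Qed.

(** * Free modules and bilinear maps *)

Section MalgLinear.
Variables (B : nzRingType) (K : choiceType) (M : lmodType B).

(** The universal property of the free module on [K]. The ring is general because it is used over
    [k], for T(V), and over [A], for A (x) T(V). *)
Definition mlin (g : K -> M) (x : {malg B[K]}) : M := \sum_(w <- msupp x) x@_w *: g w.

Lemma mlinEw (g : K -> M) (d : {fset K}) x :
  (msupp x `<=` d)%fset -> mlin g x = \sum_(w <- d) x@_w *: g w.
Proof.
move=> le; rewrite /mlin; apply: big_fset_incl => // w _ /mcoeff_outdom ->.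
by rewrite scale0r.
Qed.

Lemma mlin_is_linear g : linear (mlin g).
Proof.
move=> c x y; pose d := (msupp x `|` msupp y)%fset.
rewrite !(@mlinEw _ d) ?fsubsetUl ?fsubsetUr //.
  by rewrite scaler_sumr -big_split; apply: eq_bigr => w _; rewrite mcoeffD mcoeffZ scalerDl scalerA.
apply: fsubset_trans (msuppD_le _ _) _.
by apply: fsetUSS => //; apply: msuppZ_le.
Qed.

HB.instance Definition _ g := GRing.isLinear.Build B {malg B[K]} M *:%R (mlin g) (mlin_is_linear g).

Lemma mlinU g c w : mlin g << c *g w >> = c *: g w.
Proof. by rewrite (mlinEw _ msuppU_le) big_seq_fset1 mcoeffUU. Qed.

Lemma mlinU1 g w : mlin g << w >> = g w.
Proof. by rewrite mlinU scale1r. Qed.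

Lemma malgUZ (c : B) (w : K) : << c *g w >> = c *: << w >> :> {malg B[K]}.
Proof. by apply/malgP => v; rewrite mcoeffZ !mcoeffU mulrnAr mulr1. Qed.

Lemma malg_lin_eq (f g : {linear {malg B[K]} -> M}) :
  (forall w, f << w >> = g << w >>) -> f =1 g.
Proof.
move=> fg x; rewrite [x]monalgE !linear_sum; apply: eq_bigr => w _.
by rewrite malgUZ !linearZ /= fg.
Qed.

Lemma malg_subspace (V : set {malg B[K]}) x :
  is_subspace V -> (forall w, w \in msupp x -> V << w >>) -> V x.
Proof.
move=> sV Vx; rewrite [x]monalgE; apply: subspace_sum => // w wx _.
by rewrite malgUZ; apply: subspaceZ => //; apply: Vx.
Qed.

End MalgLinear.

Section Bilinear.
Variables (k : pzRingType) (U V M : lmodType k).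

Definition bilin (g : U -> V -> M) : Prop :=
  (forall y, linear (g^~ y)) /\ (forall x, linear (g x)).

Lemma bilinDl g x x' y : bilin g -> g (x + x') y = g x y + g x' y.
Proof. by case=> /(_ y 1 x x'); rewrite !scale1r. Qed.

Lemma bilin0l g y : bilin g -> g 0 y = 0.
Proof. by move=> bg; apply: (addrI (g 0 y)); rewrite -bilinDl // !addr0. Qed.

Lemma bilinZl g c x y : bilin g -> g (c *: x) y = c *: g x y.
Proof. by move=> bg; case: (bg) => /(_ y c x 0) + _; rewrite bilin0l // !addr0. Qed.

Lemma bilinDr g x y y' : bilin g -> g x (y + y') = g x y + g x y'.
Proof. by case=> _ /(_ x 1 y y'); rewrite !scale1r. Qed.

Lemma bilin0r g x : bilin g -> g x 0 = 0.
Proof. by move=> bg; apply: (addrI (g x 0)); rewrite -bilinDr // !addr0. Qed.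

Lemma bilinZr g c x y : bilin g -> g x (c *: y) = c *: g x y.
Proof. by move=> bg; case: (bg) => _ /(_ x c y 0); rewrite bilin0r // !addr0. Qed.

Lemma bilin_sumr g (I : Type) (r : seq I) (F : I -> V) x :
  bilin g -> g x (\sum_(i <- r) F i) = \sum_(i <- r) g x (F i).
Proof.
move=> bg; elim: r => [|i r IH]; first by rewrite !big_nil bilin0r.
by rewrite !big_cons bilinDr // IH.
Qed.

End Bilinear.

Section LinearOnWords.
Variables (B : nzRingType) (K : choiceType) (M : lmodType B).

Lemma lin_ext (f g : {malg B[K]} -> M) : linear f -> linear g ->
  (forall w, f << w >> = g << w >>) -> f =1 g.
Proof.
move=> /linear_funE[f' ff'] /linear_funE[g' gg'] fg x.
by rewrite -ff' -gg'; apply: malg_lin_eq => w; rewrite ff' gg'.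
Qed.

End LinearOnWords.

Lemma bilin_ext (B : nzRingType) (K K' : choiceType) (M : lmodType B)
  (f g : {malg B[K]} -> {malg B[K']} -> M) :
  bilin f -> bilin g -> (forall u v, f << u >> << v >> = g << u >> << v >>) ->
  forall x y, f x y = g x y.
Proof.
move=> [fl fr] [gl gr] fg x y; apply: (lin_ext (fl y) (gl y)) => u.
exact: (lin_ext (fr << u >>) (gr << u >>) (fg u)).
Qed.

(** * Tensor products of subspaces of T(V) *)

Section Words.
Variables (k : fieldType) (X : choiceType).
Local Notation W := {fmonom X}.
Local Notation T := (tensalg k X).
Local Notation "W1 \ox W2" := (tprod W1 W2) (at level 40, left associativity).
Implicit Types (u v w : W) (t x y : T) (S V : set T).

Lemma wordP u v : u = v :> seq X -> u = v.
Proof. exact: val_inj. Qed.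

Lemma size_word_mul u v : size (u ** v) = (size u + size v)%N.
Proof. by rewrite fmM size_cat. Qed.

Lemma size_word_one : size (mone : W) = 0%N.
Proof. by rewrite fm1. Qed.

Lemma size_word_eq0 w : (size w == 0%N) = (w == mone).
Proof. by rewrite -fdeg_eq0. Qed.

Lemma wordM u v : << u >> * << v >> = << (u ** v) >> :> T.
Proof. by rewrite malgM_def fgmulUU mulr1. Qed.

Lemma tmulZr c x y : x * (c *: y) = c *: (x * y).
Proof.
have xC : x * c%:MP = c *: x.
  rewrite malgM_def fgmulgU malgZ_def; apply: eq_bigr => w _.
  by rewrite mulm1 mulrC.
by rewrite -(mul_malgC c y) mulrA xC -(scalerAl c x y).
Qed.

Lemma bilin_mul : bilin (fun x y : T => x * y).
Proof.
split=> [y c z z'|x c z z']; first by rewrite (mulrDl (c *: z)) -(scalerAl c z y).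
by rewrite (mulrDr x (c *: z)) tmulZr.
Qed.

Lemma tprod_mul S V x y : S x -> V y -> (S \ox V) (x * y).
Proof. by move=> Sx Vy; apply: sub_span; exists x => //; exists y. Qed.

Lemma subspace_tprod S V : is_subspace (S \ox V).
Proof. exact: subspace_span. Qed.

Lemma tprod_min S V Z : is_subspace Z -> (forall x y, S x -> V y -> Z (x * y)) ->
  S \ox V `<=` Z.
Proof. by move=> sZ SVZ; apply: span_min => // _ [x Sx [y Vy <-]]; apply: SVZ. Qed.

Lemma tprod_mono S S' V V' : S `<=` S' -> V `<=` V' -> S \ox V `<=` S' \ox V'.
Proof.
move=> SS' VV'; apply: tprod_min (subspace_tprod _ _) _ => x y Sx Vy.
by apply: tprod_mul; [apply: SS' | apply: VV'].
Qed.

Lemma linear_mull x c y z : x * (c *: y + z) = c *: (x * y) + x * z.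
Proof. exact: bilin_mul.2. Qed.

Lemma linear_mulr y c x z : (c *: x + z) * y = c *: (x * y) + z * y.
Proof. exact: bilin_mul.1. Qed.

Lemma subspace_mull x V : is_subspace V -> is_subspace [set y | V (x * y)].
Proof.
move=> [V0 VD]; split=> [|c y y' Vy Vy'] /=; first by rewrite mulr0.
by rewrite (linear_mull x c y y'); exact: (VD c _ _ Vy Vy').
Qed.

Lemma subspace_mulr y V : is_subspace V -> is_subspace [set x | V (x * y)].
Proof.
move=> [V0 VD]; split=> [|c x x' Vx Vx'] /=; first by rewrite mul0r.
by rewrite (linear_mulr y c x x'); exact: (VD c _ _ Vx Vx').
Qed.

Lemma tprodA S V Z : (S \ox V) \ox Z = S \ox (V \ox Z).
Proof.
apply/seteqP; split.
  apply: tprod_min (subspace_tprod _ _) _ => xy z.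
  have sP := subspace_mulr z (subspace_tprod S (V \ox Z)) => + Zz.
  move: xy; apply: tprod_min sP _ => x y Sx Vy /=.
  by rewrite -mulrA; apply/tprod_mul/tprod_mul.
apply: tprod_min (subspace_tprod _ _) _ => x yz Sx.
have sP := subspace_mull x (subspace_tprod (S \ox V) Z).
move: yz; apply: tprod_min sP _ => y z Vy Zz /=.
by rewrite mulrA; apply: tprod_mul => //; apply: tprod_mul.
Qed.

Lemma tscalP x : @tscal k X x <-> exists c, x = c%:A.
Proof.
split=> [|[c ->]]; last by apply: spanZ; apply: sub_span.
elim=> [|c u v -> _ [d ->]]; first by exists 0; rewrite scale0r.
by exists (c + d); rewrite scalerDl.
Qed.

Lemma tscal1 : @tscal k X 1.
Proof. exact: sub_span. Qed.

Lemma tprod_tscalr S : is_subspace S -> S \ox (@tscal k X) = S.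
Proof.
move=> sS; apply/seteqP; split=> [|x Sx]; last first.
  by rewrite -[x]mulr1; apply: tprod_mul tscal1.
apply: tprod_min => // x _ Sx /tscalP[c ->].
by rewrite tmulZr mulr1; apply: subspaceZ.
Qed.

Lemma tprod_tscall S : is_subspace S -> (@tscal k X) \ox S = S.
Proof.
move=> sS; apply/seteqP; split=> [|x Sx]; last first.
  by rewrite -[x]mul1r; apply: tprod_mul tscal1 _.
apply: tprod_min => // _ x /tscalP[c ->] Sx.
by rewrite -scalerAl mul1r; apply: subspaceZ.
Qed.

Definition wset (P : pred W) : set T := [set x | forall w, w \in msupp x -> P w].

Lemma wsetP P x : wset P x <-> forall w, ~~ P w -> x@_w = 0.
Proof.
split=> [Px w nPw|Px w]; last by apply: contraLR => /Px /eqP; rewrite mcoeff_eq0.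
by apply/eqP; rewrite mcoeff_eq0; apply: contra nPw; apply: Px.
Qed.

Lemma subspace_wset P : is_subspace (wset P).
Proof.
split=> [|c x y /wsetP Px /wsetP Py]; first by move=> w; rewrite msupp0.
by apply/wsetP => w nPw; rewrite mcoeffD mcoeffZ Px ?Py ?mulr0 ?addr0.
Qed.

Lemma wset_word (P : pred W) w : P w -> wset P << w >>.
Proof. by move=> Pw v; rewrite msuppU1 inE => /eqP->. Qed.

Lemma wset_min (P : pred W) V : is_subspace V ->
  (forall w, P w -> V << w >>) -> wset P `<=` V.
Proof. by move=> sV PV x Px; apply: malg_subspace => // w /Px; apply: PV. Qed.

Lemma wset_lin_eq (P : pred W) (M : lmodType k) (f g : T -> M) :
  linear f -> linear g -> (forall w, P w -> f << w >> = g << w >>) ->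
  forall x, wset P x -> f x = g x.
Proof.
move=> /linear_funE[f' ff'] /linear_funE[g' gg'] fg x Px.
apply/eqP; rewrite -subr_eq0 -ff' -gg'; apply/eqP.
pose h : {linear T -> M} := f' \- g'.
apply: (wset_min (subspace_ker h) _ Px) => w /fg /=.
by rewrite ff' gg' => ->; rewrite subrr.
Qed.

Lemma wset_mul (P Q Z : pred W) x y :
  (forall u v, P u -> Q v -> Z (u ** v)) -> wset P x -> wset Q y -> wset Z (x * y).
Proof.
move=> PQZ Px Qy; move: x Px; apply: wset_min => [|u Pu].
  exact: subspace_mulr (subspace_wset Z).
move: y Qy; apply: wset_min => [|v Qv]; first exact: subspace_mull (subspace_wset Z).
by rewrite /= wordM; apply/wset_word/PQZ.
Qed.

Definition len_eq (n : nat) : set T := wset [pred w : W | size w == n].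
Definition len_ge (n : nat) : set T := wset [pred w : W | (n <= size w)%N].

Lemma genVE : genV = len_eq 1.
Proof.
apply/seteqP; split.
  apply: span_min => [|_ [x _ <-]]; first exact: subspace_wset.
  by apply: wset_word; rewrite /= fmU.
apply: wset_min => [|[[|x []]] //= _]; first exact: subspace_span.
by apply: sub_span; exists x => //; congr << _ >>; apply/wordP; rewrite fmU.
Qed.

Lemma tscalE : @tscal k X = len_eq 0.
Proof.
apply/seteqP; split=> [x /tscalP[c ->]|].
  by apply: (subspaceZ c (subspace_wset _)); apply: wset_word; rewrite /= fm1.
apply: wset_min => [|w /=]; first exact: subspace_span.
by rewrite size_word_eq0 => /eqP->; apply: tscal1.
Qed.

Lemma tpow_genV n : tpow genV n = len_eq n.
Proof.
elim: n => [|n IH]; first exact: tscalE.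
rewrite /tpow iterS -/(tpow genV n) IH genVE; apply/seteqP; split.
  apply: tprod_min => [|x y x1 yn]; first exact: subspace_wset.
  apply: wset_mul x1 yn => u v /= /eqP u1 /eqP v1.
  by rewrite size_word_mul u1 v1.
apply: wset_min => [|[[|a s]] //= /eqP[sz]]; first exact: subspace_span.
have -> : FMonom (a :: s) = (FMonom [:: a] ** FMonom s) by apply/wordP; rewrite fmM.
by rewrite -wordM; apply: tprod_mul; apply: wset_word => //=; apply/eqP.
Qed.

Lemma tens_geE n : tens_ge n = len_ge n :> set T.
Proof.
apply/seteqP; split.
  apply: span_min => [|x [m /= nm]]; first exact: subspace_wset.
  by rewrite tpow_genV => xm w /xm /= /eqP ->.
apply: wset_min => [|w /= nw]; first exact: subspace_span.
by apply: sub_span; exists (size w) => //; rewrite tpow_genV; apply: wset_word => /=.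
Qed.

Lemma len_eq_ge n m : (m <= n)%N -> len_eq n `<=` len_ge m.
Proof. by move=> mn x xn w /xn /= /eqP ->. Qed.

Lemma len_ge_mul n m x y : len_ge n x -> len_ge m y -> len_ge (n + m) (x * y).
Proof.
by apply: wset_mul => u v /= nu mv; rewrite size_word_mul leq_add.
Qed.

Lemma len_eq_mul n m x y : len_eq n x -> len_eq m y -> len_eq (n + m) (x * y).
Proof.
by apply: wset_mul => u v /= /eqP<- /eqP<-; rewrite size_word_mul.
Qed.

Lemma len_ge0 x : len_ge 0 x.
Proof. by []. Qed.

End Words.

Lemma bilin_comp (k : pzRingType) (U V M N : lmodType k) (f : {linear M -> N})
  (g : U -> V -> M) : bilin g -> bilin (fun x y => f (g x y)).
Proof. by move=> [gl gr]; split=> [y|x] c u v; rewrite ?gl ?gr linearP. Qed.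

Lemma bilin_precomp (k : pzRingType) (U V U' V' M : lmodType k) (f : {linear U' -> U})
    (h : {linear V' -> V}) (g : U -> V -> M) :
  bilin g -> bilin (fun x y => g (f x) (h y)).
Proof. by move=> [gl gr]; split=> [y|x] c u v; rewrite linearP ?gl ?gr. Qed.

Lemma linear_comp (k : pzRingType) (U V M : lmodType k) (f : V -> M) (g : U -> V) :
  linear f -> linear g -> linear (fun x => f (g x)).
Proof. by move=> lf lg c x y; rewrite lg lf. Qed.

Lemma linear_sub (k : comPzRingType) (U M : lmodType k) (f g : U -> M) :
  linear f -> linear g -> linear (fun x => f x - g x).
Proof. by move=> lf lg c x y; rewrite lg lf opprD scalerBr addrACA. Qed.

Lemma mlin_linear_fun (B : comNzRingType) (K : choiceType) (N M : lmodType B)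
    (g : N -> K -> M) (x : {malg B[K]}) :
  (forall w, linear (g^~ w)) -> linear (fun b => mlin (g b) x).
Proof.
move=> lg c u v; rewrite /mlin scaler_sumr -big_split; apply: eq_bigr => w _ /=.
by rewrite lg scalerDr !scalerA mulrC.
Qed.

(** * Injectivity of the multiplication T(V) (x) S -> T(V) *)

Section LeftFree.
Variables (k : fieldType) (X : choiceType).
Local Notation W := {fmonom X}.
Local Notation T := (tensalg k X).
Local Notation TT := {malg k[(W * W)%type]}.
Local Notation "W1 \ox W2" := (tprod W1 W2) (at level 40, left associativity).
Implicit Types (u v w : W) (t x : T) (S V : set T) (y : TT).

(** The free module on pairs of words is the model of T(V) (x) T(V), and [ten] gives its pure
    tensors. *)
Definition ten (t s : T) : TT := mlin (fun u => mlin (fun v => << (u, v) >>) s) t.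

Lemma bilin_ten : bilin ten.
Proof.
split=> [s|t]; first exact: linearP.
by apply: mlin_linear_fun => w c s s'; rewrite linearP.
Qed.

Lemma tenU u v : ten << u >> << v >> = << (u, v) >>.
Proof. by rewrite /ten !(@mlinU1 k). Qed.

Definition ev2 (M : lmodType k) (g : T -> T -> M) : TT -> M :=
  mlin (fun p => g << p.1 >> << p.2 >>).

HB.instance Definition _ (M : lmodType k) (g : T -> T -> M) :=
  GRing.isLinear.Build k TT M *:%R (@ev2 M g) (mlin_is_linear _).

Lemma ev2U (M : lmodType k) (g : T -> T -> M) u v : ev2 g << (u, v) >> = g << u >> << v >>.
Proof. exact: mlinU1. Qed.

Lemma ev2_ten (M : lmodType k) (g : T -> T -> M) t s : bilin g -> ev2 g (ten t s) = g t s.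
Proof.
move=> bg; move: t s; apply: bilin_ext => //; first exact: bilin_comp bilin_ten.
by move=> u v; rewrite tenU ev2U.
Qed.

(* The multiplication T (x) S -> T is injective; [Theta] is its inverse. *)
Definition lfree (S : set T) : Prop :=
  exists Theta : {linear T -> TT}, forall t s, S s -> Theta (t * s) = ten t s.

Lemma lfree_ext S (M : lmodType k) (g : T -> T -> M) : lfree S -> bilin g ->
  exists f : {linear T -> M}, forall t s, S s -> f (t * s) = g t s.
Proof.
move=> [Th ThE] bg; exists (ev2 g \o Th) => t s Ss /=.
by rewrite ThE // ev2_ten.
Qed.

Lemma lfree_mono S V : S `<=` V -> lfree V -> lfree S.
Proof. by move=> SV [Th ThE]; exists Th => t s /SV; apply: ThE. Qed.

(** The product t a b is undone from the right: freeness of [V] recovers t a and b, the inverse for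
    [S] then recovers t and a, and the outcome is t (x) a b. *)
Lemma lfree_tprod S V : lfree S -> lfree V -> lfree (S \ox V).
Proof.
move=> [Th ThE] fV.
pose g x b := ev2 (fun r a : T => ten r (a * b)) (Th x).
have bT b : bilin (fun r a : T => ten r (a * b)).
  split=> [a c r r'|r c a a']; first exact: bilin_ten.1.
  by rewrite (linear_mulr b c a a') (bilin_ten.2 r c).
have bg : bilin g.
  split=> [b c x x'|x]; first by rewrite /g linearP linearP.
  rewrite /g; apply: mlin_linear_fun => -[u a] c b b' /=.
  by rewrite (linear_mull _ c b b') (bilin_ten.2 _ c).
have [f fE] := lfree_ext fV bg; exists f => t s.
pose h1 : T -> TT := fun s => f (t * s).
have [h hE] : exists h : {linear T -> TT}, h =1 h1.
  by apply: linear_funE => c a b; rewrite /h1 (linear_mull t c a b) linearP.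
have [h' h'E] : exists h : {linear T -> TT}, h =1 ten t.
  exact: linear_funE (bilin_ten.2 t).
rewrite -[f _]/(h1 s) -hE -h'E; apply: span_lin_eq => _ [a Sa [b Vb <-]].
rewrite hE h'E /h1 mulrA fE // /g ThE // (ev2_ten t a (bT b)) //.
Qed.

Definition slice v : TT -> T :=
  mlin (fun p : W * W => if p.1 == v then << p.2 >> else 0).

HB.instance Definition _ v := GRing.isLinear.Build k TT T *:%R (slice v) (mlin_is_linear _).

Definition mulTT : TT -> T := ev2 (fun x y : T => x * y).

HB.instance Definition _ := GRing.isLinear.Build k TT T *:%R mulTT (mlin_is_linear _).

Lemma mulTT_ten t s : mulTT (ten t s) = t * s.
Proof. exact: ev2_ten (bilin_mul k X). Qed.

Lemma sliceU v u w : slice v << (u, w) >> = if u == v then << w >> else 0.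
Proof. exact: mlinU1. Qed.

Lemma slice_ten v t s : slice v (ten t s) = t@_v *: s.
Proof.
move: t s; apply: bilin_ext => [||u w]; first exact: bilin_comp bilin_ten.
  split=> [s c t t'|t c s s']; first by rewrite mcoeffD mcoeffZ scalerDl scalerA.
  by rewrite scalerDr !scalerA mulrC.
by rewrite tenU sliceU mcoeffU1; case: eqP => _; rewrite ?scale1r ?scale0r.
Qed.

Lemma mcoeff_slice y v w : (slice v y)@_w = y@_(v, w).
Proof.
have lin_mcoeff (K : choiceType) (p : K) : linear (fun z : {malg k[K]} => z@_p : k^o).
  by move=> c z z'; rewrite mcoeffD mcoeffZ.
apply: (@lin_ext k _ k^o (fun y => (slice v y)@_w) (fun y => y@_(v, w))).
- exact: (linear_comp (lin_mcoeff _ _) (linearP (slice v))).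
- exact: lin_mcoeff.
move=> -[a b]; rewrite sliceU [RHS]mcoeffU xpair_eqE; case: (a == v); last by rewrite mcoeff0.
by rewrite mcoeffU.
Qed.

Lemma slice_decomp y : exists2 D : {fset W}, mone \in D &
  y = \sum_(v <- D) ten << v >> (slice v y).
Proof.
pose D := (mone |` [fset p.1 | p in msupp y])%fset.
exists D; first by rewrite !inE eqxx.
have inD p : p \in msupp y -> p.1 \in D.
  by move=> yp; rewrite !inE; apply/orP; right; apply/imfsetP; exists p.
rewrite {1}[y]monalgE; under [RHS]eq_bigr => v _.
  rewrite {1}[y]monalgE linear_sum (bilin_sumr _ _ _ bilin_ten); over.
rewrite exchange_big /= [LHS]big_seq [RHS]big_seq; apply: eq_bigr => -[u w] yp.
rewrite malgUZ; under eq_bigr => v _.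
  rewrite linearZ /= (bilinZr _ _ _ bilin_ten) sliceU; over.
rewrite (big_fsetD1 u) ?(inD (u, w)) //= eqxx tenU big1_fset ?addr0 // => v.
rewrite inE => /andP[/negPf]; rewrite eq_sym inE => -> _ _.
by rewrite (bilin0r _ bilin_ten) scaler0.
Qed.

Definition lstrip (a : X) : T -> T :=
  mlin (fun w : W => if w is FMonom (b :: s) then
                       if b == a then << FMonom s >> else 0 else 0).

HB.instance Definition _ a := GRing.isLinear.Build k T T *:%R (lstrip a) (mlin_is_linear _).

Definition lstripTT (a : X) : TT -> TT :=
  mlin (fun p : W * W => if p.1 is FMonom (b :: s) then
                       if b == a then << (FMonom s, p.2) >> else 0 else 0).

HB.instance Definition _ a := GRing.isLinear.Build k TT TT *:%R (lstripTT a) (mlin_is_linear _).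

Lemma lstripU a (w : W) : lstrip a << w >> = 
  if w is FMonom (b :: s) then if b == a then << FMonom s >> else 0 else 0.
Proof. exact: mlinU1. Qed.

Lemma lstripTTU a (u w : W) : lstripTT a << (u, w) >> = 
  if u is FMonom (b :: s) then if b == a then << (FMonom s, w) >> else 0 else 0.
Proof. exact: mlinU1. Qed.

(** Stripping a letter from the left factor commutes with multiplication, except on terms whose left
    word is empty, where the product starts with a letter of the right factor. *)
Lemma mulTT_lstrip a y :
  mulTT (lstripTT a y) = lstrip a (mulTT y) - lstrip a (slice mone y).
Proof.
apply: (@lin_ext k _ _ (fun y => mulTT (lstripTT a y))
  (fun y => lstrip a (mulTT y) - lstrip a (slice mone y))).
- exact: (linear_comp (f := mulTT) (g := lstripTT a) (linearP _) (linearP _)).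
- apply: linear_sub.
    exact: (linear_comp (f := lstrip a) (g := mulTT) (linearP _) (linearP _)).
  exact: (linear_comp (f := lstrip a) (g := slice mone) (linearP _) (linearP _)).
move=> -[[[|b s]] w].
  rewrite lstripTTU linear0 sliceU.
  have -> : FMonom [::] = mone :> W by apply/wordP; rewrite fm1.
  by rewrite eqxx -tenU mulTT_ten wordM mul1m subrr.
rewrite lstripTTU sliceU.
have -> : (FMonom (b :: s) == mone) = false.
  by rewrite -size_word_eq0.
rewrite linear0 subr0 -(tenU (FMonom (b :: s))) mulTT_ten wordM.
have -> : FMonom (b :: s) ** w = FMonom (b :: s ++ w) by apply/wordP; rewrite fmM.
rewrite lstripU; case: eqP => _; last by rewrite linear0.
rewrite -tenU mulTT_ten wordM; congr << _ >>.
by apply/wordP; rewrite fmM.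
Qed.

Lemma slice_lstrip a s y : slice (FMonom s) (lstripTT a y) = slice (FMonom (a :: s)) y.
Proof.
apply: (@lin_ext k _ _ (fun y => slice (FMonom s) (lstripTT a y)) (slice (FMonom (a :: s)))).
- exact: (linear_comp (f := slice (FMonom s)) (g := lstripTT a) (linearP _) (linearP _)).
- exact: linearP.
move=> -[[[|b s']] w]; rewrite lstripTTU sliceU /=; first by rewrite linear0.
rewrite -val_eqE /= eqseq_cons; case: eqP => _ /=; last by rewrite linear0.
by rewrite sliceU -val_eqE.
Qed.

(** Let y = sum_v v (x) s_v be killed by multiplication. Then s_1 is minus the sum of the v s_v with
    v nonempty, so it lies in S and in T_+ S and vanishes. Stripping a letter a from the left
    factors now gives another element killed by multiplication, with components s_(a v), and
    induction on the length of v gives y = 0. *)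
Lemma lfree_criterion S : is_subspace S ->
  (forall s, S s -> (@len_ge k X 1 \ox S) s -> s = 0) -> lfree S.
Proof.
move=> sS minS.
have row1 y : (forall v, S (slice v y)) -> mulTT y = 0 -> slice mone y = 0.
  move=> Sy my0; apply: minS => //.
  have [D D1 yE] := slice_decomp y.
  have E0 : \sum_(v <- D) << v >> * slice v y = 0.
    rewrite -[RHS]my0 [in RHS]yE linear_sum; apply: eq_bigr => v _.
    exact/esym/mulTT_ten.
  rewrite (big_fsetD1 mone D1) in E0; rewrite (mul1r (slice mone y)) in E0.
  rewrite -(opprK (slice mone y)) (addr0_eq E0).
  apply: (subspaceN (subspace_tprod _ _)).
  apply: (subspace_sum (subspace_tprod _ _)) => v; rewrite !inE => /andP[v1 _] _.
  apply: tprod_mul => //; apply: wset_word => /=.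
  by rewrite lt0n size_word_eq0.
have inj n : forall y, (forall v, S (slice v y)) -> mulTT y = 0 ->
    forall v, size v = n -> slice v y = 0.
  elim: n => [|n IH] y Sy my0 v.
    by move=> /eqP; rewrite size_word_eq0 => /eqP->; apply: row1.
  case: v => -[|a s] sz; first discriminate sz.
  have E := slice_lstrip a s y.
  rewrite -E.
  apply: (IH _ _ _ (FMonom s) (succn_inj sz)) => [[v]|]; first by have -> := slice_lstrip a v y.
  by rewrite mulTT_lstrip my0 (row1 y Sy my0) subrr.
(* By the injectivity just proved, the inverse of multiplication is the graph of a linear map on T
   S. *)
pose G : set (T * TT) := [set p | (forall v, S (slice v p.2)) /\ p.1 = mulTT p.2].
have [||f [fG _]] := @linear_extension _ _ _ G.
- split=> [|c [x y] [x' y'] [/= Sy ->] [/= Sy' ->]].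
    by split=> [v|] /=; rewrite linear0 //; apply: subspace0.
  split=> [v|] /=; rewrite linearP //.
  exact: (sS.2 c _ _ (Sy v) (Sy' v)).
- move=> y [/= Sy my0]; apply/malgP => -[v w].
  by rewrite -mcoeff_slice (inj (size v)) // !mcoeff0.
exists f => t s Ss; apply: fG; split=> [v|] /=; last by rewrite mulTT_ten.
by rewrite slice_ten; apply: subspaceZ.
Qed.

End LeftFree.

Lemma lin_fun0 (k : pzRingType) (N N' : lmodType k) (f : N -> N') : linear f -> f 0 = 0.
Proof. by move=> /linear_funE[g gf]; rewrite -gf linear0. Qed.

Lemma lin_fun_sum (k : pzRingType) (N N' : lmodType k) (f : N -> N') (I : Type)
  (r : seq I) (G : I -> N) : linear f -> f (\sum_(i <- r) G i) = \sum_(i <- r) f (G i).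
Proof. by move=> /linear_funE[g gf]; rewrite -gf linear_sum; apply: eq_bigr. Qed.

Lemma lin_funB (k : pzRingType) (N N' : lmodType k) (f : N -> N') x y :
  linear f -> f (x - y) = f x - f y.
Proof. by move=> /linear_funE[g gf]; rewrite -!gf linearB. Qed.

Lemma lin_funD (k : pzRingType) (N N' : lmodType k) (f : N -> N') x y :
  linear f -> f (x + y) = f x + f y.
Proof. by move=> /linear_funE[g gf]; rewrite -!gf linearD. Qed.

Lemma lin_funZ (k : pzRingType) (N N' : lmodType k) (f : N -> N') c x :
  linear f -> f (c *: x) = c *: f x.
Proof. by move=> lf; have := lf c x 0; rewrite (lin_fun0 lf) !addr0. Qed.

Lemma linear_idfun (k : pzRingType) (N : lmodType k) : linear (@id N).
Proof. by []. Qed.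

Lemma linear_zero (k : pzRingType) (N N' : lmodType k) : linear (fun _ : N => 0 : N').
Proof. by move=> c x y; rewrite scaler0 addr0. Qed.

Lemma subspace_cut (k : fieldType) (N : lmodType k) (U1 U2 : set N) :
  is_subspace U1 -> is_subspace U2 -> (forall x, U1 x -> U2 x -> x = 0) ->
  exists q : {linear N -> N}, (forall x, U1 x -> q x = x) /\ (forall x, U2 x -> q x = 0).
Proof.
move=> s1 s2 U12; pose G : set (N * N) := [set p | U1 p.2 /\ U2 (p.1 - p.2)].
have [||f [fG _]] := @linear_extension _ _ _ G.
- split=> [|c [x y] [x' y'] [/= Uy Uxy] [/= Uy' Uxy']] /=.
    by split; rewrite /= ?subr0; apply: subspace0.
  split; first exact: (s1.2 c _ _ Uy Uy').
  have := s2.2 c _ _ Uxy Uxy'.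
  by rewrite scalerBr addrACA -opprD.
- move=> y [/= Uy]; rewrite sub0r => /(subspaceN s2); rewrite opprK; exact: U12.
exists f; split=> x Ux; apply: fG; split=> //=; rewrite ?subrr ?subr0 //.
  exact: subspace0.
exact: subspace0.
Qed.

(** * Intersections of products of subspaces *)

Section FreeIntersections.
Variables (k : fieldType) (X : choiceType).
Local Notation W := {fmonom X}.
Local Notation T := (tensalg k X).
Local Notation "W1 \ox W2" := (tprod W1 W2) (at level 40, left associativity).
Implicit Types (u v w : W) (x y z : T) (S V M : set T).

Lemma tprod_lin_eq (N : lmodType k) (f g : T -> N) S V : linear f -> linear g ->
  (forall x y, S x -> V y -> f (x * y) = g (x * y)) ->
  forall x, (S \ox V) x -> f x = g x.
Proof.
move=> /linear_funE[f' ff'] /linear_funE[g' gg'] fg x SVx.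
rewrite -ff' -gg'; move: x SVx; apply: span_lin_eq => _ [x Sx [y Vy <-]].
by rewrite ff' gg'; apply: fg.
Qed.

Lemma tprod_linear_image (N : lmodType k) (f : T -> N) S V (Z : set N) :
  linear f -> is_subspace Z ->
  (forall x y, S x -> V y -> Z (f (x * y))) -> forall x, (S \ox V) x -> Z (f x).
Proof.
move=> /linear_funE[f' ff'] sZ SVZ x SVx; rewrite -ff'; move: x SVx.
by apply: span_linear_image => // _ [x Sx [y Vy <-]]; rewrite ff'; apply: SVZ.
Qed.

Lemma bilin_mul_lin (f g : {linear T -> T}) : bilin (fun x y => f x * g y).
Proof. exact: bilin_precomp (bilin_mul k X). Qed.

(* Inside T (x) M: (U (x) M) /\ (T (x) S) = U (x) S for S in M. *)
Lemma lfree_inter U S M : lfree M -> is_subspace S -> S `<=` M ->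
  (U \ox M) `&` (setT \ox S) `<=` U \ox S.
Proof.
move=> fM sS SM x [UMx TSx].
have [q [qS Sq]] := linear_projector sS.
have [f fE] := lfree_ext fM (bilin_mul_lin idfun q).
have <- : f x = x.
  move: x TSx {UMx}; apply: tprod_lin_eq; [exact: linearP | exact: linear_idfun |].
  by move=> t s _ Ss; rewrite fE /= ?qS //; apply: SM.
move: x UMx {TSx}.
apply: (tprod_linear_image (f := f) (Z := U \ox S)); [exact: linearP | exact: subspace_tprod |].
by move=> u m Uu Mm; rewrite fE //; exact: (tprod_mul Uu (Sq m)).
Qed.

(** Take q equal to 1 on [U1] and to 0 on [U2]. Since T (x) M embeds in T(V), q (x) 1 is defined
    there; it fixes U1 M and kills U2 M. *)
Lemma lfree_disjoint U1 U2 M : lfree M -> is_subspace U1 -> is_subspace U2 ->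
  (forall x, U1 x -> U2 x -> x = 0) ->
  forall x, (U1 \ox M) x -> (U2 \ox M) x -> x = 0.
Proof.
move=> fM s1 s2 U12 x U1x U2x.
have [q [q1 q2]] := subspace_cut s1 s2 U12.
have [f fE] := lfree_ext fM (bilin_mul_lin q idfun).
have <- : f x = x.
  move: x U1x {U2x}; apply: tprod_lin_eq; [exact: linearP | exact: linear_idfun |].
  by move=> t s Ut Ms; rewrite (fE t s Ms) (q1 t Ut).
move: x U2x {U1x}.
apply: (tprod_lin_eq (g := fun _ => 0)); [exact: linearP | exact: linear_zero |].
move=> t s Ut Ms; rewrite (fE t s Ms) (q2 t Ut); exact: mul0r.
Qed.

Lemma tprod3_linear_image (N : lmodType k) (f : T -> N) S V U (Z : set N) :
  linear f -> is_subspace Z ->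
  (forall x y z, S x -> V y -> U z -> Z (f (x * y * z))) ->
  forall x, (S \ox V \ox U) x -> Z (f x).
Proof.
move=> lf sZ SVUZ; apply: (tprod_linear_image (f := f) (Z := Z)) => // x z SVx Uz.
pose g x := f (x * z).
have lg : linear g by move=> c a b; rewrite /g (linear_mulr z c a b) lf.
rewrite -/(g x); move: x SVx; apply: (tprod_linear_image (f := g) (Z := Z)) => // x y Sx Vy.
exact: SVUZ.
Qed.

Lemma tprod3_lin_eq (N : lmodType k) (f g : T -> N) S V U : linear f -> linear g ->
  (forall x y z, S x -> V y -> U z -> f (x * y * z) = g (x * y * z)) ->
  forall x, (S \ox V \ox U) x -> f x = g x.
Proof.
move=> lf lg fg x SVUx; apply/eqP; rewrite -subr_eq0; apply/eqP.
have s0 : is_subspace [set 0 : N].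
  by split=> // c a b /= -> ->; rewrite scaler0 addr0.
move: x SVUx; apply: (tprod3_linear_image (Z := [set 0]) (linear_sub lf lg) s0).
by move=> x y z Sx Vy Uz /=; rewrite fg // subrr.
Qed.

Definition trilin (M : lmodType k) (g : T -> T -> T -> M) : Prop :=
  [/\ forall y z, linear (fun x => g x y z), forall x z, linear (fun y => g x y z)
    & forall x y, linear (g x y)].

(* The map V^(l) (x) T (x) V^(r) -> M induced by a trilinear map. *)
Definition ext3 (M : lmodType k) (l r : nat) (g : T -> T -> T -> M) : T -> M :=
  mlin (fun w : W => if (l + r <= size w)%N then
    g << FMonom (take l w) >> << FMonom (drop l (take (size w - r) w)) >>
      << FMonom (drop (size w - r) w) >> else 0).

Lemma linear_ext3 (M : lmodType k) l r (g : T -> T -> T -> M) : linear (ext3 l r g).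
Proof. exact: linearP. Qed.

Lemma ext3_word (M : lmodType k) (g : T -> T -> T -> M) u v w :
  ext3 (size u) (size w) g << u ** v ** w >> = g << u >> << v >> << w >>.
Proof.
rewrite /ext3 (@mlinU1 k) !size_word_mul addnK leq_add2r leq_addr !fmM.
have -> : take (size u) ((u ++ v) ++ w) = u by rewrite -catA take_size_cat.
rewrite -size_cat take_size_cat // drop_size_cat // drop_size_cat //.
by case: u v w => [u] [v] [w].
Qed.

Lemma ext3_mul (M : lmodType k) l r (g : T -> T -> T -> M) x y z : trilin g ->
  @len_eq k X l x -> @len_eq k X r z -> ext3 l r g (x * y * z) = g x y z.
Proof.
move=> [g1 g2 g3] lx rz.
move: x lx; apply: wset_lin_eq => //.
  move=> c a b; rewrite (linear_mulr y c a b) (linear_mulr z c (a * y) (b * y)).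
  exact: linear_ext3.
move=> u /= /eqP <-.
apply: (@lin_ext k _ _ (fun y => ext3 (size u) r g (<< u >> * y * z)) (fun y => g << u >> y z)) => //.
  move=> c a b; rewrite (linear_mull _ c a b) (linear_mulr z c _ _).
  exact: linear_ext3.
move=> v; move: z rz; apply: wset_lin_eq => //.
  move=> c a b; rewrite (linear_mull _ c a b); exact: linear_ext3.
by move=> w /= /eqP <-; rewrite !wordM ext3_word.
Qed.

Lemma trilin_mid (f : {linear T -> T}) : trilin (fun x y z => x * f y * z).
Proof.
split=> [y z c a b|x z c a b|x y c a b].
- by rewrite (linear_mulr (f y) c a b) (linear_mulr z c (a * f y)).
- by rewrite linearP (linear_mull x c (f a)) (linear_mulr z c (x * f a)).
- exact: linear_mull.
Qed.

(** [V'] is a complement of the intersection in V, hence meets S in 0. A map q fixing S and killing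
    [V'] sends V into the intersection. So 1 (x) q (x) 1 fixes the first space and sends the second
    into the desired one. *)
Lemma len_eq_inter l r S V : is_subspace S -> is_subspace V ->
  (@len_eq k X l \ox S \ox @len_eq k X r) `&` (@len_eq k X l \ox V \ox @len_eq k X r)
    `<=` @len_eq k X l \ox (S `&` V) \ox @len_eq k X r.
Proof.
move=> sS sV x [Sx Vx]; have sSV := subspaceI sS sV.
have [p [pSV SVp]] := linear_projector sSV.
pose V' := [set z | V z /\ p z = 0].
have sV' : is_subspace V' := subspaceI sV (subspace_ker p).
have [z Sz [Vz pz]|q [qS qV']] := subspace_cut sS sV'.
  by rewrite -pz pSV.
have qV z : V z -> (S `&` V) (q z).
  move=> Vz; have -> : q z = p z; last exact: SVp.
  apply/eqP; rewrite -subr_eq0 -(qS (p z)); last by case: (SVp z).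
  rewrite -linearB qV' //; split; last by rewrite linearB (pSV (p z)) ?subrr.
  by apply: (subspaceB sV Vz); case: (SVp z).
pose Q : T -> T := ext3 l r (fun x y z => x * q y * z).
have lQ : linear Q := @linear_ext3 _ l r _.
have QE a b c : @len_eq k X l a -> @len_eq k X r c -> Q (a * b * c) = a * q b * c.
  exact: ext3_mul (trilin_mid q).
have <- : Q x = x.
  move: x Sx {Vx}; apply: tprod3_lin_eq; [exact: lQ | exact: linear_idfun |].
  by move=> a b c la Sb rc; rewrite (QE a b c la rc) (qS b Sb).
move: x Vx {Sx}; apply: (tprod3_linear_image (f := Q) (Z := _ \ox _ \ox _)).
- exact: lQ.
- exact: subspace_tprod.
move=> a b c la Vb rc; rewrite (QE a b c la rc).
exact: (tprod_mul (tprod_mul la (qV b Vb)) rc).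
Qed.

End FreeIntersections.

(** * The grading of T(V) by degree and its graded subspaces *)

Section Grading.
Variables (k : fieldType) (X : choiceType) (deg : X -> nat).
Local Notation W := {fmonom X}.
Local Notation T := (tensalg k X).
Local Notation "W1 \ox W2" := (tprod W1 W2) (at level 40, left associativity).
Implicit Types (u v w : W) (x y : T) (S V : set T) (n : nat).

Lemma word_degM u v : word_deg deg (u ** v) = (word_deg deg u + word_deg deg v)%N.
Proof. by rewrite /word_deg fmM big_cat. Qed.

Lemma word_deg1 : word_deg deg mone = 0%N.
Proof. by rewrite /word_deg fm1 big_nil. Qed.

Definition cmp n : T -> T := mlin (fun w : W => if word_deg deg w == n then << w >> else 0).

Lemma linear_cmp n : linear (cmp n).
Proof. exact: linearP. Qed.

HB.instance Definition _ n := GRing.isLinear.Build k T T *:%R (cmp n) (linear_cmp n).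

Lemma cmpU n w : cmp n << w >> = if word_deg deg w == n then << w >> else 0.
Proof. exact: mlinU1. Qed.

Lemma mcoeff_cmp n x w : (cmp n x)@_w = if word_deg deg w == n then x@_w else 0.
Proof.
pose f (P : bool) : T -> k^o := fun x => if P then x@_w else 0.
have lf P : linear (f P).
  move=> c a b; rewrite /f; case: P; last by rewrite scaler0 addr0.
  by rewrite mcoeffD mcoeffZ.
apply: (@lin_ext k _ k^o (fun x => f true (cmp n x)) (f (word_deg deg w == n))).
- exact: (linear_comp (lf true) (linear_cmp n)).
- exact: lf.
move=> v; rewrite cmpU /f; case: (eqVneq v w) => [->|vw].
  by case: ifP => // _; rewrite mcoeff0.
have v0 : (<< v >> : T)@_w = 0 by rewrite mcoeffU (negPf vw).
by rewrite v0 if_same; case: ifP; rewrite ?mcoeff0.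
Qed.

Lemma homog_cmp n x : homog deg n%:Z (cmp n x).
Proof.
move=> w; rewrite -mcoeff_neq0 mcoeff_cmp.
by have [->|_] := eqVneq (word_deg deg w) n; rewrite ?eqxx.
Qed.

Lemma cmp_homog n m x : homog deg m x -> cmp n x = if n%:Z == m then x else 0.
Proof.
move=> mx; apply/malgP => w; rewrite mcoeff_cmp.
have [/eqP x0|xw] := boolP (x@_w == 0).
  by rewrite x0 if_same; case: ifP => _; rewrite ?mcoeff0 ?x0.
have /mx <- : w \in msupp x by rewrite -mcoeff_neq0.
by rewrite eqz_nat eq_sym; case: eqP => // _; rewrite mcoeff0.
Qed.

Lemma cmp_sum x : exists N, x = \sum_(n < N) cmp n x.
Proof.
pose N := (\max_(w <- msupp x) word_deg deg w).+1.
exists N; apply/malgP => w; rewrite raddf_sum /=.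
under eq_bigr do rewrite mcoeff_cmp.
have [/eqP x0|xw] := boolP (x@_w == 0).
  by rewrite big1 // => i _; rewrite x0 if_same.
have wN : (word_deg deg w < N)%N.
  rewrite ltnS; rewrite mcoeff_neq0 in xw.
  by rewrite (big_fsetD1 w) //= leq_maxl.
rewrite (bigD1 (Ordinal wN)) //= eqxx big1 ?addr0 // => i.
by rewrite -val_eqE /= eq_sym => /negPf ->.
Qed.

Definition graded V := forall n x, V x -> V (cmp n x).

Lemma graded_span S : (forall n x, S x -> span S (cmp n x)) -> graded (span S).
Proof.
move=> gS n; apply: (span_linear_image (f := cmp n)); first exact: subspace_span.
exact: gS.
Qed.

Lemma gradedI S V : graded S -> graded V -> graded (S `&` V).
Proof. by move=> gS gV n x [Sx Vx]; split; [exact: gS | exact: gV]. Qed.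

Lemma cmpM n x y : cmp n (x * y) = \sum_(p < n.+1) cmp p x * cmp (n - p) y.
Proof.
move: x y; apply: bilin_ext.
- exact: (bilin_comp (cmp n) (bilin_mul k X)).
- have bp (p : 'I_n.+1) := bilin_mul_lin (cmp p) (cmp (n - p)).
  split=> [y|x] c a b; rewrite scaler_sumr -big_split; apply: eq_bigr => p _.
    exact: ((bp p).1 y c a b).
  exact: ((bp p).2 x c a b).
move=> u v; rewrite wordM cmpU word_degM.
under eq_bigr do rewrite !cmpU.
have [E|NE] := eqVneq.
  have un : (word_deg deg u < n.+1)%N by rewrite ltnS -E leq_addr.
  rewrite (bigD1 (Ordinal un)) //= eqxx -{1}E addKn eqxx wordM big1 ?addr0 // => i.
  by rewrite -val_eqE /= eq_sym => /negPf ->; rewrite mul0r.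
rewrite big1 // => p _; case: eqP => [Eu|]; last by rewrite mul0r.
case: eqP => [Ev|]; last by rewrite mulr0.
by move: NE; rewrite Eu Ev subnKC ?eqxx // -ltnS.
Qed.

Lemma graded_tprod S V : graded S -> graded V -> graded (S \ox V).
Proof.
move=> gS gV; apply: graded_span => n _ [x Sx [y Vy <-]]; rewrite cmpM.
apply: (subspace_sum (subspace_tprod _ _)) => p _ _.
exact: (tprod_mul (gS _ _ Sx) (gV _ _ Vy)).
Qed.

Lemma graded_wset (P : pred W) : graded (wset P).
Proof.
move=> n x /wsetP Px; apply/wsetP => w nPw.
by rewrite mcoeff_cmp Px // if_same.
Qed.

Lemma graded_genV : graded genV.
Proof. by rewrite genVE; apply: graded_wset. Qed.

Lemma graded_tscal : graded (@tscal k X).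
Proof. by rewrite tscalE; apply: graded_wset. Qed.

Lemma graded_tpow S n : graded S -> graded (tpow S n).
Proof.
move=> gS; elim: n => [|n IH]; first exact: graded_tscal.
exact: graded_tprod.
Qed.

Lemma graded_alt_tprod E (m n : seq nat) : (forall a, graded (E a)) -> graded (alt_tprod E m n).
Proof.
move=> gE; elim: m n => [|a m IH] [|b n] /=; try exact: graded_tscal.
  exact/graded_tpow/graded_genV.
apply: graded_tprod; first exact/graded_tpow/graded_genV.
exact: graded_tprod.
Qed.

Lemma graded_J_step R E i : graded R -> (forall a, graded (E a)) -> graded (J_step R E i).
Proof.
move=> gR gE; apply: gradedI; last exact: graded_tpow.
apply: graded_span => n x [N /= N1 Nx]; apply: sub_span; exists N => // mn mnP.
exact/graded_alt_tprod/Nx.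
Qed.

Lemma graded_J_evens R n a : graded R -> graded (nth set0 (J_evens R n) a).
Proof.
have g0 : graded set0 by [].
move=> gR; elim: n a => [|n IH] a.
  by case: a => [|a] /=; rewrite ?nth_nil //; apply: graded_tscal.
rewrite [J_evens R n.+1]/= nth_rcons; case: ifP => _ //; case: ifP => _ //.
by case: ifP => _ //; apply: graded_J_step.
Qed.

Lemma graded_J R i : graded R -> graded (J R i).
Proof.
move=> gR; have gJ n : graded (J_even R n) by exact: graded_J_evens.
rewrite /J; case: ifP => _ //.
by apply: gradedI; apply: graded_tprod => //; apply: graded_genV.
Qed.

Lemma graded_relations R : space_of_relations deg R -> graded R.
Proof.
case=> sR gR _ _ n x /gR; elim=> [|c y z [Ry [m _ my]] _ IH].
  by rewrite linear0; apply: subspace0.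
rewrite (linear_cmp n c y z); apply: sR.2 IH; rewrite (cmp_homog _ my).
by case: ifP => _ //; apply: subspace0.
Qed.

End Grading.

Section Relations.
Variables (k : fieldType) (X : choiceType) (deg : X -> nat) (R : set (tensalg k X)).
Local Notation T := (tensalg k X).
Local Notation "W1 \ox W2" := (tprod W1 W2) (at level 40, left associativity).
Local Notation L n := (@len_eq k X n).
Local Notation Lge n := (@len_ge k X n).
Hypothesis HR : space_of_relations deg R.
Implicit Types (x y : T) (S V : set T).

Lemma len_eqD n m : L (n + m) = L n \ox L m.
Proof.
apply/seteqP; split; last first.
  by apply: tprod_min => [|x y]; [exact: subspace_wset | exact: len_eq_mul].
elim: n m => [|n IH] m.
  by rewrite -tscalE tprod_tscall //; apply: subspace_wset.
have LS a : L a.+1 = genV \ox L a by rewrite -!tpow_genV.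
rewrite addSn !LS tprodA; apply: tprod_mono => //; exact: IH.
Qed.

Lemma subspace_tpow n : is_subspace (tpow R n).
Proof. by case: n => [|n]; exact: subspace_span. Qed.

Lemma subspace_J i : is_subspace (J R i).
Proof.
have sE j : is_subspace (J R j.*2).
  case: j => [|[|j]]; [exact: subspace_span | exact: rel_subspace HR |].
  rewrite J_evenE //; apply: subspaceI; [exact: subspace_span | exact: subspace_tpow].
rewrite -[i]odd_double_half; case: (odd i) => /=; last exact: sE.
by rewrite add1n J_oddE; apply: subspaceI; apply: subspace_tprod.
Qed.

Lemma relations_len_ge2 : R `<=` Lge 2.
Proof. by move=> x /(rel_ge2 HR); rewrite tens_geE. Qed.

Definition rel_ideal : set T := tprod (tprod setT R) setT.

Lemma rel_ideal_len_ge2 : rel_ideal `<=` Lge 2.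
Proof.
apply: (@tprod3_linear_image _ _ _ id _ _ _ (Lge 2)) => //.
  exact: subspace_wset.
move=> x y z _ /relations_len_ge2 Ry _.
have := len_ge_mul (len_ge_mul (@len_ge0 k X x) Ry) (@len_ge0 k X z).
by rewrite addn0.
Qed.

Lemma relations_sub_ideal : R `<=` rel_ideal.
Proof.
move=> x Rx; rewrite -[x]mulr1 -[x]mul1r; apply: tprod_mul => //.
exact: tprod_mul.
Qed.

(* T_+ I + I T_+ *)
Definition dec_ideal : set T := span ((Lge 1 \ox rel_ideal) `|` (rel_ideal \ox Lge 1)).

(** T_+ T and T T_+ are contained in T_+, so [dec_ideal] is contained in T_+ R T + T R T_+, which
    meets R in 0 by the minimality of R. *)
Lemma relations_dec_ideal x : R x -> dec_ideal x -> x = 0.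
Proof.
move=> Rx dx; apply: (rel_minimal HR); split=> //; move: x {Rx} dx.
have geT : Lge 1 \ox setT `<=` tens_ge 1.
  rewrite tens_geE; apply: tprod_min => [|x y lx _]; first exact: subspace_wset.
  by have := len_ge_mul lx (@len_ge0 k X y); rewrite addn0.
have Tge : setT \ox Lge 1 `<=` tens_ge 1.
  rewrite tens_geE; apply: tprod_min => [|x y _ ly]; first exact: subspace_wset.
  exact: (len_ge_mul (@len_ge0 k X x) ly).
apply: span_mono => x [lx|rx]; [left | right].
  move: x lx; rewrite /rel_ideal -!tprodA.
  by do 2!apply: tprod_mono => //.
move: x rx; rewrite /rel_ideal tprodA.
by apply: tprod_mono.
Qed.

End Relations.

(** * The spaces J_i *)

Section JSpaces.
Variables (k : fieldType) (X : choiceType) (deg : X -> nat) (R : set (tensalg k X)).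
Local Notation W := {fmonom X}.
Local Notation T := (tensalg k X).
Local Notation "W1 \ox W2" := (tprod W1 W2) (at level 40, left associativity).
Local Notation L n := (@len_eq k X n).
Local Notation Lge n := (@len_ge k X n).
Local Notation Je j := (J R j.*2).
Local Notation Jo j := (J R j.*2.+1).
Hypothesis HR : space_of_relations deg R.
Implicit Types (x y : T) (S V : set T).

Lemma len_disjoint n m x : (n < m)%N -> L n x -> Lge m x -> x = 0.
Proof.
move=> nm nx mx; apply/malgP => w; rewrite mcoeff0.
apply/eqP; apply: contraT; rewrite mcoeff_neq0 => xw.
by move: (nx w xw) (mx w xw) nm => /= /eqP -> /leq_gtF ->.
Qed.

Lemma lfree_tscal : lfree (@tscal k X).
Proof.
apply: lfree_criterion => [|x]; first exact: subspace_span.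
rewrite tscalE => x0 x1; apply: (@len_disjoint 0 1) => //; move: x x1 {x0}.
apply: tprod_min => [|x y x1 _]; first exact: subspace_wset.
by have := len_ge_mul x1 (@len_ge0 k X y).
Qed.

Lemma lfree_genV : lfree (@genV k X).
Proof.
apply: lfree_criterion => [|x]; first exact: subspace_span.
rewrite genVE => x0 x1; apply: (@len_disjoint 1 2) => //; move: x x1 {x0}.
apply: tprod_min => [|x y x1 y1]; first exact: subspace_wset.
exact: (len_ge_mul x1 (len_eq_ge (leqnn 1) y1)).
Qed.

Lemma lfree_relations : lfree R.
Proof.
apply: lfree_criterion => [|x Rx LRx]; first exact: rel_subspace HR.
apply: (relations_dec_ideal HR Rx); move: x LRx {Rx}.
apply: tprod_min => [|x y x1 Ry]; first exact: subspace_span.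
apply: sub_span; left; apply: tprod_mul => //.
exact: relations_sub_ideal.
Qed.

Lemma lfree_tpow n : lfree (tpow R n).
Proof.
elim: n => [|n IH]; first exact: lfree_tscal.
exact: (lfree_tprod lfree_relations IH).
Qed.

Lemma J_even_tpow j : Je j `<=` tpow R j.
Proof.
case: j => [|[|j]] //; last by rewrite J_evenE //; exact: subIsetr.
by rewrite /tpow /= tprod_tscalr //; apply: rel_subspace HR.
Qed.

Lemma lfree_J_even j : lfree (Je j).
Proof. exact: (lfree_mono (@J_even_tpow j) (lfree_tpow j)). Qed.

Lemma J_oddl j : Jo j `<=` genV \ox Je j.
Proof. by rewrite J_oddE; apply: subIsetl. Qed.

Lemma J_oddr j : Jo j `<=` Je j \ox genV.
Proof. by rewrite J_oddE; apply: subIsetr. Qed.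

Lemma lfree_J i : lfree (J R i).
Proof.
rewrite -[i]odd_double_half; case: (odd i) => /=; last exact: lfree_J_even.
apply: lfree_mono (@J_oddl _) _.
exact: (lfree_tprod lfree_genV (lfree_J_even _)).
Qed.

(** The shape shared by the recursion for J_(2j+2) and by the domain of the even differential: N
    letters distributed around [S] in every possible way. *)
Definition mid S N : set T :=
  [set x | forall l, (l <= N)%N -> (L l \ox S \ox L (N - l)) x].

Lemma subspace_mid S N : is_subspace (mid S N).
Proof.
split=> [l lN|c x y Sx Sy l lN]; first exact: (subspace0 (subspace_tprod _ _)).
exact: ((subspace_tprod _ _).2 c _ _ (Sx l lN) (Sy l lN)).
Qed.

Lemma mid_left S N : mid S N `<=` L N \ox S \ox L 0.
Proof. by move=> x /(_ N (leqnn _)); rewrite subnn. Qed.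

Lemma mid_lefts S N : is_subspace S -> mid S N `<=` L N \ox S.
Proof.
move=> sS x /mid_left; rewrite -tscalE tprod_tscalr //; exact: subspace_tprod.
Qed.

(** The factors J_0 = k disappear. This evaluates the tail of the terms of the recursion with n =
    (i, 0, ..., 0). *)
Lemma alt_tprod_single (E : nat -> set T) a j : E 0%N = @tscal k X ->
  alt_tprod E (a :: nseq j 0%N) (nseq j 0%N) = L a.
Proof.
move=> E0; elim: j a => [|j IH] a; first exact: tpow_genV.
rewrite -[LHS]/(tpow genV a \ox (E 0%N \ox alt_tprod E (nseq j.+1 0%N) (nseq j 0%N))) IH E0 tpow_genV -tscalE !tprod_tscalr //.
- exact: subspace_wset.
- exact: subspace_span.
Qed.

Lemma span_cut (I : Type) (S : I -> set T) (P Q : set I) x :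
  span (\bigcup_(i in P) S i) x ->
  exists y z, [/\ span (\bigcup_(i in P `&` Q) S i) y,
    span (\bigcup_(i in P `&` ~` Q) S i) z & x = y + z].
Proof.
elim=> [|c u v [i Pi Su] _ [y [z [Py Pz ->]]]].
  by exists 0, 0; split; rewrite ?addr0 //; exact: span_zero.
have [Qi|nQi] := pselect (Q i).
  exists (c *: u + y), z; split=> //; last by rewrite addrA.
  by apply: span_add => //; exists i.
exists y, (c *: u + z); split=> //; last by rewrite addrCA.
by apply: span_add => //; exists i.
Qed.

(** Of the intersection defining J_(2j+2), only the terms with n = (j, 0, ..., 0) and m = (l, N - l,
    0, ..., 0) are kept. *)
Lemma J_even_mid1 j : (0 < j)%N ->
  Je j.+1 `<=` span (\bigcup_(N in [set N | (1 <= N)%N]) mid (Je j) N).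
Proof.
case: j => // j _; rewrite J_evenE // => x [+ _].
apply: span_mono => {}x [N /= N1 Nx]; exists N => //= l lN.
pose E n := J R n.*2.
have : alt_tprod E (l :: (N - l)%N :: nseq j 0%N) (j.+1 :: nseq j 0%N) x.
  apply: (Nx (_, _)); split=> /=; rewrite ?size_nseq ?sumn_nseq ?mul0n ?addn0 //.
  exact: subnKC.
rewrite -[alt_tprod _ _ _]/(tpow genV l \ox
  (E j.+1 \ox alt_tprod E ((N - l)%N :: nseq j 0%N) (nseq j 0%N))).
by rewrite alt_tprod_single // tpow_genV tprodA.
Qed.

(** By definition J_(2j+2) lies in R^(j+1) = R R^(j), and by the terms l = N it lies in T J_(2j).
    Inside T (x) R^(j) these two conditions cut out R J_(2j). *)
Lemma J_add2_even j : Je j.+1 `<=` R \ox Je j.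
Proof.
case: j => [|j].
  by rewrite tprod_tscalr //; apply: rel_subspace HR.
move=> x Jx; apply: (lfree_inter (lfree_tpow j.+1) (subspace_J HR _) (@J_even_tpow _)).
split; first exact: (J_even_tpow Jx).
move: x {Jx} (J_even_mid1 (ltn0Sn j) Jx).
apply: span_min => [|x [N _ /(mid_lefts (subspace_J HR _)) Nx]].
  exact: subspace_tprod.
exact: tprod_mono Nx.
Qed.

(** The part with N = 1 lies in V J_(2j). It is also the difference of the element, which lies in R
    J_(2j), and of the parts with N >= 2, so it lies in T_(>=2) J_(2j) and vanishes. Two letters are
    required later: one goes into J_(2j+1), and one must stay outside for J_(2j+2) <= T_+
    J_(2j+1). *)
Lemma J_even_mid2 j :
  Je j.+1 `<=` span (\bigcup_(N in [set N | (2 <= N)%N]) mid (Je j) N).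
Proof.
case: j => [|j].
  move=> x Rx; have := relations_len_ge2 HR Rx.
  move: x {Rx}; apply: wset_min => [|w /= w2]; first exact: subspace_span.
  apply: sub_span; exists (size w) => //= l lw.
  rewrite -[J R 0]/(@tscal k X) tprod_tscalr; last exact: subspace_wset.
  by rewrite -len_eqD subnKC //; apply: wset_word => /=.
move=> x Jx.
have [x1 [x2 [H1 H2 xE]]] := span_cut [set 1%N] (J_even_mid1 (ltn0Sn j) Jx).
have sJ := subspace_J HR j.+1.*2.
have {H2} H2 : span (\bigcup_(N in [set N | (2 <= N)%N]) mid (Je j.+1) N) x2.
  move: H2; apply: span_mono => y [N [/= N1 /eqP N2] My]; exists N => //=.
  by rewrite ltn_neqAle eq_sym N2.
suff x10 : x1 = 0 by rewrite xE x10 add0r.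
have s1 := @subspace_wset k X [pred w : W | size w == 1%N].
have s2 := @subspace_wset k X [pred w : W | (2 <= size w)%N].
apply: (lfree_disjoint (lfree_J j.+1.*2) s1 s2).
- by move=> y; apply: len_disjoint.
- move: x1 H1 {xE}; apply: span_min => [|y [N [_ /= ->]]]; first exact: subspace_tprod.
  exact: mid_lefts.
have -> : x1 = x - x2 by rewrite xE addrK.
apply: (subspaceB (subspace_tprod _ _)).
  by apply: (tprod_mono _ _ (J_add2_even Jx)) => //; exact: (relations_len_ge2 HR).
move: x2 H2 {xE}; apply: span_min => [|y [N /= N2 /(mid_lefts sJ)]].
  exact: subspace_tprod.
by apply: tprod_mono => //; apply: len_eq_ge.
Qed.

(** One letter, on the left or on the right, is absorbed into J_(2j+1) = V J_(2j) /\ J_(2j) V,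
    whence the shift of N. This is the inclusion on which the formula for the even differential
    rests. *)
Lemma J_even_mid j :
  Je j.+1 `<=` span (\bigcup_(N in [set N | (1 <= N)%N]) mid (Jo j) N).
Proof.
move=> x /J_even_mid2; apply: span_mono => {}x [[|[|N]] //= _ Nx].
exists N.+1 => //= l lN; rewrite J_oddE; apply: len_eq_inter.
- exact: subspace_tprod.
- exact: subspace_tprod.
split.
  have := Nx l.+1 lN; rewrite subSS -addn1 len_eqD -genVE.
  by rewrite !tprodA.
have := Nx l (leqW lN).
by rewrite subSn // -add1n len_eqD -genVE !tprodA.
Qed.

Lemma J_succ i : J R i.+1 `<=` Lge 1 \ox J R i.
Proof.
rewrite -[i]odd_double_half; case: (odd i) => /=; last first.
  move=> x /J_oddl; apply: tprod_mono => //.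
  by rewrite genVE; apply: len_eq_ge.
rewrite add1n => x /(@J_even_mid _); move: x.
apply: span_min => [|x [N /= N1 /(mid_lefts (subspace_J HR _))]].
  exact: subspace_tprod.
by apply: tprod_mono => //; apply: len_eq_ge.
Qed.

(** In the odd case J_(2j+3) lies in J_(2j+2) V <= R J_(2j) V and, by two steps of [J_succ], in T
    J_(2j+1). As T (x) J_(2j) V embeds in T(V), the two meet in R J_(2j+1). *)
Lemma J_add2 i : J R i.+2 `<=` R \ox J R i.
Proof.
rewrite -[i]odd_double_half; case: (odd i) => /=; last exact: J_add2_even.
rewrite add1n; set j := i./2 => x Jx.
have lJV := lfree_tprod (lfree_J_even j) lfree_genV.
apply: (lfree_inter lJV (subspace_J HR _) (@J_oddr _)).
split.
  rewrite -tprodA; move: (J_oddr (j := j.+1) Jx).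
  by apply: tprod_mono => //; apply: J_add2_even.
move: (J_oddl (j := j.+1) Jx) => {}Jx.
have : (setT \ox (setT \ox Jo j)) x.
  move: Jx; apply: tprod_mono => // y /(@J_succ j.*2.+1).
  exact: tprod_mono.
rewrite -tprodA; exact: tprod_mono.
Qed.

End JSpaces.

(** Restriction of scalars from [A] to [k]; a type synonym, because the same module is also used
    over [A]. *)
Definition resc (k : fieldType) (A : algType k) (M : lmodType A) : Type := M.

Section RestrictScalars.
Variables (k : fieldType) (A : algType k) (M : lmodType A).

HB.instance Definition _ := GRing.Zmodule.copy (resc M) M.

Definition resc_scale (c : k) (x : resc M) : resc M := c%:A *: (x : M).

Fact resc_scaleA a b v : resc_scale a (resc_scale b v) = resc_scale (a * b) v.
Proof. by rewrite /resc_scale scalerA -scalerAl mul1r scalerA. Qed.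

Fact resc_scale1 : left_id 1 resc_scale.
Proof. by move=> v; rewrite /resc_scale !scale1r. Qed.

Fact resc_scaleDr : right_distributive resc_scale +%R.
Proof. by move=> c x y; rewrite /resc_scale scalerDr. Qed.

Fact resc_scaleDl v : {morph resc_scale^~ v : a b / a + b}.
Proof. by move=> a b; rewrite /resc_scale !scalerDl. Qed.

HB.instance Definition _ := GRing.Zmodule_isLmodule.Build k (resc M)
  resc_scaleA resc_scale1 resc_scaleDr resc_scaleDl.

Lemma rescE (c : k) (x : resc M) : c *: x = (c%:A *: (x : M) : M).
Proof. by []. Qed.

Lemma linear_act (a : A) : linear (fun x : resc M => (a *: (x : M) : M) : resc M).
Proof.
move=> c x y; rewrite !rescE scalerDr !scalerA.
by rewrite -scalerAl -scalerAr mul1r mulr1.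
Qed.

End RestrictScalars.

Lemma linear_resc (k : fieldType) (A : algType k) (M N : lmodType A) (f : M -> N) :
  linear f ->
  linear (f : resc M -> resc N).
Proof. by move=> lf c x y; exact: (lf c%:A x y). Qed.

(** * The complex A (x) J and its minimality *)

Section LeftComplex.
Variables (k : fieldType) (X : choiceType) (deg : X -> nat) (R : set (tensalg k X)).
Variables (A : cgalg k) (pi : {lrmorphism (tensalg k X) -> A}).
Local Notation W := {fmonom X}.
Local Notation T := (tensalg k X).
Local Notation F := {malg A[W]}.
Local Notation rF := (resc {malg A[W]}).
Local Notation Lge n := (@len_ge k X n).
Hypotheses (deg_gt0 : forall x, (0 < deg x)%N) (HR : space_of_relations deg R).
Hypothesis HA : presents deg R pi.
Implicit Types (a b : A) (t s : T) (x y z : F).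

Local Notation eps := (cga_eps A).

Lemma eps_scale (c : k) a : eps (c *: a) = c * eps a.
Proof. by rewrite -[a in LHS]mul1r scalerAl rmorphM /= cga_eps_scal. Qed.

Lemma pi_surj a : exists t, pi t = a.
Proof. by case: HA => /(_ a). Qed.

Lemma pi_eq0 t : pi t = 0 <-> rel_ideal R t.
Proof. by case: HA => _ /(_ t). Qed.

(** Letters have positive degree, so a nonempty word is sent to a component of positive degree of
    [A], which the augmentation kills. *)
Lemma eps_pi t : eps (pi t) = t@_mone.
Proof.
pose f : T -> k^o := fun t => eps (pi t).
pose g : T -> k^o := fun t => t@_mone.
apply: (@lin_ext k _ k^o f g).
- by move=> c u v; rewrite /f linearP rmorphD /= eps_scale.
- by move=> c u v; rewrite /g mcoeffD mcoeffZ.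
move=> w; rewrite /f /g mcoeffU1; have [->|w1] := eqVneq w mone.
  by rewrite [<< mone >>]mpolyC1E rmorph1 rmorph1.
case: HA => _ _ pi_homog.
suff -> : eps (pi << w >>) = 0 by [].
apply: (@cga_eps_pos _ _ (word_deg deg w)).
  move: w1; rewrite -size_word_eq0; case: w => -[|a s] //= _.
  by rewrite /word_deg big_cons addn_gt0 deg_gt0.
by apply: pi_homog => v; rewrite msuppU1 inE => /eqP ->.
Qed.

Lemma eps_pi_len t : Lge 1 t -> eps (pi t) = 0.
Proof.
move=> /wsetP t1; rewrite eps_pi t1 //=.
by rewrite -leqNgt leqn0 size_word_eq0.
Qed.

Lemma len_ge1E t : t@_mone = 0 -> Lge 1 t.
Proof.
move=> t0; apply/wsetP => w /=; rewrite -leqNgt leqn0 size_word_eq0 => /eqP -> //.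
Qed.

Lemma len_ge1_decomp t : Lge 1 (t - (t@_mone)%:A).
Proof.
by apply: len_ge1E; rewrite mcoeffB mcoeffZ mcoeff1 eqxx mulr1 subrr.
Qed.

Lemma pi_surj_pos a : eps a = 0 -> exists2 t, Lge 1 t & pi t = a.
Proof.
have [t <-] := pi_surj a; rewrite eps_pi => t0.
by exists t => //; apply: len_ge1E.
Qed.

(* {malg A[W]} stands for A (x) T(V), and [tp a t] for a (x) t. *)
Definition tp (a : A) (t : T) : rF := mlin (fun w : W => << a *g w >> : rF) t.

Lemma mcoeff_tp a t w : (tp a t : F)@_w = t@_w *: a.
Proof.
rewrite /tp /mlin raddf_sum /=.
under eq_bigr => v _ do rewrite rescE mcoeffZ mcoeffU mulrnAr -scalerAl mul1r.
have [tw|] := boolP (w \in msupp t).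
  by rewrite (big_fsetD1 w) //= eqxx big1_fset ?addr0 // => v; rewrite !inE => /andP[/negPf ->].
move=> tw; rewrite (mcoeff_outdom tw) scale0r big1_fset // => v vt _.
have [vw|_ //] := eqVneq v w.
by case/negP: tw; rewrite -vw.
Qed.

Lemma linear_tp a : linear (tp a).
Proof. exact: linearP. Qed.

Opaque tp.

Lemma bilin_tp : bilin tp.
Proof.
split=> [t c a b|a]; last exact: linear_tp.
suff : (tp (c *: a + b) t : F) = c%:A *: (tp a t : F) + (tp b t : F) by [].
apply/malgP => w; rewrite mcoeffD mcoeffZ.
have E (r : k) : r *: (c *: a + b) = c%:A * (r *: a) + r *: b.
  by rewrite -scalerAl mul1r scalerDr !scalerA mulrC.
refine (etrans (mcoeff_tp _ _ _) (etrans (E _) (esym _))).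
exact: (congr2 (fun u v => c%:A * u + v) (mcoeff_tp a t w) (mcoeff_tp b t w)).
Qed.

Lemma tpZ a b t : b *: (tp a t : F) = tp (b * a) t.
Proof.
apply/malgP => w; rewrite mcoeffZ; refine (etrans _ (esym (mcoeff_tp _ _ _))).
by rewrite scalerAr; congr (b * _); exact: mcoeff_tp.
Qed.

Lemma tp_word a w : tp a << w >> = << a *g w >>.
Proof.
apply/malgP => v; refine (etrans (mcoeff_tp _ _ _) _).
by rewrite [RHS]mcoeffU mcoeffU1 scaler_nat.
Qed.

Lemma tp_decomp x : x = \sum_(w <- msupp x) (tp x@_w << w >> : F).
Proof. by rewrite [LHS]monalgE; apply: eq_bigr => w _; rewrite tp_word. Qed.

Lemma bilin_pi_tp : bilin (fun t s : T => tp (pi t) s).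
Proof.
split=> [s c t u|t]; last exact: bilin_tp.2.
by rewrite linearP; exact: bilin_tp.1.
Qed.

(** On T J_i, identified with T (x) J_i, this is the quotient map onto A (x) J_i; off T J_i its
    values are arbitrary. *)
Lemma theta_exists i : exists f : {linear T -> rF},
  forall t s, J R i s -> f (t * s) = tp (pi t) s.
Proof. exact: lfree_ext (lfree_J HR i) bilin_pi_tp. Qed.

Definition theta i : T -> rF := sval (cid (theta_exists i)).

Lemma linear_theta i : linear (theta i).
Proof. exact: linearP. Qed.

Lemma theta_mul i t s : J R i s -> theta i (t * s) = tp (pi t) s.
Proof. by rewrite /theta; case: cid => f /= fE; apply: fE. Qed.

(** On A (x) J_(i+1) this is the differential of K (x)_A k. *)
Definition dF i : F -> F := mlin (fun w : W => theta i << w >> : F).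

Lemma linear_dF i : linear (dF i).
Proof. exact: linearP. Qed.

Lemma dF_tp i a t : dF i (tp a t) = a *: (theta i t : F).
Proof.
apply: (@lin_ext k _ rF (fun t => dF i (tp a t)) (fun t => a *: (theta i t : F))).
- exact: (linear_comp (linear_resc (linear_dF i)) (bilin_tp.2 a)).
- exact: (linear_comp (@linear_act _ _ F a) (linear_theta i)).
move=> w; rewrite tp_word.
exact: (@mlinU A W F (fun w => theta i << w >>) a w).
Qed.

End LeftComplex.

Section Minimality.
Variables (k : fieldType) (X : choiceType) (deg : X -> nat) (R : set (tensalg k X)).
Variables (A : cgalg k) (pi : {lrmorphism (tensalg k X) -> A}).
Local Notation W := {fmonom X}.
Local Notation T := (tensalg k X).
Local Notation F := {malg A[W]}.
Local Notation rF := (resc {malg A[W]}).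
Local Notation "W1 \ox W2" := (tprod W1 W2) (at level 40, left associativity).
Local Notation TJ i := (setT \ox J R i).
Hypotheses (deg_gt0 : forall x, (0 < deg x)%N) (HR : space_of_relations deg R).
Hypothesis HA : presents deg R pi.
Local Notation th := (theta pi HR).
Local Notation dd := (dF pi HR).
Implicit Types (a b : A) (t s : T) (x y z : F).

Lemma J_sub_TJ i : J R i `<=` TJ i.
Proof. by move=> s Js; rewrite -[s]mul1r; apply: tprod_mul. Qed.

Lemma TJ_succ i : TJ i.+1 `<=` TJ i.
Proof.
apply: tprod_min => [|t s _ /(J_succ HR)]; first exact: subspace_tprod.
apply: (@tprod_linear_image _ _ _ (fun s => t * s) _ _ (TJ i)).
- exact: linear_mull.
- exact: subspace_tprod.
by move=> u v _ Jv; rewrite mulrA; apply: tprod_mul.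
Qed.

Lemma theta_act i t s : TJ i s -> (th i (t * s) : F) = pi t *: (th i s : F).
Proof.
move: s; apply: (@tprod_lin_eq _ _ rF (fun s => th i (t * s)) (fun s => pi t *: (th i s : F))).
- exact: (linear_comp (linear_theta pi HR i) (linear_mull t)).
- exact: (linear_comp (@linear_act _ _ F (pi t)) (linear_theta pi HR i)).
move=> u v _ Jv; rewrite (mulrA t u v); refine (etrans (theta_mul pi HR (t * u) Jv) (esym _)).
refine (etrans (congr1 (fun z : F => pi t *: z) (theta_mul pi HR u Jv)) _).
by rewrite tpZ (rmorphM pi).
Qed.

(** Seen in T(V), the differential is the inclusion of T J_(i+1) in T J_i. *)
Lemma dF_theta i s : TJ i.+1 s -> dd i (th i.+1 s) = (th i s : F).
Proof.
move: s; apply: (@tprod_lin_eq _ _ rF (fun s => dd i (th i.+1 s)) (th i)).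
- exact: (linear_comp (linear_resc (linear_dF pi HR i)) (linear_theta pi HR i.+1)).
- exact: linear_theta.
move=> u v _ Jv; rewrite (theta_mul pi HR u Jv) dF_tp.
by rewrite -theta_act //; apply: TJ_succ; apply: J_sub_TJ.
Qed.

Lemma theta_ideal i s : (rel_ideal R \ox J R i) s -> th i s = 0.
Proof.
move: s; apply: (@tprod_lin_eq _ _ rF (th i) (fun=> 0)).
- exact: linear_theta.
- exact: linear_zero.
move=> u v u0 Jv; refine (etrans (theta_mul pi HR u Jv) _).
rewrite ((pi_eq0 HA u).2 u0); exact: bilin0l (bilin_tp _ _).
Qed.

(** The reason for d d = 0: J_(i+2) <= R J_i, and pi kills R. *)
Lemma dF_theta0 i s : J R i.+2 s -> dd i (th i.+1 s) = 0.
Proof.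
move=> Js; rewrite dF_theta; last exact: (TJ_succ (J_sub_TJ Js)).
apply: theta_ideal; apply: tprod_mono (J_add2 HR Js) => //.
exact: relations_sub_ideal.
Qed.

Lemma pi_sub t s : pi (t - s) = pi t - pi s.
Proof. exact: rmorphB. Qed.

Lemma pi_section : exists f : {linear A -> T}, forall a, pi (f a) = a.
Proof.
have sI : is_subspace [set t | pi t = 0].
  split=> [|c u v /= u0 v0] /=; first exact: linear0.
  have -> : pi (c *: u + v) = c *: pi u + pi v by exact: linearP.
  by rewrite u0 v0 scaler0 addr0.
have [q [qI Iq]] := linear_projector sI.
pose G : set (A * T) := [set p | exists t, p = (pi t, t - q t)].
have [||f [fG _]] := @linear_extension _ _ _ G.
- split=> [|c _ _ [t ->] [u ->]]; first by exists 0; rewrite (linear0 q) subr0 (linear0 pi).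
  exists (c *: t + u); apply: (congr2 pair); first exact/esym/linearP.
  by rewrite /= (linearP q c t u) opprD scalerBr addrACA.
- by move=> s [t [t0 ->]]; rewrite qI ?subrr.
exists f => a; have [t ta] := pi_surj HA a.
rewrite (fG a (t - q t)); first by rewrite pi_sub (Iq t) subr0.
by exists t; rewrite ta.
Qed.

(** Let f be a linear section of pi and mu the map a (x) w |-> f(a) w. Then t s - mu(theta(t s)) =
    (t - f(pi t)) s lies in I J_i, and on the kernel of theta the left side is the element
    itself. *)
Lemma theta_ker i s : TJ i s -> th i s = 0 -> (rel_ideal R \ox J R i) s.
Proof.
have [f fK] := pi_section.
pose mu : F -> T := mmap f (fun w : W => << w >> : T).
have muD x y : mu (x + y) = mu x + mu y by exact: raddfD.
have mu_sum (I : eqType) (r : seq I) (G : I -> F) :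
    mu (\sum_(i <- r) G i) = \sum_(i <- r) mu (G i).
  by apply: (big_morph mu muD); exact: raddf0.
have muZ c x : mu (c%:A *: x) = c *: mu x.
  rewrite [x]monalgE scaler_sumr !mu_sum scaler_sumr; apply: eq_bigr => w _.
  have -> : c%:A *: << x@_w *g w >> = << c *: x@_w *g w >> :> F.
    by apply/malgP => v; rewrite mcoeffZ !mcoeffU mulrnAr -scalerAl mul1r.
  have muU a : mu << a *g w >> = f a * << w >> by exact: mmapU.
  have fZ a : f (c *: a) = c *: f a by exact: linearZ.
  by rewrite !muU fZ -(scalerAl c).
have lmu : linear (mu : rF -> T).
  by move=> c x y; refine (etrans (muD _ _) _); congr (_ + _); exact: muZ.
have mu_tp a t : mu (tp a t) = f a * t.
  apply: (@lin_ext k _ _ (fun t => mu (tp a t)) (fun t => f a * t)).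
  - exact: (linear_comp lmu ((@bilin_tp _ X A).2 a)).
  - exact: linear_mull.
  by move=> w; rewrite tp_word; exact: mmapU.
move=> Js th0; rewrite -[s]subr0.
have -> : 0 = mu (th i s) by rewrite th0 /mu raddf0.
move: s Js {th0}; apply: (@tprod_linear_image _ _ _ (fun s => s - mu (th i s)) _ _ (rel_ideal R \ox J R i)).
- exact: (linear_sub (@linear_idfun _ _) (linear_comp lmu (linear_theta pi HR i))).
- exact: subspace_tprod.
move=> u v _ Jv; rewrite (theta_mul pi HR u Jv) mu_tp -mulrBl.
apply: tprod_mul => //; apply: (pi_eq0 HA _).1.
by rewrite pi_sub fK subrr.
Qed.

End Minimality.

Section Resolution.
Variables (k : fieldType) (X : choiceType) (deg : X -> nat) (R : set (tensalg k X)).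
Variables (A : cgalg k) (pi : {lrmorphism (tensalg k X) -> A}).
Local Notation W := {fmonom X}.
Local Notation T := (tensalg k X).
Local Notation F := {malg A[W]}.
Local Notation rF := (resc {malg A[W]}).
Local Notation "W1 \ox W2" := (tprod W1 W2) (at level 40, left associativity).
Local Notation TJ i := (setT \ox J R i).
Hypotheses (deg_gt0 : forall x, (0 < deg x)%N) (HR : space_of_relations deg R).
Hypothesis HA : presents deg R pi.
Local Notation th := (theta pi HR).
Implicit Types (a b : A) (t s : T) (x y z : F).

Local Notation eps := (cga_eps A).

Lemma subspace_homog (n : int) : is_subspace (@homog k X deg n).
Proof.
have -> : @homog k X deg n = wset [pred w : W | (word_deg deg w)%:Z == n].
  by apply/seteqP; split=> t nt w /nt /eqP.
exact: subspace_wset.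
Qed.

(** Projectors onto the homogeneous components of J_i are chosen separately and glued on words.
    Respecting degrees is what later makes A (x) J_i a graded direct summand of A (x) T(V). *)
Lemma J_projector i : exists p : {linear T -> T},
  [/\ forall t, J R i t -> p t = t, forall t, J R i (p t)
    & forall (n : nat) t, homog deg n t -> homog deg n (p t)].
Proof.
have sJ := subspace_J HR i.
have gJ := graded_J (i := i) (graded_relations HR).
have sH (n : nat) : is_subspace (hcomp deg (J R i) n).
  exact: subspaceI sJ (subspace_homog n).
have [q qP] := choice (fun n => linear_projector (sH n)).
pose f : T -> T := mlin (fun w : W => q (word_deg deg w) << w >>).
have lf : linear f by exact: linearP.
have fq (n : nat) t : homog deg n t -> f t = q n t.
  have lq : linear (q n) by exact: linearP.
  have hw : @homog k X deg n `<=` wset [pred w : W | word_deg deg w == n].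
    by move=> u nu w /nu [] /= ->.
  move=> /hw; apply: wset_lin_eq => // w /= /eqP <-.
  exact: mlinU1.
have [p pf] := linear_funE lf; exists p; split=> [t Jt|t|n t nt].
- rewrite pf; have [N tE] := cmp_sum deg t.
  rewrite [in LHS]tE -pf linear_sum [RHS]tE; apply: eq_bigr => n _ /=.
  have nt := @homog_cmp k X deg n t.
  rewrite pf (fq n _ nt); apply: (qP n).1; split=> //; exact: gJ.
- suff: (p @^-1` J R i) t by [].
  apply: malg_subspace; first exact: subspace_preim.
  move=> w _ /=; rewrite pf /f (@mlinU1 k).
  by case: ((qP (word_deg deg w)).2 << w >>).
- by rewrite pf (fq n) //; case: ((qP n).2 t).
Qed.

Definition pr i : T -> T := sval (cid (J_projector i)).

Lemma linear_pr i : linear (pr i).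
Proof. exact: linearP. Qed.

Lemma pr_id i t : J R i t -> pr i t = t.
Proof. by rewrite /pr; case: cid => p /= [H _ _]; apply: H. Qed.

Lemma pr_J i t : J R i (pr i t).
Proof. by rewrite /pr; case: cid => p /= [_ H _]; apply: H. Qed.

Lemma pr_homog i (n : nat) t : homog deg n t -> homog deg n (pr i t).
Proof. by rewrite /pr; case: cid => p /= [_ _ H]; apply: H. Qed.

Definition prF i : F -> F := mlin (fun w : W => tp 1 (pr i << w >>) : F).

Lemma linear_prF i : linear (prF i).
Proof. exact: linearP. Qed.

HB.instance Definition _ i := GRing.isLinear.Build A F F *:%R (prF i) (linear_prF i).

Lemma prF_tp i a t : prF i (tp a t) = (tp a (pr i t) : F).
Proof.
apply: (@lin_ext k _ rF (fun t => prF i (tp a t)) (fun t => tp a (pr i t))).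
- exact: (linear_comp (linear_resc (linear_prF i)) ((@bilin_tp _ X A).2 a)).
- exact: (linear_comp ((@bilin_tp _ X A).2 a) (linear_pr i)).
move=> w; rewrite tp_word; refine (etrans (@mlinU A W F _ a w) _).
by rewrite tpZ mulr1.
Qed.

(* A (x) J_i inside A (x) T(V). *)
Definition AJ i : set F := [set x | prF i x = x].

Lemma AJ_tp i a t : J R i t -> AJ i (tp a t).
Proof. by move=> Jt; rewrite /AJ /= prF_tp pr_id. Qed.

Lemma AJ_decomp i x : AJ i x -> x = \sum_(w <- msupp x) (tp x@_w (pr i << w >>) : F).
Proof.
move=> Sx; rewrite -[LHS]Sx {1}[x]tp_decomp linear_sum; apply: eq_bigr => w _.
exact: prF_tp.
Qed.

Lemma AJ_ind i (Z : set F) : Z 0 -> (forall x y, Z x -> Z y -> Z (x + y)) ->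
  (forall a t, J R i t -> Z (tp a t)) -> AJ i `<=` Z.
Proof.
move=> Z0 ZD Zt x /AJ_decomp ->; elim/big_ind: _ => // w _.
exact/Zt/pr_J.
Qed.

Lemma subspace_AJ i : is_subspace (AJ i).
Proof.
split=> [|c x y]; rewrite /AJ /=; first exact: linear0.
by move=> Sx Sy; rewrite (linear_prF i c x y) Sx Sy.
Qed.

Lemma AJ_theta i t : TJ i t -> AJ i (th i t).
Proof.
have sAJ : is_subspace (AJ i : set rF).
  by split=> [|c x y]; [exact: (subspace_AJ i).1 | exact: (subspace_AJ i).2 c%:A x y].
apply: (@tprod_linear_image _ _ rF (th i) _ _ (AJ i)) => //.
  exact: linear_theta.
move=> u v _ Jv; rewrite (theta_mul pi HR u Jv); exact: AJ_tp.
Qed.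

Lemma AJ_lift i x : AJ i x -> exists2 t, TJ i t & (th i t : F) = x.
Proof.
move: x; apply: AJ_ind.
- exists 0; first exact: subspace0 (subspace_tprod _ _).
  by have [f ff] := linear_funE (linear_theta pi HR i); rewrite -ff linear0.
- move=> x y [t Tt <-] [s Ts <-]; exists (t + s).
    exact: subspaceD (subspace_tprod _ _) Tt Ts.
  by have [f ff] := linear_funE (linear_theta pi HR i); rewrite -!ff linearD.
move=> a t Jt; have [u <-] := pi_surj HA a; exists (u * t); first exact: tprod_mul.
exact: theta_mul.
Qed.

Definition augF (x : F) : k := eps (x@_mone).

Lemma augFD x y : augF (x + y) = augF x + augF y.
Proof. by rewrite /augF mcoeffD rmorphD. Qed.

Lemma augFZ a x : augF (a *: x) = eps a * augF x.
Proof. by rewrite /augF mcoeffZ rmorphM. Qed.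

Lemma augF_tp a t : augF (tp a t) = t@_mone * eps a.
Proof.
rewrite /augF -eps_scale; congr (eps _); exact: mcoeff_tp.
Qed.

Lemma linear_augF (c : k) (x y : rF) : augF (c *: x + y) = c * augF x + augF y.
Proof.
refine (etrans (augFD _ _) _); congr (_ + _).
by refine (etrans (augFZ _ _) _); rewrite cga_eps_scal.
Qed.

Lemma augF_theta0 t : TJ 0 t -> augF (th 0 t) = t@_mone.
Proof.
have laug : linear (augF : rF -> k^o) by exact: linear_augF.
move: t; apply: (@tprod_lin_eq _ _ k^o (fun t => augF (th 0 t)) (fun t => t@_mone)).
- exact: (linear_comp laug (linear_theta pi HR 0)).
- by move=> c t s; rewrite mcoeffD mcoeffZ.
move=> u _ _ /tscalP[c ->].
have J0 : J R 0 (c%:A) by apply/tscalP; exists c.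
rewrite (theta_mul pi HR u J0) augF_tp (eps_pi deg_gt0 HA) mcoeffZ mcoeff1 eqxx mulr1.
by rewrite tmulZr mulr1 mcoeffZ.
Qed.

End Resolution.

Lemma scale_regroup (k : pzRingType) (M : lmodType k) (c : k) (u v x y : M) :
  c *: u + x - (c *: v + y) = c *: (u - v) + (x - y).
Proof. by rewrite opprD addrACA scalerBr. Qed.

(** * Minimality of the complex, by induction with a parity split *)

Section Minimal.
Variables (k : fieldType) (X : choiceType) (deg : X -> nat) (R : set (tensalg k X)).
Variables (A : cgalg k) (pi : {lrmorphism (tensalg k X) -> A}).
Local Notation W := {fmonom X}.
Local Notation T := (tensalg k X).
Local Notation F := {malg A[W]}.
Local Notation rF := (resc {malg A[W]}).
Local Notation "W1 \ox W2" := (tprod W1 W2) (at level 40, left associativity).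
Local Notation L n := (@len_eq k X n).
Local Notation Lge n := (@len_ge k X n).
Local Notation TJ i := (setT \ox J R i).
Hypotheses (deg_gt0 : forall x, (0 < deg x)%N) (HR : space_of_relations deg R).
Hypothesis HA : presents deg R pi.
Local Notation th := (theta pi HR).
Local Notation dd := (dF pi HR).
Implicit Types (a b : A) (t s : T) (x y z : F).

Local Notation eps := (cga_eps A).

Local Notation SJ i := (AJ HR i).

Definition cycle (i : nat) : set F := [set x | SJ i x /\
  match i with 0 => augF x = 0 | j.+1 => dd j x = 0 end].

(* A_+ Z_i *)
Definition pos_cycle (i : nat) : set F :=
  span [set y | exists a z, [/\ eps a = 0, cycle i z & y = a *: z]].

Lemma TJ_decomp i t : TJ i t -> exists2 s, J R i s & (Lge 1 \ox J R i) (t - s).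
Proof.
elim=> [|c _ y [u _ [v Jv <-]] _ [s Js yE]].
  exists 0; first exact: subspace0 (subspace_J HR i).
  by rewrite subr0; apply: span_zero.
exists (c *: (u@_mone *: v) + s).
  apply: (subspace_J HR i).2 => //; exact: subspaceZ (subspace_J HR i) Jv.
have E : (u - (u@_mone)%:A) * v = u * v - u@_mone *: v.
  rewrite (mulrBl v u) -(scalerAl _ 1 v); congr (_ - _ *: _); exact: mul1r.
have -> := scale_regroup c (u * v) (u@_mone *: v) y s; rewrite -E.
apply: ((subspace_tprod _ _).2 c) => //; apply: tprod_mul => //.
exact: len_ge1_decomp.
Qed.

Lemma theta_cycle i s : J R i.+1 s -> cycle i (th i s).
Proof.
move=> Js; have TJs := TJ_succ HR (J_sub_TJ Js).
split; first exact: AJ_theta.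
case: i Js TJs => [|i] Js TJs; last exact: dF_theta0.
rewrite (augF_theta0 deg_gt0 HR HA TJs).
have /wsetP s1 : Lge 1 s.
  move: s Js {TJs} => s /(J_succ HR); apply: tprod_min => [|u v u1 _].
    exact: subspace_wset.
  by have := len_ge_mul u1 (@len_ge0 k X v).
by rewrite s1 //= size_word_one.
Qed.

Lemma linear_thetaB i t s : th i (t - s) = th i t - th i s.
Proof. by have [f ff] := linear_funE (linear_theta pi HR i); rewrite -!ff linearB. Qed.

Lemma linear_thetaD i t s : th i (t + s) = th i t + th i s.
Proof. by have [f ff] := linear_funE (linear_theta pi HR i); rewrite -!ff linearD. Qed.

(** Injectivity of J_(i+1) -> Z_i / A_+ Z_i. *)
Definition separated (i : nat) := forall s, J R i.+1 s -> pos_cycle i (th i s) -> s = 0.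

(** Being in A_+ (x) J_i is expressed by a lift to T_+ J_i, because word length is lost in [A]. *)
Definition minimal (i : nat) := forall z, cycle i z ->
  exists2 t, (Lge 1 \ox J R i) t & (th i t : F) = z.

Lemma lge_TJ n i : Lge n \ox J R i `<=` TJ i.
Proof. exact: tprod_mono. Qed.

Lemma minimal0 : minimal 0.
Proof.
move=> z [Sz augz]; have [t Tt tz] := AJ_lift HA Sz.
exists t => //; rewrite tprod_tscalr; last exact: subspace_wset.
by apply: len_ge1E; rewrite -(augF_theta0 deg_gt0 HR HA Tt) tz.
Qed.

(** Lift the cycle to t = s + t' with s in J_(i+1) and t' in T_+ J_(i+1). As theta_i(t) = 0,
    theta_i(s) = - theta_i(t'), and this is in A_+ Z_i because theta_i maps J_(i+1) to cycles.
    Separation gives s = 0. *)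
Lemma minimalS i : separated i -> minimal i.+1.
Proof.
move=> sep z [Sz dz]; have [t Tt tz] := AJ_lift HA Sz.
have [s Js ts] := TJ_decomp Tt.
suff s0 : s = 0 by exists t => //; rewrite s0 subr0 in ts.
apply: sep => //.
have th0 : (th i t : F) = 0 by rewrite -(dF_theta pi HR Tt) tz.
have -> : (th i s : F) = - (th i (t - s) : F).
  by rewrite linear_thetaB opprB [X in _ - X]th0 subr0.
apply: (subspaceN (subspace_span _)).
move: (t - s) ts => u; apply: (@tprod_linear_image _ _ rF (th i) _ _ (pos_cycle i)).
- exact: linear_theta.
- split=> [|c x y]; first exact: span_zero.
  exact: (subspace_span _).2 c%:A x y.
move=> v w v1 Jw; rewrite (theta_act pi HR _ (TJ_succ HR (J_sub_TJ Jw))).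
apply: sub_span; exists (pi v), (th i w); split=> //.
  exact: (eps_pi_len deg_gt0 HA v1).
exact: theta_cycle.
Qed.

(** Both parities need lifts of A_+ Z_i to T(V), from different knowledge about lifts of Z_i; [Z1]
    and [Z] record that knowledge. *)
Lemma pos_cycle_lift i (Z1 Z : set T) : is_subspace Z ->
  (forall z, cycle i z -> exists t, [/\ TJ i t, Z1 t & (th i t : F) = z]) ->
  (forall u t, Lge 1 u -> Z1 t -> Z (u * t)) ->
  forall y, pos_cycle i y -> exists t, [/\ TJ i t, Z t & (th i t : F) = y].
Proof.
move=> sZ lift Z1Z y; elim=> [|c _ y' [a [z [a0 Zz ->]]] _ [t' [Tt' Zt' <-]]].
  exists 0; split; [exact: subspace0 (subspace_tprod _ _) | exact: subspace0 |].
  by have [f ff] := linear_funE (linear_theta pi HR i); rewrite -ff linear0.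
have [t [Tt Zt <-]] := lift z Zz.
have [v v1 va] := pi_surj_pos deg_gt0 HA a0.
have [u uc] := pi_surj HA c.
have TJm r s : TJ i s -> TJ i (r * s).
  apply: (@tprod_linear_image _ _ _ (fun s => r * s) _ _ (TJ i)).
  - exact: linear_mull.
  - exact: subspace_tprod.
  by move=> p q _ Jq; rewrite mulrA; apply: tprod_mul.
exists (u * v * t + t'); split.
- apply: subspaceD (subspace_tprod _ _) _ Tt'; exact: TJm.
- apply: subspaceD sZ _ Zt'; apply: Z1Z => //.
  have := len_ge_mul (@len_ge0 k X u) v1; exact.
refine (etrans (linear_thetaD _ _ _) _); congr (_ + _).
refine (etrans (theta_act pi HR _ Tt) _); rewrite -uc -va.
refine (etrans (congr1 (fun e : A => e *: (th i t : F)) (rmorphM pi u v)) _).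
exact/esym/scalerA.
Qed.

(** Cycles lift to T_+ J_i, so A_+ Z_i lifts to T_(>=2) J_i. Two lifts differ by an element of I
    J_i, again in T_(>=2) J_i. Hence s is in V J_i and in T_(>=2) J_i, which meet in 0. *)
Lemma separated_even j : minimal j.*2 -> separated j.*2.
Proof.
move=> min s Js Ys; set i := j.*2 in min Js Ys *.
have [t [Tt t2 ts]] : exists t, [/\ TJ i t, (Lge 2 \ox J R i) t & (th i t : F) = th i s].
  apply: pos_cycle_lift Ys => [|z /min[t t1 tz]|u t u1].
  - exact: subspace_tprod.
  - by exists t; split; [exact: lge_TJ t1 | exact: t1 |].
  apply: (@tprod_linear_image _ _ _ (fun t => u * t) _ _ (Lge 2 \ox J R i)).
  - exact: linear_mull.
  - exact: subspace_tprod.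
  by move=> p q p1 Jq; rewrite mulrA; apply: tprod_mul => //; exact: (len_ge_mul u1 p1).
have TJs := TJ_succ HR (J_sub_TJ Js).
have s2 : (Lge 2 \ox J R i) s.
  rewrite -[s](subrK t); apply: subspaceD (subspace_tprod _ _) _ t2.
  have T0 : TJ i (s - t) := subspaceB (subspace_tprod _ _) TJs Tt.
  have th0 : th i (s - t) = 0 by rewrite linear_thetaB [X in _ - X]ts subrr.
  have := theta_ker HA T0 th0.
  by apply: tprod_mono => //; apply: rel_ideal_len_ge2 HR.
apply: (lfree_disjoint (U1 := L 1) (lfree_J HR i) _ _ _ _ s2).
- exact: subspace_wset.
- exact: subspace_wset.
- by move=> x; apply: (@len_disjoint k X 1 2).
by have := J_oddl Js; rewrite genVE.
Qed.

(** A lift t of a cycle has theta_(i-1)(t) = 0, so it lies in I J_(i-1), and A_+ Z_i lifts to T_+ I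
    J_(i-1). Two lifts differ by an element of I J_i <= I T_+ J_(i-1). So s lies in (T_+ I + I T_+)
    J_(i-1) and in R J_(i-1), which meet in 0. *)
Lemma separated_odd j : separated j.*2.+1.
Proof.
move=> s Js Ys; set i := j.*2.+1 in Js Ys *.
have [t [Tt t2 ts]] : exists t,
    [/\ TJ i t, (dec_ideal R \ox J R j.*2) t & (th i t : F) = th i s].
  apply: (@pos_cycle_lift i (rel_ideal R \ox J R j.*2)) Ys => [|z [Sz dz]|u t u1].
  - exact: subspace_tprod.
  - have [t Tt tz] := AJ_lift HA Sz; exists t; split=> //.
    apply: (theta_ker HA (TJ_succ HR Tt)).
    by rewrite -[LHS](dF_theta pi HR Tt) tz.
  apply: (@tprod_linear_image _ _ _ (fun t => u * t) _ _ (dec_ideal R \ox J R j.*2)).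
  - exact: linear_mull.
  - exact: subspace_tprod.
  move=> p q Ip Jq; rewrite mulrA; apply: tprod_mul => //.
  by apply: sub_span; left; apply: tprod_mul.
have TJs := TJ_succ HR (J_sub_TJ Js).
have s2 : (dec_ideal R \ox J R j.*2) s.
  rewrite -[s](subrK t); apply: subspaceD (subspace_tprod _ _) _ t2.
  have T0 : TJ i (s - t) := subspaceB (subspace_tprod _ _) TJs Tt.
  have th0 : th i (s - t) = 0 by rewrite linear_thetaB [X in _ - X]ts subrr.
  have := theta_ker HA T0 th0.
  move: (s - t) => u Iu.
  have {Iu} : (rel_ideal R \ox (Lge 1 \ox J R j.*2)) u.
    by apply: tprod_mono Iu => // v; exact: (@J_succ _ _ _ _ HR j.*2).
  rewrite -tprodA; apply: tprod_mono => // v Iv.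
  by apply: sub_span; right.
apply: (lfree_disjoint (U1 := R) (lfree_J HR j.*2) _ _ _ _ s2).
- exact: rel_subspace HR.
- exact: subspace_span.
- exact: relations_dec_ideal HR.
exact: (J_add2 HR Js).
Qed.

(** The implications alternate: [minimal i] gives [separated i], and this gives [minimal i.+1]. *)
Lemma minimal_separated i : minimal i /\ separated i.
Proof.
have sep j : minimal j -> separated j.
  rewrite -[j]odd_double_half; case: (odd j) => /=; last exact: separated_even.
  by move=> _; exact: separated_odd.
elim: i => [|i [_ /minimalS m]].
  split; [exact: minimal0 | exact/sep/minimal0].
by split; [exact: m | exact/sep/m].
Qed.

End Minimal.

(** * Comparison with the bimodule complex *)

Section TensorLift.
Variables (k : fieldType) (U V : lmodType k).
Local Notation F := {malg k[(U * V)%type]}.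
Local Open Scope quotient_scope.

Lemma tens_pi_linear (c : k) (x y : F) :
  \pi_(tens U V) (c *: x + y) = c *: \pi_(tens U V) x + \pi_(tens U V) y :> tens U V.
Proof. by rewrite -[c *: \pi_(tens U V) x]/(tens_scale c _) tens_scale_pi -raddfD. Qed.

Lemma tens_ind (Z : set (tens U V)) : is_subspace Z ->
  (forall u v, Z (tens_pure u v)) -> forall x, Z x.
Proof.
move=> sZ Zp x; rewrite -[x]reprK; move: (repr x) => y.
pose Z' : set F := [set y | Z (\pi_(tens U V) y)].
have sZ' : is_subspace Z'.
  split=> [|c a b]; rewrite /Z' /=; first by rewrite raddf0; exact: (subspace0 sZ).
  by rewrite tens_pi_linear; exact: (sZ.2 c _ _).
suff: Z' y by [].
by apply: malg_subspace => // -[u v] _; apply: Zp.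
Qed.

Lemma tens_lift (N : lmodType k) (g : U -> V -> N) : bilin g ->
  exists f : {linear tens U V -> N}, forall u v, f (tens_pure u v) = g u v.
Proof.
move=> bg; pose G : F -> N := mlin (fun p => g p.1 p.2).
have lG : linear G by exact: linearP.
have GU u v : G << (u, v) >> = g u v by exact: mlinU1.
have [G' GG'] := linear_funE lG.
have G0 x : span (@tens_rel k U V) x -> G x = 0.
  rewrite -GG'; move: x.
  apply: (span_min (subspace_ker G')) => _ [c u u' v|c u v v'] /=.
    rewrite !linearB linearZ /= !GG' !GU (bilinDl _ _ _ bg) (bilinZl _ _ _ bg).
    by rewrite addrAC addrK subrr.
  rewrite !linearB linearZ /= !GG' !GU (bilinDr _ _ _ bg) (bilinZr _ _ _ bg).
  by rewrite addrAC addrK subrr.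
have fE (x : F) : G (repr (\pi_(tens U V) x)) = G x.
  apply/eqP; rewrite -subr_eq0 -!GG' -linearB GG'; apply/eqP/G0/tens_kerP.
  by rewrite Quotient.idealrBE reprK.
have [f ff] : exists f : {linear tens U V -> N}, f =1 (fun x => G (repr x)).
  apply: linear_funE => c x y.
  have [x' ->] := tens_pi_surj x; have [y' ->] := tens_pi_surj y.
  rewrite -tens_pi_linear !fE; exact: lG.
by exists f => u v; rewrite ff /tens_pure fE GU.
Qed.

Lemma bilin_tens_pure : bilin (@tens_pure k U V).
Proof.
by split=> [v c u u'|u c v v']; [exact: tens_pure_linl | exact: tens_pure_linr].
Qed.

Lemma tens_ext (N : lmodType k) (f g : tens U V -> N) : linear f -> linear g ->
  (forall u v, f (tens_pure u v) = g (tens_pure u v)) -> f =1 g.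
Proof.
move=> lf lg fg x; apply/eqP; rewrite -subr_eq0; apply/eqP; move: x.
have [h hE] := linear_funE (linear_sub lf lg).
have := @tens_ind [set x | h x = 0] (subspace_ker h) => H x.
rewrite -[LHS]hE; apply: (H _) => u v /=; by rewrite hE fg subrr.
Qed.

End TensorLift.

Section Bimodule.
Variables (k : fieldType) (X : choiceType) (R : set (tensalg k X)) (A : cgalg k).
Local Notation W := {fmonom X}.
Local Notation T := (tensalg k X).
Local Notation F := {malg A[W]}.
Local Notation rF := (resc {malg A[W]}).
Local Notation eps := (cga_eps A).
Local Notation tri a w b := (@tri k X A a w b).
Implicit Types (a b : A) (w : T).

Lemma tri_lin1 w b : linear (fun a => tri a w b).
Proof.
have bT := bilin_tens_pure (tens A T) A.
by move=> c a a'; rewrite /Defs.tri (bilin_tens_pure A T).1 bT.1.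
Qed.

Lemma tri_lin2 a b : linear (fun w => tri a w b).
Proof.
have bT := bilin_tens_pure (tens A T) A.
by move=> c w w'; rewrite /Defs.tri (bilin_tens_pure A T).2 bT.1.
Qed.

Lemma tri_lin3 a w : linear (fun b => tri a w b).
Proof. exact: (bilin_tens_pure (tens A T) A).2. Qed.

Lemma ATA_ext (N : lmodType k) (f g : ATA X A -> N) : linear f -> linear g ->
  (forall a w b, f (tri a w b) = g (tri a w b)) -> f =1 g.
Proof.
move=> lf lg fg; apply: tens_ext => // x b; move: x.
have lp : linear (fun x : tens A T => tens_pure x b).
  exact: (bilin_tens_pure (tens A T) A).1.
by apply: tens_ext => [||a w]; [exact: (linear_comp lf lp) | exact: (linear_comp lg lp) | exact: fg].
Qed.

Lemma ATA_lift (N : lmodType k) (g : A -> T -> A -> N) :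
  (forall w b, linear (fun a => g a w b)) -> (forall a b, linear (fun w => g a w b)) ->
  (forall a w, linear (g a w)) ->
  exists f : {linear ATA X A -> N}, forall a w b, f (tri a w b) = g a w b.
Proof.
move=> g1 g2 g3.
have b12 b : bilin (fun a w => g a w b) by split=> [w|a]; [exact: g1 | exact: g2].
have [f fE] := choice (fun b => tens_lift (b12 b)).
have bf : bilin (fun x b => f b x).
  split=> [b|x c b b']; first exact: linearP.
  have lf d : linear (f d) by exact: linearP.
  have lr : linear (fun x => c *: f b x + f b' x).
    move=> e u v; rewrite (lf b e u v) (lf b' e u v) !scalerDr !scalerA mulrC.
    by rewrite addrACA.
  move: x; apply: (tens_ext (lf _) lr) => a w.
  by rewrite !fE; exact: g3.
have [h hE] := tens_lift bf; exists h => a w b.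
by rewrite /Defs.tri hE fE.
Qed.

Lemma act_exists a b : exists f : {linear ATA X A -> ATA X A},
  forall a' w b', f (tri a' w b') = tri (a * a') w (b' * b).
Proof.
apply: ATA_lift.
- by move=> w b' c u v; rewrite mulrDr -scalerAr; exact: tri_lin1.
- by move=> a' b'; exact: tri_lin2.
- by move=> a' w c u v; rewrite mulrDl -scalerAl; exact: tri_lin3.
Qed.

Definition act a b : ATA X A -> ATA X A := sval (cid (act_exists a b)).

Lemma linear_actz a b : linear (act a b).
Proof. exact: linearP. Qed.

Lemma act_tri a b a' w b' : act a b (tri a' w b') = tri (a * a') w (b' * b).
Proof. by rewrite /act; case: cid => f /= ->. Qed.

Lemma linear_actl b z : linear (fun a => act a b z).
Proof.
move=> c a a'; move: z; apply: ATA_ext.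
- exact: linear_actz.
- move=> d u v; rewrite !linear_actz !scalerDr !scalerA mulrC; exact: addrACA.
by move=> u w v; rewrite !act_tri mulrDl -scalerAl; exact: tri_lin1.
Qed.

Lemma linear_actr a z : linear (fun b => act a b z).
Proof.
move=> c b b'; move: z; apply: ATA_ext.
- exact: linear_actz.
- move=> d u v; rewrite !linear_actz !scalerDr !scalerA mulrC; exact: addrACA.
by move=> u w v; rewrite !act_tri mulrDr -scalerAr; exact: tri_lin3.
Qed.

Lemma rho_exists : exists f : {linear ATA X A -> rF},
  forall a w b, f (tri a w b) = tp (eps b *: a) w.
Proof.
apply: ATA_lift.
- move=> w b c u v; rewrite scalerDr scalerA mulrC -scalerA.
  exact: (@bilin_tp _ X A).1.
- by move=> a b; exact: (@bilin_tp _ X A).2.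
- move=> a w c u v; rewrite rmorphD /= eps_scale scalerDl -scalerA.
  exact: (@bilin_tp _ X A).1.
Qed.

(* rho identifies K (x)_A k with A (x) J. *)
Definition rho : ATA X A -> rF := sval (cid rho_exists).

Lemma linear_rho : linear rho.
Proof. exact: linearP. Qed.

Lemma rho_tri a w b : rho (tri a w b) = tp (eps b *: a) w.
Proof. by rewrite /rho; case: cid => f /= ->. Qed.

Lemma rho_act a b z : rho (act a b z) = (eps b *: a) *: (rho z : F).
Proof.
move: z; apply: (@ATA_ext rF (fun z => rho (act a b z)) (fun z => (eps b *: a) *: (rho z : F))).
- exact: (linear_comp linear_rho (linear_actz a b)).
- exact: (linear_comp (@linear_act _ _ F _) linear_rho).
move=> a' w b'; rewrite act_tri; refine (etrans (rho_tri _ _ _) (esym _)).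
refine (etrans (congr1 (fun z : F => (eps b *: a) *: z) (rho_tri _ _ _)) _).
rewrite tpZ; congr (tp _ w).
by rewrite -scalerAl -scalerAr scalerA mulrC rmorphM.
Qed.

Definition sig (x : rF) : ATA X A :=
  \sum_(w <- msupp (x : F)) tri ((x : F)@_w) << w >> 1.

Lemma linear_sig : linear sig.
Proof.
move=> c x y; pose d := (msupp (x : F) `|` msupp (y : F))%fset.
have sigE (z : F) : (msupp z `<=` d)%fset -> sig z = \sum_(w <- d) tri z@_w << w >> 1.
  move=> zd; rewrite /sig; apply: big_fset_incl => // w _ /mcoeff_outdom ->.
  have [f ff] := linear_funE (tri_lin1 << w >> 1); by rewrite -ff linear0.
have sxy : (msupp (c%:A *: (x : F) + (y : F)) `<=` d)%fset.
  apply: fsubset_trans (msuppD_le _ _) _; apply: fsetUSS => //; exact: msuppZ_le.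
refine (etrans (sigE _ sxy) _).
rewrite (sigE x (fsubsetUl _ _)) (sigE y (fsubsetUr _ _)).
rewrite scaler_sumr -big_split; apply: eq_bigr => w _ /=.
rewrite mcoeffD mcoeffZ -scalerAl mul1r; exact: tri_lin1.
Qed.

Lemma sig_tp a w : sig (tp a w) = tri a w 1.
Proof.
move: w; apply: lin_ext.
- exact: (linear_comp linear_sig ((@bilin_tp _ X A).2 a)).
- exact: tri_lin2.
move=> w; rewrite tp_word /sig msuppU; case: eqP => [->|_].
  rewrite big_seq_fset0; have [f ff] := linear_funE (tri_lin1 << w >> 1).
  by rewrite -ff linear0.
by rewrite big_seq_fset1 mcoeffUU.
Qed.

Lemma KLR_tri i a w b : J R i w -> @KLR k X R A i (tri a w b).
Proof. by move=> Jw; apply: sub_span; exists a, w, b. Qed.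

Lemma subspace_KLR i : is_subspace (@KLR k X R A i).
Proof. exact: subspace_span. Qed.

Lemma KLR_act i a b z : @KLR k X R A i z -> @KLR k X R A i (act a b z).
Proof.
have [f ff] := linear_funE (linear_actz a b); rewrite -ff; move: z.
apply: span_linear_image => [|_ [a' [w [b' [Jw ->]]]]]; first exact: subspace_KLR.
by rewrite ff act_tri; apply: KLR_tri.
Qed.

(** On a generator, z - sig (rho z) is a (x) w (x) (b - eps b), whose last factor is in A_+. So an
    element of K_i killed by [rho] is in K_i A_+. *)
Lemma KLR_posP i z : KLR_pos R i z <-> @KLR k X R A i z /\ rho z = 0.
Proof.
have [r rE] := linear_funE linear_rho.
split=> [|[Kz rz0]].
  elim=> [|c _ y [a [w [b [b' [Jw b0 ->]]]]] _ [Ky ry]].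
    by split; [exact: span_zero | rewrite -rE linear0].
  split; first by apply: (subspace_KLR i).2 => //; apply: KLR_tri.
  rewrite linear_rho rho_tri ry rmorphM /= b0 mulr0 scale0r addr0.
  by rewrite (bilin0l _ (@bilin_tp _ X A)) scaler0.
suff: KLR_pos R i (z - sig (rho z)).
  rewrite rz0; have [s sE] := linear_funE linear_sig; by rewrite -sE linear0 subr0.
have l : linear (fun z => z - sig (rho z)).
  exact: (linear_sub (@linear_idfun _ _) (linear_comp linear_sig linear_rho)).
have [f fE] := linear_funE l; rewrite -[_ - _]fE; move: z Kz {rz0}.
apply: span_linear_image => [|_ [a [w [b [Jw ->]]]]]; first exact: subspace_span.
rewrite fE rho_tri sig_tp; apply: sub_span.
exists a, w, 1, (b - (eps b)%:A); split=> //.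
  by rewrite rmorphB /= cga_eps_scal subrr.
rewrite mul1r; have [f3 f3E] := linear_funE (tri_lin3 a w).
have [f1 f1E] := linear_funE (tri_lin1 w 1).
have E3 : tri a w (b - (eps b)%:A) = tri a w b - eps b *: tri a w 1.
  by rewrite -!f3E linearB linearZ.
have E1 : tri (eps b *: a) w 1 = eps b *: tri a w 1 by rewrite -!f1E linearZ.
by rewrite E3 E1.
Qed.

End Bimodule.

(** * The bimodule differential and its reduction to A (x) J *)

Section TwoSided.
Variables (k : fieldType) (X : choiceType) (deg : X -> nat) (R : set (tensalg k X)).
Variables (A : cgalg k) (pi : {lrmorphism (tensalg k X) -> A}).
Local Notation W := {fmonom X}.
Local Notation T := (tensalg k X).
Local Notation F := {malg A[W]}.
Local Notation rF := (resc {malg A[W]}).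
Local Notation "W1 \ox W2" := (tprod W1 W2) (at level 40, left associativity).
Local Notation L n := (@len_eq k X n).
Hypotheses (deg_gt0 : forall x, (0 < deg x)%N) (HR : space_of_relations deg R).
Hypothesis HA : presents deg R pi.
Local Notation th := (theta pi HR).
Local Notation dd := (dF pi HR).
Implicit Types (a b : A).

Local Notation eps := (cga_eps A).

Local Notation SJ i := (AJ HR i).
Local Notation tri a w b := (@tri k X A a w b).
Local Notation K i := (@KLR k X R A i).
Local Notation Je j := (J R j.*2).
Local Notation Jo j := (J R j.*2.+1).
Local Notation Act := (@act k X A).
Local Notation Rho := (@rho k X A).

(* pi (x) 1 (x) pi on V^(l) (x) T (x) V^(r). *)
Definition cut3 (l r : nat) : T -> ATA X A := ext3 l r (fun x y z => tri (pi x) y (pi z)).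

Lemma trilin_pi_tri : trilin (fun x y z : T => tri (pi x) y (pi z)).
Proof.
split=> [y z c u v|x z c u v|x y c u v].
- rewrite (_ : pi (c *: u + v) = c *: pi u + pi v); first exact: tri_lin1.
  exact: linearP.
- exact: tri_lin2.
- rewrite (_ : pi (c *: u + v) = c *: pi u + pi v); first exact: tri_lin3.
  exact: linearP.
Qed.

Lemma linear_cut3 l r : linear (cut3 l r).
Proof. exact: linear_ext3. Qed.

Lemma cut3_mul l r x y z : L l x -> L r z -> cut3 l r (x * y * z) = tri (pi x) y (pi z).
Proof. exact: ext3_mul trilin_pi_tri. Qed.

Opaque cut3.

Lemma len_eq0_1 : L 0 1.
Proof. by rewrite -tscalE; apply: tscal1. Qed.

Lemma cut3_mull l x y : L l x -> cut3 l 0 (x * y) = tri (pi x) y 1.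
Proof.
by move=> lx; rewrite -(mulr1 (x * y)) (cut3_mul y lx len_eq0_1) (rmorph1 pi).
Qed.

Lemma cut3_mulr r y z : L r z -> cut3 0 r (y * z) = tri 1 y (pi z).
Proof.
by move=> rz; rewrite -(mul1r y) (cut3_mul y len_eq0_1 rz) (rmorph1 pi) (mul1r y).
Qed.

Definition D_odd (w : T) : ATA X A := cut3 1 0 w - cut3 0 1 w.

Lemma linear_D_odd : linear D_odd.
Proof. exact: (linear_sub (linear_cut3 1 0) (linear_cut3 0 1)). Qed.

(** The formula involves N, the number of letters around J_(2j+1), which the lengths in w do not
    reveal since J_(2j+1) need not be homogeneous for length. Injectivity of T (x) J_(2j+1) -> T(V)
    lets N be read off as the length of the left factor. *)
Lemma D_even_exists j : exists f : {linear T -> ATA X A},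
  forall N w, (L N \ox Jo j) w -> f w = \sum_(l < N.+1) cut3 l (N - l) w.
Proof.
pose g (t s : T) : ATA X A :=
  mlin (fun v : W => \sum_(l < (size v).+1) cut3 l (size v - l) (<< v >> * s)) t.
have lsum (I : Type) (r : seq I) (h : I -> T -> ATA X A) :
    (forall i, linear (h i)) -> linear (fun s => \sum_(i <- r) h i s).
  move=> lh c u v; rewrite scaler_sumr -big_split; apply: eq_bigr => i _; exact: lh.
have lc l r v : linear (fun s => cut3 l r (v * s)).
  exact: (linear_comp (linear_cut3 l r) (linear_mull v)).
have bg : bilin g.
  split=> [s|t]; first exact: linearP.
  by apply: mlin_linear_fun => v; apply: lsum => l; exact: lc.
have [f fE] := lfree_ext (lfree_J HR j.*2.+1) bg; exists f => N.
have lr := lsum _ (index_enum 'I_N.+1) (fun l : 'I_N.+1 => cut3 l (N - l)) (fun l => linear_cut3 _ _).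
apply: (tprod_lin_eq _ lr) => [|t s Nt Js]; first exact: linearP.
rewrite fE //; move: t Nt; apply: wset_lin_eq.
- exact: bg.1.
- exact: (linear_comp lr (linear_mulr s)).
by move=> w /= /eqP <-; exact: mlinU1.
Qed.

Definition D_even j : T -> ATA X A := sval (cid (D_even_exists j)).

Lemma linear_D_even j : linear (D_even j).
Proof. exact: linearP. Qed.

Lemma D_evenE j N w : (L N \ox Jo j) w -> D_even j w = \sum_(l < N.+1) cut3 l (N - l) w.
Proof. by rewrite /D_even; case: cid => f /= fE; apply: fE. Qed.

(* [KD i w] is the value of the differential at [1 (x) w (x) 1], w in J_i. *)
Definition KD (i : nat) : T -> ATA X A := if odd i then D_odd else D_even i./2.-1.

Lemma KD_odd j : KD j.*2.+1 = D_odd.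
Proof. by rewrite /KD /= odd_double. Qed.

Lemma KD_even j : KD j.*2.+2 = D_even j.
Proof. by rewrite /KD /= odd_double /= doubleK. Qed.

Lemma linear_KD i : linear (KD i).
Proof. by rewrite /KD; case: ifP => _; [exact: linear_D_odd | exact: linear_D_even]. Qed.

Lemma delta0_exists i : exists f : {linear ATA X A -> ATA X A},
  forall a w b, f (tri a w b) = Act a b (KD i w).
Proof.
apply: ATA_lift => [w b|a b|a w].
- exact: linear_actl.
- exact: (linear_comp (linear_actz a b) (linear_KD i)).
- exact: linear_actr.
Qed.

Definition delta0 i : ATA X A -> ATA X A := sval (cid (delta0_exists i)).

Lemma linear_delta0 i : linear (delta0 i).
Proof. exact: linearP. Qed.

Lemma delta0_tri i a w b : delta0 i (tri a w b) = Act a b (KD i w).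
Proof. by rewrite /delta0; case: cid => f /= ->. Qed.

Lemma act_sum (I : Type) (r : seq I) a b (G : I -> ATA X A) :
  Act a b (\sum_(i <- r) G i) = \sum_(i <- r) Act a b (G i).
Proof. by have [f ff] := linear_funE (linear_actz (X := X) a b); rewrite -ff linear_sum; apply: eq_bigr. Qed.

Lemma act_sub a b u v : Act a b (u - v) = Act a b u - Act a b v.
Proof. by have [f ff] := linear_funE (linear_actz (X := X) a b); rewrite -!ff linearB. Qed.

Lemma delta0_odd j : diff_odd R pi j (delta0 j.*2.+1).
Proof.
move=> w s s' Jw sP s'P ws ws' a b; rewrite delta0_tri KD_odd.
have e1 : cut3 1 0 w = \sum_(p <- s) tri (pi p.1) p.2 1.
  rewrite ws (lin_fun_sum _ _ (linear_cut3 1 0)) big_seq [RHS]big_seq.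
  by apply: eq_bigr => p /sP[+ _]; rewrite genVE; exact: cut3_mull.
have e2 : cut3 0 1 w = \sum_(p <- s') tri 1 p.1 (pi p.2).
  rewrite ws' (lin_fun_sum _ _ (linear_cut3 0 1)) big_seq [RHS]big_seq.
  by apply: eq_bigr => p /s'P[_ +]; rewrite genVE; exact: cut3_mulr.
refine (etrans (congr1 (Act a b) (congr2 (fun u v => u - v) e1 e2)) _).
refine (etrans (act_sub a b _ _) _); apply: (congr2 (fun u v => u - v)).
  refine (etrans (act_sum _ _ _ _) _); apply: eq_bigr => p _.
  by rewrite act_tri (mul1r b).
refine (etrans (act_sum _ _ _ _) _); apply: eq_bigr => p _.
by rewrite act_tri (mulr1 a).
Qed.

(** Each summand [cut3 l (N - l)] is a function of w^N alone, so the value does not depend on the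
    chosen decompositions. *)
Lemma delta0_even j : diff_even R pi j (delta0 j.*2.+2).
Proof.
move=> w B wN s Jw wE sP sE a b; rewrite delta0_tri KD_even.
rewrite wE (lin_fun_sum _ _ (linear_D_even j)) act_sum; apply: eq_bigr => N _.
have NB := ltn_ord N.
(* The decomposition with l = N, whose right factors are scalars. *)
have LJ : (L N \ox Jo j) (wN N).
  rewrite (sE N N NB (leqnn N)); apply: subspace_sum => [|t ts _].
    exact: subspace_tprod.
  have [] := sP N N t NB (leqnn N) ts.
  rewrite subnn -[tpow _ 0]/(@tscal k X) tpow_genV => t1 t2 /tscalP[c ->].
  rewrite (tmulZr c) mulr1; apply: (subspaceZ c (subspace_tprod _ _)).
  exact: tprod_mul.
rewrite (D_evenE LJ) act_sum; apply: eq_bigr => l _.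
have lN : (l <= N)%N by rewrite -ltnS ltn_ord.
rewrite (sE N l NB lN) (lin_fun_sum _ _ (linear_cut3 l (N - l))) act_sum.
rewrite big_seq [RHS]big_seq; apply: eq_bigr => t ts.
have [+ _ +] := sP N l t NB lN ts; rewrite !tpow_genV => t1 t3.
by rewrite (cut3_mul _ t1 t3) act_tri.
Qed.

Lemma delta0_KLR_diff : is_KLR_diff R pi delta0.
Proof.
split=> [i c x y _ _|j|j].
- exact: linear_delta0.
- exact: delta0_odd.
- exact: delta0_even.
Qed.

Lemma tprod_seq S V x : is_subspace S -> (S \ox V) x ->
  exists2 s : seq (T * T), (forall p, p \in s -> S p.1 /\ V p.2) & x = \sum_(p <- s) p.1 * p.2.
Proof.
move=> sS; elim=> [|c _ y [u Su [v Vv <-]] _ [s sP ->]].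
  by exists [::] => //; rewrite big_nil.
exists ((c *: u, v) :: s); last by rewrite big_cons (scalerAl c).
move=> p; rewrite inE => /predU1P[->|/sP //].
by split=> //; exact: (subspaceZ c sS Su).
Qed.

Lemma tprod3_seq S V U x : is_subspace S -> (S \ox V \ox U) x ->
  exists2 s : seq (T * T * T), (forall p, p \in s -> [/\ S p.1.1, V p.1.2 & U p.2])
    & x = \sum_(p <- s) p.1.1 * p.1.2 * p.2.
Proof.
move=> sS; elim=> [|c _ y [u Su [v Uv <-]] _ [s sP ->]].
  by exists [::] => //; rewrite big_nil.
have [s' s'P ->] := tprod_seq sS Su.
exists ([seq (c *: p.1, p.2, v) | p <- s'] ++ s).
  move=> p; rewrite mem_cat => /orP[/mapP[q /s'P[S1 V2] ->]|/sP //].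
  by split=> //=; exact: (subspaceZ c sS S1).
rewrite big_cat big_map /=; congr (_ + _).
rewrite mulr_suml scaler_sumr; apply: eq_bigr => p _.
by rewrite -(scalerAl c p.1 p.2) -(scalerAl c (p.1 * p.2) v).
Qed.

Lemma span_mid_seq S (P : set nat) w : span (\bigcup_(N in P) mid S N) w ->
  exists B (wN : nat -> T), w = \sum_(N < B) wN N /\ forall N, mid S N (wN N).
Proof.
elim=> [|c u v [N0 _ uN] _ [B [vN [-> vP]]]].
  exists 0%N, (fun=> 0); rewrite big_ord0; split=> // N; exact: subspace0 (subspace_mid S N).
(* The new bound exceeds [N0] and is at least [B]; past [B] the old terms are replaced by 0. *)
exists (B + N0.+1)%N, (fun N => (if N == N0 then c *: u else 0) + (if (N < B)%N then vN N else 0)).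
have s0 N := subspace0 (subspace_mid S N).
split; last first.
  move=> N; apply: (subspaceD (subspace_mid S N)).
    by case: eqP => [->|_] //; exact: (subspaceZ c (subspace_mid S N0) uN).
  by case: ifP.
rewrite big_split /=; congr (_ + _).
  have N0B : (N0 < B + N0.+1)%N by rewrite addnS ltnS leq_addl.
  rewrite (bigD1 (Ordinal N0B)) //= eqxx big1 ?addr0 // => i.
  by rewrite -val_eqE /= => /negPf ->.
rewrite big_split_ord /= [X in _ = _ + X]big1 ?addr0; last first.
  by move=> i _; rewrite ltnNge leq_addr.
by apply: eq_bigr => i _; rewrite ltn_ord.
Qed.

(** The inclusions satisfied by J_(i+1) provide the decompositions that the formulas ask for, so any
    admissible differential is forced on the generators. *)
Lemma KLR_diff_unique delta i z : is_KLR_diff R pi delta -> K i.+1 z ->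
  delta i.+1 z = delta0 i.+1 z.
Proof.
move=> [lin dodd deven].
have key a w b : J R i.+1 w -> delta i.+1 (tri a w b) = delta0 i.+1 (tri a w b).
  rewrite -[i]odd_double_half; case: (odd i) => /=; last first.
    move=> Jw.
    have [s sP ws] := tprod_seq (subspace_span _) (J_oddl Jw).
    have [s' s'P ws'] := tprod_seq (subspace_J HR _) (J_oddr Jw).
    by rewrite (dodd _ w s s') // (@delta0_odd _ w s s').
  rewrite add1n => Jw.
  have [B [wN [wE wP]]] := span_mid_seq (J_even_mid HR Jw).
  have ex N l : exists s : seq (T * T * T), (l <= N)%N ->
      (forall p, p \in s -> [/\ L l p.1.1, Jo i./2 p.1.2 & L (N - l) p.2])
      /\ wN N = \sum_(p <- s) p.1.1 * p.1.2 * p.2.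
    have [lN|] := boolP (l <= N)%N; last by exists [::].
    have [s sP E] := tprod3_seq (@subspace_wset k X _) (wP N l lN).
    by exists s.
  have [s sP] := choice (fun p : nat * nat => ex p.1 p.2).
  have H1 N l t : (N < B)%N -> (l <= N)%N -> t \in s (N, l) ->
      [/\ tpow genV l t.1.1, Jo i./2 t.1.2 & tpow genV (N - l) t.2].
    by move=> _ lN ts; rewrite !tpow_genV; apply: (sP (N, l) lN).1.
  have H2 N l : (N < B)%N -> (l <= N)%N ->
      wN N = \sum_(t <- s (N, l)) t.1.1 * t.1.2 * t.2.
    by move=> _ lN; apply: (sP (N, l) lN).2.
  refine (etrans (deven _ w B wN (fun N l => s (N, l)) Jw wE H1 H2 a b) (esym _)).
  exact: (@delta0_even _ w B wN (fun N l => s (N, l)) Jw wE H1 H2 a b).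
elim=> [|c x y [a [w [b [Jw ->]]]] Ky IH].
  rewrite (lin_fun0 (linear_delta0 i.+1)).
  (* Linearity on K_(i+1) alone gives delta 0 = delta 0 + delta 0, hence delta 0 = 0. *)
  have := lin i 1 0 0 (span_zero _) (span_zero _); rewrite !scale1r !addr0 => E.
  by apply: (addrI (delta i.+1 0)); rewrite addr0 -E.
rewrite lin ?key //; last exact: KLR_tri.
by rewrite (linear_delta0 i.+1 c) IH.
Qed.

Lemma rho_sub u v : Rho (u - v) = Rho u - Rho v.
Proof. by have [f ff] := linear_funE (@linear_rho k X A); rewrite -!ff linearB. Qed.

(** [rho] applies the augmentation on the right, which kills every term with a letter there. For an
    odd index only the first cut survives, for an even one only l = N, and either gives theta. *)
Lemma rho_KD i w : J R i.+1 w -> Rho (KD i.+1 w) = th i w.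
Proof.
have tri0 a w' z : L z.+1 `<=` [set t | Rho (tri a w' (pi t)) = 0].
  move=> t tz /=; rewrite rho_tri (eps_pi_len deg_gt0 HA) ?scale0r.
    exact: bilin0l (@bilin_tp _ X A).
  exact: len_eq_ge tz.
have tri1 a w' : Rho (tri a w' 1) = tp a w' by rewrite rho_tri rmorph1 scale1r.
have lrc l r : linear (fun w => Rho (cut3 l r w)).
  exact: (linear_comp (@linear_rho k X A) (linear_cut3 l r)).
have cutl l S : S `<=` J R i -> forall w, (L l \ox S) w -> Rho (cut3 l 0 w) = th i w.
  move=> SJ; apply: tprod_lin_eq; [exact: lrc | exact: linear_theta |].
  move=> t s lt /SJ Js; rewrite (cut3_mull s lt) tri1.
  exact/esym/theta_mul.
rewrite -[i]odd_double_half in cutl *; case: (odd i) cutl => /= cutl.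
  rewrite add1n KD_even => Jw; move: w {Jw} (J_even_mid HR Jw).
  have lKD : linear (fun w => Rho (D_even i./2 w)).
    exact: (linear_comp (@linear_rho k X A) (linear_D_even _)).
  have [f fE] := linear_funE lKD; have [g gE] := linear_funE (linear_theta pi HR (1 + (i./2).*2)).
  move=> w; rewrite -[LHS]fE -[RHS]gE; move: w; apply: (span_lin_eq (f := f) (g := g)) => w [N _ Nw].
  rewrite fE gE (D_evenE (mid_lefts (subspace_J HR _) Nw)).
  rewrite (lin_fun_sum _ _ (@linear_rho k X A)) big_ord_recr /= subnn.
  have NJ : (L N \ox Jo i./2) w := mid_lefts (subspace_J HR _) Nw.
  have E1 := cutl N (Jo i./2) (fun x Jx => Jx) w NJ.
  refine (etrans (congr2 +%R _ E1) (add0r _)); apply: big1 => l _.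
  have lN := ltn_ord l; move: (Nw l (ltnW lN)).
  apply: (@tprod3_lin_eq _ _ _ (fun w => Rho (cut3 l (N - l) w)) (fun=> 0)).
  - exact: lrc.
  - exact: linear_zero.
  move=> x y z lx Jy lz; rewrite (cut3_mul y lx lz).
  by move: lz; rewrite -(subnSK lN); apply: tri0.
rewrite add0n KD_odd => Jw.
have E0 : Rho (cut3 0 1 w) = 0.
  move: w Jw => w /J_oddr; move: w.
  apply: (@tprod_lin_eq _ _ _ (fun w => Rho (cut3 0 1 w)) (fun=> 0)).
  - exact: lrc.
  - exact: linear_zero.
  move=> y z _; rewrite genVE => z1; rewrite (cut3_mulr y z1); exact: tri0 z1.
have E1 : Rho (cut3 1 0 w) = th i./2.*2 w.
  apply: (cutl 1%N (Je i./2)) => //.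
  by have := J_oddl Jw; rewrite genVE.
refine (etrans (rho_sub _ _) _).
exact: (etrans (congr2 (fun u v => u - v) E1 E0) (subr0 _)).
Qed.

Lemma rho_delta0 i z : K i.+1 z -> Rho (delta0 i.+1 z) = dd i (Rho z).
Proof.
move=> Kz.
have l1 : linear (fun z => Rho (delta0 i.+1 z)).
  exact: (linear_comp (@linear_rho k X A) (linear_delta0 _)).
have l2 : linear (fun z => dd i (Rho z) : rF).
  exact: (linear_comp (linear_resc (linear_dF pi HR i)) (@linear_rho k X A)).
have [f fE] := linear_funE l1; have [g gE] := linear_funE l2.
rewrite -[LHS]fE -[RHS]gE; move: z Kz; apply: (span_lin_eq (f := f) (g := g)) => _ [a [w [b [Jw ->]]]].
rewrite fE gE delta0_tri; refine (etrans (rho_act _ _ _) _).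
rewrite rho_tri dF_tp; exact: (congr1 (fun z : F => (eps b *: a) *: z) (rho_KD Jw)).
Qed.

Lemma KLR_delta0 i z : K i.+1 z -> K i (delta0 i.+1 z).
Proof.
have [f fE] := linear_funE (linear_delta0 i.+1); rewrite -fE; move: z.
have sK j := subspace_KLR R A j.
apply: span_linear_image => // _ [a [w [b [Jw ->]]]].
rewrite fE delta0_tri; apply: KLR_act.
rewrite -[i]odd_double_half in Jw *; case: (odd i) Jw => /= Jw.
  rewrite add1n KD_even; move: w {Jw} (J_even_mid HR Jw).
  have [g gE] := linear_funE (linear_D_even i./2) => w; rewrite -gE; move: w.
  apply: span_linear_image => // w [N _ Nw].
  rewrite gE (D_evenE (mid_lefts (subspace_J HR _) Nw)).
  apply: subspace_sum => // l _ _.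
  have lN : (l <= N)%N by rewrite -ltnS ltn_ord.
  move: (Nw l lN); apply: (@tprod3_linear_image _ _ _ (cut3 l (N - l)) _ _ _ (K _)) => //.
    exact: linear_cut3.
  by move=> x y z lx Jy lz; rewrite (cut3_mul y lx lz); apply: KLR_tri.
rewrite add0n KD_odd; apply: subspaceB => //.
  move: (J_oddl Jw); apply: (@tprod_linear_image _ _ _ (cut3 1 0) _ _ (K _)) => //.
    exact: linear_cut3.
  by move=> x y; rewrite genVE => x1 Jy; rewrite (cut3_mull y x1); apply: KLR_tri.
move: (J_oddr Jw); apply: (@tprod_linear_image _ _ _ (cut3 0 1) _ _ (K _)) => //.
  exact: linear_cut3.
by move=> x y Jx; rewrite genVE => y1; rewrite (cut3_mulr x y1); apply: KLR_tri.
Qed.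

End TwoSided.

(** * Multi-Koszulness as exactness of A (x) J *)

Section Acyclic.
Variables (k : fieldType) (X : choiceType) (deg : X -> nat) (R : set (tensalg k X)).
Variables (A : cgalg k) (pi : {lrmorphism (tensalg k X) -> A}).
Local Notation W := {fmonom X}.
Local Notation F := {malg A[W]}.
Local Notation rF := (resc {malg A[W]}).
Hypotheses (deg_gt0 : forall x, (0 < deg x)%N) (HR : space_of_relations deg R).
Hypothesis HA : presents deg R pi.
Local Notation th := (theta pi HR).
Local Notation dd := (dF pi HR).
Implicit Types (a b : A).

Local Notation eps := (cga_eps A).

Local Notation SJ i := (AJ HR i).
Local Notation tri a w b := (@tri k X A a w b).
Local Notation K i := (@KLR k X R A i).
Local Notation Rho := (@rho k X A).
Local Notation Sig := (@sig k X A).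
Local Notation cyc := (cycle pi HR).
Local Notation d0 := (delta0 pi HR).

Definition acyclic : Prop := forall i (x : F), cyc i x -> exists2 y, SJ i.+1 y & dd i y = x.

Lemma theta_TJ_AJ i (x : F) : SJ i.+1 x -> cyc i (dd i x).
Proof.
move=> Sx; have [t Tt <-] := AJ_lift HA Sx.
rewrite (dF_theta pi HR Tt).
have sc : is_subspace (cyc i : set rF).
  have [s1 s2] := subspace_AJ A HR i.
  split=> [|c x1 x2 [S1 z1] [S2 z2]].
    split; first exact: s1.
    by case: i {s1 s2 Sx Tt} => [|i]; [rewrite /augF mcoeff0 rmorph0 | exact: lin_fun0 (linear_dF pi HR i)].
  split; first exact: (s2 c%:A).
  case: i {s1 s2 Sx Tt S1 S2} z1 z2 => [|i] z1 z2.
    by rewrite augFD augFZ z1 z2 mulr0 addr0.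
  by rewrite (linear_dF pi HR i c%:A x1 x2) z1 z2 scaler0 addr0.
move: t {x Sx} Tt; apply: (@tprod_linear_image _ _ rF (th i) _ _ (cyc i)) => //.
  exact: linear_theta.
move=> u v _ Jv; have [Sv zv] := theta_cycle deg_gt0 HR HA Jv.
rewrite (theta_act pi HR u (TJ_succ HR (J_sub_TJ Jv))).
split; first exact: (subspaceZ (pi u) (subspace_AJ A HR i) Sv).
case: i {sc Sv} zv Jv => [|i] zv Jv; first by rewrite augFZ zv mulr0.
refine (etrans (lin_funZ (pi u) _ (linear_dF pi HR i)) _).
by rewrite zv scaler0.
Qed.

Lemma AJ_rho i z : K i z -> SJ i (Rho z).
Proof.
have sAJ : is_subspace (SJ i : set rF).
  by split=> [|c x y]; [exact: (subspace_AJ A HR i).1 | exact: (subspace_AJ A HR i).2 c%:A x y].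
have [f fE] := linear_funE (@linear_rho k X A); rewrite -fE; move: z.
apply: span_linear_image => // _ [a [w [b [Jw ->]]]].
by rewrite fE rho_tri; apply: AJ_tp.
Qed.

Lemma sig_AJ i x : SJ i x -> K i (Sig x) /\ Rho (Sig x) = x.
Proof.
move: x; apply: AJ_ind.
- rewrite (lin_fun0 (@linear_sig k X A)); split; first exact: span_zero.
  exact: lin_fun0 (@linear_rho k X A).
- move=> x y [Kx rx] [Ky ry].
  have E : Sig (x + y) = Sig x + Sig y.
    exact: lin_funD (@linear_sig k X A).
  apply: (eq_ind_r (fun s => K i s /\ Rho s = (x + y : F)) _ E).
  split; first exact: (spanD Kx Ky).
  refine (etrans (lin_funD (Sig x) (Sig y) (@linear_rho k X A)) _).
  exact: (congr2 (fun u v : F => u + v) rx ry).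
move=> a t Jt; rewrite sig_tp; split; first exact: KLR_tri.
by rewrite rho_tri rmorph1 scale1r.
Qed.

Lemma aug_rho (aug : ATA X A -> k^o) z : is_KL_aug R aug -> K 0 z -> aug z = augF (Rho z).
Proof.
move=> [lin augE]; elim=> [|c _ y [a [_ [b [/tscalP[e ->] ->]]]] Ky IH].
  have aug0 : augF (Rho 0) = 0.
    by rewrite (lin_fun0 (@linear_rho k X A)) /augF mcoeff0 rmorph0.
  rewrite aug0; have := lin 1 0 0 (span_zero _) (span_zero _); rewrite !scale1r !addr0 => E.
  by apply: (addrI (aug 0)); rewrite addr0 -E.
rewrite lin //; last by apply: KLR_tri; apply/tscalP; exists e.
rewrite IH (@linear_rho k X A c) rho_tri augE.
rewrite (@linear_augF k X A c (tp (eps b *: a) (e%:A)) (Rho y)).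
congr (_ + _); congr (_ * _).
by rewrite augF_tp mcoeffZ mcoeff1 eqxx mulr1 eps_scale [RHS]mulrCA [RHS]mulrC [e * _]mulrC.
Qed.

Lemma aug0_is_KL_aug : is_KL_aug R (fun z : ATA X A => augF (Rho z) : k^o).
Proof.
split=> [c x y _ _|a c b].
  by rewrite (@linear_rho k X A c x y); exact: (@linear_augF k X A).
by rewrite rho_tri augF_tp mcoeffZ mcoeff1 eqxx mulr1 eps_scale [LHS]mulrCA [LHS]mulrC [c * _]mulrC.
Qed.

Lemma boundary_rho i z y : K i z -> K i.+1 y ->
  @KLR_pos k X R A i (z - d0 i.+1 y) <-> (Rho z : F) = dd i (Rho y).
Proof.
move=> Kz Ky; rewrite -(rho_delta0 deg_gt0 HR HA Ky).
have Kzy : K i (z - d0 i.+1 y).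
  exact: (subspaceB (subspace_KLR R A i) Kz (KLR_delta0 pi HR Ky)).
split=> [/KLR_posP[_]|E].
  by rewrite rho_sub => /eqP; rewrite subr_eq0 => /eqP.
by apply/KLR_posP; split=> //; rewrite rho_sub [X in X - _]E subrr.
Qed.

(** Uniqueness replaces any differential by [delta0], and [rho] with its section [sig] turns
    congruences modulo K A_+ into equalities in A (x) J. *)
Lemma multi_koszul_acyclic : multi_koszul R pi <-> acyclic.
Proof.
(* The common form of the two exactness clauses; [P] is their way of saying that [z] becomes a
   cycle. *)
have ex i (P : ATA X A -> Prop) z : K i z -> (P z <-> cyc i (Rho z)) ->
    (P z <-> exists2 y, K i.+1 y & @KLR_pos k X R A i (z - d0 i.+1 y)) <->
    (cyc i (Rho z) -> exists2 y, SJ i.+1 y & dd i y = Rho z).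
  move=> Kz Pz; split=> [H /Pz/H[y Ky /(boundary_rho Kz Ky) E]|H].
    by exists (Rho y); [exact: AJ_rho | rewrite E].
  split=> [/Pz/H[y Sy dy]|[y Ky /(boundary_rho Kz Ky) E]].
    have [Ks rs] := sig_AJ Sy; exists (Sig y) => //.
    by apply/(boundary_rho Kz Ks); rewrite rs.
  by apply/Pz; rewrite E; apply/theta_TJ_AJ/AJ_rho.
have cyc0 z : K 0 z -> augF (Rho z) = 0 <-> cyc 0 (Rho z).
  by move=> Kz; split=> [E|[]] //; split=> //; exact: AJ_rho.
have cycS i z : K i.+1 z -> @KLR_pos k X R A i (d0 i.+1 z) <-> cyc i.+1 (Rho z).
  move=> Kz; split=> [/KLR_posP[_ E]|[_ E]].
    by split; [exact: AJ_rho | rewrite -(rho_delta0 deg_gt0 HR HA Kz)].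
  apply/KLR_posP; split; first exact: KLR_delta0.
  by rewrite (rho_delta0 deg_gt0 HR HA Kz).
split=> [[delta [aug [dP aP [_ H0 HS]]]] i x cx|acyc].
  have [Sx _] := cx; have [Ks rs] := sig_AJ Sx.
  rewrite -rs in cx *; move: cx; case: i Ks {Sx rs} => [|i] Ks.
    apply/(ex _ (fun z => augF (Rho z) = 0) _ Ks (cyc0 _ Ks)).
    rewrite -(aug_rho aP Ks); refine (iff_trans (H0 _ Ks) _).
    by split=> -[y Ky Py]; exists y => //; move: Py; rewrite (KLR_diff_unique HR dP Ky).
  apply/(ex _ (fun z => @KLR_pos k X R A i (d0 i.+1 z)) _ Ks (cycS _ _ Ks)).
  rewrite -(KLR_diff_unique HR dP Ks); refine (iff_trans (HS _ _ Ks) _).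
  by split=> -[y Ky Py]; exists y => //; move: Py; rewrite (KLR_diff_unique HR dP Ky).
exists d0, (fun z => augF (Rho z)); split.
- exact: delta0_KLR_diff.
- exact: aug0_is_KL_aug.
split=> [c|z Kz|i z Kz].
- exists (tri 1 (c%:A) 1); first by apply: KLR_tri; apply/tscalP; exists c.
  by rewrite aug0_is_KL_aug.2 !rmorph1 mul1r mulr1.
- by apply/(ex _ (fun z => augF (Rho z) = 0) _ Kz (cyc0 _ Kz)); exact: acyc.
by apply/(ex _ (fun z => @KLR_pos k X R A i (d0 i.+1 z)) _ Kz (cycS _ _ Kz)); exact: acyc.
Qed.

End Acyclic.

(** * Graded modules *)

Section Components.
Variables (I : eqType) (M : zmodType) (G : I -> set M).
Hypothesis gG : is_grading G.

Lemma grading0 i : G i 0.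
Proof. by case: gG => /(_ i)[]. Qed.

Lemma gradingB i x y : G i x -> G i y -> G i (x - y).
Proof. by case: gG => /(_ i)[_ h] _ _; apply: h. Qed.

Lemma gradingN i x : G i x -> G i (- x).
Proof. by move=> Gx; rewrite -sub0r; apply: gradingB => //; exact: grading0. Qed.

Lemma gradingD i x y : G i x -> G i y -> G i (x + y).
Proof. by move=> Gx Gy; rewrite -[y]opprK; apply: gradingB => //; apply: gradingN. Qed.

Lemma gradingMn i x n : G i x -> G i (x *+ n).
Proof.
move=> Gx; elim: n => [|n IH]; first exact: grading0.
by rewrite mulrS; apply: gradingD.
Qed.

Definition is_decomp (x : M) (f : I -> M) : Prop :=
  (forall i, G i (f i)) /\
  exists s, [/\ uniq s, forall i, i \notin s -> f i = 0 & x = \sum_(i <- s) f i].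

Lemma decomp_widen (s u : seq I) (f : I -> M) : uniq s -> uniq u -> {subset s <= u} ->
  (forall i, i \notin s -> f i = 0) -> \sum_(i <- s) f i = \sum_(i <- u) f i.
Proof.
move=> us uu su f0; rewrite [RHS](bigID (mem s)) /= [X in _ + X]big1 ?addr0.
  rewrite -[RHS]big_filter; apply: perm_big; apply: uniq_perm => //.
    exact: filter_uniq.
  by move=> i; rewrite mem_filter; case: (boolP (i \in s)) => // /su ->.
by move=> i /f0.
Qed.

Lemma decomp_unique x f g : is_decomp x f -> is_decomp x g -> f =1 g.
Proof.
move=> [Gf [s [us fs xf]]] [Gg [t [ut gt xg]]] i.
pose u := undup (s ++ t).
have su : {subset s <= u} by move=> j js; rewrite mem_undup mem_cat js.
have tu : {subset t <= u} by move=> j jt; rewrite mem_undup mem_cat jt orbT.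
have [iu|iu] := boolP (i \in u); last first.
  rewrite fs; last by apply: contra iu => /su.
  by rewrite gt //; apply: contra iu => /tu.
apply/eqP; rewrite -subr_eq0; apply/eqP.
case: gG => _ _ /(_ u (fun j => f j - g j) (undup_uniq _)) ind; apply: ind iu.
  by move=> j; apply: gradingB.
rewrite sumrB -(decomp_widen us (undup_uniq _) su fs).
by rewrite -(decomp_widen ut (undup_uniq _) tu gt) -xf -xg subrr.
Qed.

Lemma decomp_exists x : exists f, is_decomp x f.
Proof.
case: gG => _ /(_ x)[s [f [Gf ->]]] _.
(* The list [s] may repeat an index; its multiplicity is moved into the component. *)
exists (fun i => f i *+ count_mem i s); split=> [i|]; first exact: gradingMn.
exists (undup s); split; first exact: undup_uniq.
  by move=> i; rewrite mem_undup => /count_memPn ->.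
by rewrite -[LHS]big_undup_iterop_count; apply: eq_bigr.
Qed.

Definition gcomp (i : I) (x : M) : M := sval (cid (decomp_exists x)) i.

Lemma gcompP x : is_decomp x (gcomp^~ x).
Proof. by rewrite /gcomp; case: cid. Qed.

Lemma gcomp_in i x : G i (gcomp i x).
Proof. by case: (gcompP x). Qed.

Lemma gcomp_unique x f i : is_decomp x f -> gcomp i x = f i.
Proof. by move=> Df; exact: (decomp_unique (gcompP x) Df i). Qed.

Lemma gcomp_homog i j x : G j x -> gcomp i x = if i == j then x else 0.
Proof.
move=> Gx; apply: (gcomp_unique (f := fun i => if i == j then x else 0)); split=> [l|].
  by case: eqP => [->|_] //; exact: grading0.
exists [:: j]; split=> //; last by rewrite big_seq1 eqxx.
by move=> l; rewrite inE => /negPf ->.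
Qed.

Lemma gcompB i x y : gcomp i (x - y) = gcomp i x - gcomp i y.
Proof.
apply: (gcomp_unique (f := fun i => gcomp i x - gcomp i y)).
have [Gf [s [us fs xf]]] := gcompP x; have [Gg [t [ut gt xg]]] := gcompP y.
split=> [j|]; first by apply: gradingB; apply: gcomp_in.
exists (undup (s ++ t)); split; first exact: undup_uniq.
  by move=> j; rewrite mem_undup mem_cat negb_or => /andP[/fs -> /gt ->]; rewrite subrr.
rewrite sumrB {1}xf {1}xg; congr (_ - _); apply: decomp_widen; rewrite ?undup_uniq //.
  by move=> j js; rewrite mem_undup mem_cat js.
by move=> j jt; rewrite mem_undup mem_cat jt orbT.
Qed.

Lemma gcomp0 i : gcomp i 0 = 0.
Proof. by rewrite (gcomp_homog i (grading0 i)) eqxx. Qed.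

Lemma gcompD i x y : gcomp i (x + y) = gcomp i x + gcomp i y.
Proof.
by rewrite -{1}[y]opprK gcompB -{2}[y]subr0 -[- y]sub0r gcompB gcomp0 sub0r opprK subr0.
Qed.

Lemma gcomp_sum x : exists2 s, uniq s & x = \sum_(i <- s) gcomp i x.
Proof. by have [_ [s [us _ xs]]] := gcompP x; exists s. Qed.

End Components.

(** [e] is n |-> n + d for a map of degree d, and n |-> m + n for the action of an element of [A] of
    degree m. *)
Lemma gcomp_morph (I J : eqType) (M N : zmodType) (G : I -> set M) (H : J -> set N)
    (gG : is_grading G) (gH : is_grading H) (f : M -> N) (e : I -> J) i x :
  injective e -> {morph f : x y / x + y} -> (forall i x, G i x -> H (e i) (f x)) ->
  gcomp gH (e i) (f x) = f (gcomp gG i x).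
Proof.
move=> ie fD fG.
have f0 : f 0 = 0 by apply: (addrI (f 0)); rewrite -fD !addr0.
have [s us xs] := gcomp_sum gG x.
have -> : f x = \sum_(j <- s) f (gcomp gG j x) by rewrite {1}xs (big_morph f fD f0).
have gsum (r : seq I) : gcomp gH (e i) (\sum_(j <- r) f (gcomp gG j x)) =
    \sum_(j <- r) gcomp gH (e i) (f (gcomp gG j x)).
  by apply: (big_morph (gcomp gH (e i))); [exact: gcompD | exact: gcomp0].
rewrite gsum.
have gE j : gcomp gH (e i) (f (gcomp gG j x)) = if i == j then f (gcomp gG j x) else 0.
  rewrite (gcomp_homog gH _ (fG _ _ (gcomp_in gG j x))).
  by rewrite (inj_eq ie).
under eq_bigr do rewrite gE.
have [si|nsi] := boolP (i \in s).
  rewrite (bigD1_seq i) //= eqxx big1 ?addr0 // => j.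
  by rewrite eq_sym => /negPf ->.
(* Summing to x over [s] does not by itself say that the other components vanish; uniqueness of the
   decomposition does. *)
have -> : gcomp gG i x = 0.
  have [Gf [t [ut ft xt]]] := gcompP gG x.
  have Dx : is_decomp G x (fun j => if j \in s then gcomp gG j x else 0).
    split=> [j|]; first by case: ifP => _; [exact: gcomp_in | exact: grading0 gG j].
    exists s; split=> // [j /negPf -> //|].
    by rewrite {1}xs big_seq [RHS]big_seq; apply: eq_bigr => j ->.
  by rewrite (gcomp_unique gG i Dx) (negPf nsi).
rewrite f0 big_seq big1 // => j js; case: eqP => // ij.
by rewrite ij js in nsi.
Qed.

Lemma is_gradingI (I : eqType) (M : zmodType) (G : I -> set M) :
  (forall i, G i 0 /\ (forall x y, G i x -> G i y -> G i (x - y))) ->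
  (forall x, exists (r : seq (I * M)), (forall p, p \in r -> G p.1 p.2) /\ x = \sum_(p <- r) p.2) ->
  (forall (s : seq I) (f : I -> M), uniq s -> (forall i, G i (f i)) ->
        \sum_(i <- s) f i = 0 -> forall i, i \in s -> f i = 0) ->
  is_grading G.
Proof.
move=> G0B Gr Gi; split=> // x; have [r [rG ->]] := Gr x.
have GD i y z : G i y -> G i z -> G i (y + z).
  have [G0 GB] := G0B i; move=> Gy Gz; rewrite -[z]opprK; apply: (GB) => //.
  by rewrite -sub0r; apply: GB.
exists (undup [seq p.1 | p <- r]), (fun i => \sum_(p <- r | p.1 == i) p.2); split=> [i|].
  rewrite big_seq_cond; elim/big_ind: _ => [|y z|p /andP[pr /eqP <-]].
  - by case: (G0B i).
  - exact: GD.
  - exact: rG.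
under [RHS]eq_bigr do rewrite big_mkcond.
rewrite exchange_big /= big_seq [RHS]big_seq; apply: eq_bigr => p pr.
rewrite (bigD1_seq p.1) ?undup_uniq //=; last by rewrite mem_undup map_f.
by rewrite eqxx big1 ?addr0 // => i; rewrite eq_sym => /negPf ->.
Qed.

Section SubModule.
Variables (B : nzRingType) (M : lmodType B) (S : set M) (sS : is_subspace S).

(** The proof is an argument so that the submodule structure can be inferred from the predicate
    alone. *)
Definition smod_pred of is_subspace S : {pred M} := fun x => `[<S x>].

Lemma smod_predP x : reflect (S x) (x \in smod_pred sS).
Proof. exact: asboolP. Qed.

Fact smod_closed : GRing.subsemimod_closed (smod_pred sS).
Proof.
split=> [|c x]; last by move=> /smod_predP Sx; apply/smod_predP/(subspaceZ c sS Sx).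
split; first exact/smod_predP/(subspace0 sS).
by move=> x y /smod_predP Sx /smod_predP Sy; apply/smod_predP/(subspaceD sS Sx Sy).
Qed.

HB.instance Definition _ := GRing.isSubmodClosed.Build B M (smod_pred sS) smod_closed.

Definition smod : Type := {x : M | x \in smod_pred sS}.

HB.instance Definition _ := [isSub of smod for @sval M (fun x => x \in smod_pred sS)].
HB.instance Definition _ := [Choice of smod by <:].
HB.instance Definition _ := [SubChoice_isSubLmodule of smod by <:].

Definition smval (u : smod) : M := val u.

Lemma linear_smval : linear smval.
Proof. exact: (@linearP _ _ _ _ (val : {linear smod -> M})). Qed.

Lemma smval_inj : injective smval.
Proof. exact: val_inj. Qed.

Lemma smodP (u : smod) : S (smval u).
Proof. exact/smod_predP/(valP u). Qed.

Definition to_smod x (Sx : S x) : smod := exist _ x (introT (smod_predP x) Sx).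

End SubModule.

Section GradedModules.
Variables (k : fieldType) (A : cgalg k).
Implicit Types (M N P : grmod A).

Definition gc M := gcomp (grmod_grading M).

Lemma gr_hom_linear M N d (f : M -> N) : gr_hom d f -> linear f.
Proof. by case. Qed.

Lemma gr_homD M N d (f : M -> N) : gr_hom d f -> {morph f : x y / x + y}.
Proof. by move=> /gr_hom_linear lf x y; exact: lin_funD. Qed.

Lemma gr_homB M N d (f : M -> N) : gr_hom d f -> {morph f : x y / x - y}.
Proof. by move=> /gr_hom_linear lf x y; exact: lin_funB. Qed.

Lemma gr_homZ M N d (f : M -> N) : gr_hom d f -> forall a, {morph f : x / a *: x}.
Proof. by move=> /gr_hom_linear lf a x; exact: lin_funZ. Qed.

Lemma gr_hom_0 M N d (f : M -> N) : gr_hom d f -> f 0 = 0.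
Proof. by move=> /gr_hom_linear lf; exact: lin_fun0. Qed.

Lemma gc_hom M N d (f : M -> N) n x : gr_hom d f ->
  gc (M := N) (n + d) (f x) = f (gc n x).
Proof.
move=> hf; apply: (@gcomp_morph _ _ _ _ _ _ _ _ f (fun n : int => n + d)).
- exact: addIr.
- exact: gr_homD hf.
- by case: hf.
Qed.

Lemma gc_act M m n (a : A) (x : M) : cga_comp m a ->
  gc (m%:Z + n) (a *: x) = a *: gc n x.
Proof.
move=> ma; apply: (@gcomp_morph _ _ _ _ _ _ _ _ (fun x : M => a *: x) (fun n : int => m%:Z + n)).
- exact: addrI.
- by move=> y z; rewrite scalerDr.
- by move=> i y; apply: grmod_act.
Qed.

Definition gr_submodule M (S : set M) : Prop :=
  is_subspace S /\ forall n x, S x -> S (gc n x).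

Section SubGrmod.
Variables (M : grmod A) (S : set M) (hS : gr_submodule S).

Definition sub_comp (n : int) : set (smod hS.1) := [set u | grmod_comp n (smval u)].

Lemma sub_grading : is_grading sub_comp.
Proof.
pose gM := grmod_grading M; have lv := @linear_smval _ _ _ hS.1.
split=> [i|u|s f us fs sum0 i si].
- split=> [|x y]; rewrite /sub_comp /=; first by rewrite lin_fun0 //; exact: grading0 gM i.
  by rewrite lin_funB //; exact: (gradingB gM).
- have [s _ xs] := gcomp_sum gM (smval u).
  exists s, (fun i => to_smod hS.1 (hS.2 i _ (smodP u))); split=> [i|].
    exact: gcomp_in.
  by apply: smval_inj; rewrite (lin_fun_sum _ _ lv); apply: (etrans xs); apply: eq_bigr.
apply: smval_inj; rewrite [RHS]lin_fun0 //.
case: gM => _ _ /(_ s (fun i => smval (f i)) us); apply=> //.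
by rewrite -(lin_fun_sum _ _ lv) sum0 lin_fun0.
Qed.

Lemma sub_act m n (a : A) (u : smod hS.1) :
  cga_comp m a -> sub_comp n u -> sub_comp (m%:Z + n) (a *: u).
Proof.
move=> ma nu; rewrite /sub_comp /= (lin_funZ _ _ (@linear_smval _ _ _ hS.1)).
exact: grmod_act.
Qed.

Definition sub_grmod : grmod A := Grmod sub_grading sub_act.

Definition sub_val (u : sub_grmod) : M := smval (u : smod hS.1).
Definition sub_mk x (Sx : S x) : sub_grmod := to_smod hS.1 Sx.

Lemma sub_mkK x (Sx : S x) : sub_val (sub_mk Sx) = x.
Proof. by []. Qed.

Lemma sub_valP u : S (sub_val u).
Proof. exact: smodP. Qed.

Lemma sub_val_inj : injective sub_val.
Proof. exact: smval_inj. Qed.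

Lemma sub_val_hom : gr_hom 0 sub_val.
Proof.
split=> [a x y|n x]; last by rewrite addr0.
exact: linear_smval.
Qed.

Lemma sub_mk_hom N (f : N -> M) (Sf : forall x, S (f x)) d :
  gr_hom d f -> gr_hom d (fun x => sub_mk (Sf x)).
Proof.
move=> [fl fd]; split=> [a x y|n x nx]; last exact: fd.
by apply: sub_val_inj; rewrite (gr_hom_linear sub_val_hom) /= !sub_mkK fl.
Qed.

End SubGrmod.

Lemma gr_hom_comp M N P d e (f : N -> P) (g : M -> N) :
  gr_hom d f -> gr_hom e g -> gr_hom (e + d) (fun x => f (g x)).
Proof.
move=> [fl fd] [gl gd]; split=> [a x y|n x nx]; first by rewrite gl fl.
by rewrite addrA; apply/fd/gd.
Qed.

Lemma gr_hom_comp0 M N P d (f : N -> P) (g : M -> N) :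
  gr_hom d f -> gr_hom 0 g -> gr_hom d (fun x => f (g x)).
Proof. by move=> hf hg; have := gr_hom_comp hf hg; rewrite add0r. Qed.

Lemma gr_hom_sub M N d (f g : M -> N) :
  gr_hom d f -> gr_hom d g -> gr_hom d (fun x => f x - g x).
Proof.
move=> [fl fd] [gl gd]; split=> [a x y|n x nx].
  by rewrite fl gl opprD addrACA scalerBr.
by apply: (gradingB (grmod_grading N)); [exact: fd | exact: gd].
Qed.

Lemma gr_hom_id M : gr_hom 0 (@id M).
Proof. by split=> // n x; rewrite addr0. Qed.

Lemma gr_hom_zero M N d : gr_hom d (fun _ : M => 0 : N).
Proof.
split=> [a x y|n x _]; first by rewrite scaler0 addr0.
exact: grading0 (grmod_grading N) _.
Qed.

Lemma image_submodule M N (f : M -> N) : gr_hom 0 f -> gr_submodule (range f).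
Proof.
move=> hf; split.
  split=> [|c _ _ [x _ <-] [y _ <-]]; first by exists 0 => //; exact: gr_hom_0 hf.
  by exists (c *: x + y) => //; exact: gr_hom_linear hf _ _ _.
move=> n _ [x _ <-]; exists (gc n x) => //.
by rewrite -(gc_hom _ _ hf) addr0.
Qed.

(** Projectivity concerns surjections, so [D] and [f] are first corestricted to the image of [D], a
    graded submodule. *)
Lemma projective_lift P M N (D : M -> N) (f : P -> N) : gr_projective P ->
  gr_hom 0 D -> gr_hom 0 f -> (forall x, exists y, D y = f x) ->
  exists2 g : P -> M, gr_hom 0 g & forall x, D (g x) = f x.
Proof.
move=> pP hD hf fD; have hS := image_submodule hD.
have SD y : range D (D y) by exists y.
have Sf x : range D (f x) by have [y <-] := fD x.
have [|g hg gE] := pP _ _ _ _ (sub_mk_hom hS SD hD) _ (sub_mk_hom hS Sf hf).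
  move=> u; have [y _ yu] := sub_valP u; exists y.
  by apply: sub_val_inj; rewrite sub_mkK.
by exists g => // x; rewrite -(sub_mkK hS (SD (g x))) gE sub_mkK.
Qed.

Lemma homog_lift M N (g : M -> N) n y : gr_hom 0 g -> (exists x, g x = y) ->
  grmod_comp n y -> exists2 x, grmod_comp n x & g x = y.
Proof.
move=> hg [x xy] ny; exists (gc n x); first exact: gcomp_in.
rewrite -(gc_hom _ _ hg) addr0 xy /gc (gcomp_homog _ _ ny) eqxx //.
Qed.

End GradedModules.

(** * A (x) J as a complex of graded projective modules *)

Section GradedComplex.
Variables (k : fieldType) (X : choiceType) (deg : X -> nat) (R : set (tensalg k X)).
Variables (A : cgalg k) (pi : {lrmorphism (tensalg k X) -> A}).
Local Notation W := {fmonom X}.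
Local Notation T := (tensalg k X).
Local Notation F := {malg A[W]}.
Local Notation rF := (resc {malg A[W]}).
Local Notation "W1 \ox W2" := (tprod W1 W2) (at level 40, left associativity).
Local Notation TJ i := (setT \ox J R i).
Hypotheses (deg_gt0 : forall x, (0 < deg x)%N) (HR : space_of_relations deg R).
Hypothesis HA : presents deg R pi.
Local Notation th := (theta pi HR).
Implicit Types (a b : A) (t : T) (w : W).

Local Notation SJ i := (AJ HR i).
Local Notation pF i := (@prF k X deg R A HR i).
Local Notation wd w := (word_deg deg w)%:Z.

(** Modules are graded by the integers and [A] by the naturals: [A] is extended by 0 in negative
    degrees. *)
Definition Acomp (z : int) : set A := if z is Posz m then cga_comp m else [set 0].

Lemma Acomp0 z : Acomp z 0.
Proof. by case: z => [m|m] //=; exact: grading0 (cga_grading A) m. Qed.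

Lemma AcompB z a b : Acomp z a -> Acomp z b -> Acomp z (a - b).
Proof.
case: z => [m|m] /=; last by move=> -> ->; rewrite subrr.
by move=> ma mb; exact: (gradingB (cga_grading A) ma mb).
Qed.

Lemma Acomp_mul m z a b : cga_comp m a -> Acomp z b -> Acomp (m%:Z + z) (a * b).
Proof.
case: z => [n|n] /= ma; last by move=> ->; rewrite mulr0; exact: Acomp0.
exact: cga_mul.
Qed.

(** Indices below [d] carry only 0; j |-> |j - d| is injective on the others and reduces to the
    independence of the components of [A]. *)
Lemma Acomp_indep (d : int) (s : seq int) (f : int -> A) : uniq s ->
  (forall i, Acomp (i - d) (f i)) -> \sum_(i <- s) f i = 0 ->
  forall i, i \in s -> f i = 0.
Proof.
move=> us fA sum0 i si.
have neg0 j : (j < d)%R -> f j = 0.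
  by rewrite -subr_lt0; have := fA j; case: (j - d).
have [di|/neg0 //] := lerP d i.
pose s' := [seq absz (j - d) | j <- s & (d <= j)%R].
pose g (m : nat) := f (m%:Z + d).
have absK j : (d <= j)%R -> `|j - d|%N%:Z + d = j.
  by move=> dj; rewrite gez0_abs ?subrK // subr_ge0.
have us' : uniq s'.
  rewrite map_inj_in_uniq ?filter_uniq // => x y.
  rewrite !mem_filter => /andP[dx _] /andP[dy _] E.
  by rewrite -(absK x dx) -(absK y dy) E.
have gA m : cga_comp m (g m) by have := fA (m%:Z + d); rewrite addrK.
have gsum : \sum_(m <- s') g m = 0.
  rewrite big_map big_filter -[RHS]sum0 [RHS](bigID (fun j => d <= j)%R) /=.
  rewrite [X in _ = _ + X]big1 ?addr0; last by move=> j; rewrite -Order.TotalTheory.ltNge => /neg0.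
  by apply: eq_bigr => j dj; rewrite /g absK.
case: (cga_grading A) => _ _ /(_ s' g us' gA gsum `|i - d|%N).
by rewrite /g absK //; apply; apply: map_f; rewrite mem_filter di.
Qed.

Definition Fcomp (n : int) : set F := [set x | forall w, Acomp (n - wd w) (x@_w)].

Lemma Fcomp_word m a w : cga_comp m a -> Fcomp (m%:Z + wd w) (<< a *g w >> : F).
Proof.
move=> ma v; rewrite mcoeffU; case: eqP => [<-|_]; last exact: Acomp0.
by rewrite addrK.
Qed.

Lemma Fcomp_grading : is_grading Fcomp.
Proof.
apply: is_gradingI => [i|x|s f us fs sum0 i si].
- split=> [w|x y ix iy w]; first by rewrite mcoeff0; exact: Acomp0.
  by rewrite mcoeffB; apply: AcompB; [exact: ix | exact: iy].
- pose Z (x : F) := exists r : seq (int * F),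
    (forall p, p \in r -> Fcomp p.1 p.2) /\ x = \sum_(p <- r) p.2.
  have ZD y z : Z y -> Z z -> Z (y + z).
    move=> [r [rF ->]] [r' [r'F ->]]; exists (r ++ r'); rewrite big_cat; split=> // p.
    by rewrite mem_cat => /orP[/rF|/r'F].
  have Z0 : Z 0 by exists [::]; rewrite big_nil.
  suff: Z x by [].
  rewrite [x]monalgE; elim/big_ind: _ => // w _.
  have [s _ xs] := gcomp_sum (cga_grading A) x@_w; rewrite xs.
  rewrite raddf_sum; elim/big_ind: _ => // m _.
  exists [:: (m%:Z + wd w, << gcomp (cga_grading A) m x@_w *g w >>)].
  rewrite big_seq1; split=> // p; rewrite inE => /eqP -> /=.
  exact: (Fcomp_word w (gcomp_in (cga_grading A) m _)).
apply/malgP => w; rewrite mcoeff0.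
apply: (@Acomp_indep (wd w) s (fun i => (f i)@_w) us _ _ i si) => [j|].
  exact: fs.
by have /(congr1 (mcoeff w)) := sum0; rewrite raddf_sum mcoeff0.
Qed.

Lemma Fcomp_act m n (a : A) (x : F) : cga_comp m a -> Fcomp n x -> Fcomp (m%:Z + n) (a *: x).
Proof. by move=> ma nx w; rewrite mcoeffZ -addrA; apply: Acomp_mul => //; exact: nx. Qed.

Definition Fgr : grmod A := Grmod Fcomp_grading Fcomp_act.

Lemma Fcomp_scale n c (x : F) : Fcomp n x -> Fcomp n (c%:A *: x).
Proof.
move=> nx; rewrite -[n]add0r -[0]/(0%N%:Z); apply: Fcomp_act => //.
by rewrite cga_connected; exists c.
Qed.

Lemma subspace_Fcomp n : is_subspace (Fcomp n : set rF).
Proof.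
split=> [|c x y nx ny]; first exact: grading0 Fcomp_grading n.
by apply: (gradingD Fcomp_grading) => //; exact: (Fcomp_scale c nx).
Qed.

Lemma tp_homog m (n : nat) a t : cga_comp m a -> homog deg n t ->
  Fcomp (m%:Z + n%:Z) (tp a t : F).
Proof.
move=> ma nt w; rewrite (mcoeff_tp a t w).
have [|tw] := boolP (w \in msupp t); last first.
  by rewrite (mcoeff_outdom tw) scale0r; exact: Acomp0.
move=> /nt ->; rewrite addrK /= -[a]mul1r scalerAl -[m]add0n; apply: cga_mul => //.
by rewrite cga_connected; exists (t@_w).
Qed.

(** A homogeneous element of T J_i is not given as a sum of products of homogeneous factors. So the
    claim is proved for the degree n part of every element; for a word w and s in J_i, that part of
    w s is w times a component of s, again in J_i. *)
Lemma theta_homog i (n : nat) t : TJ i t -> homog deg n t -> Fcomp n (th i t : F).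
Proof.
have gJ := graded_J (i := i) (graded_relations HR).
suff key : forall t, TJ i t -> Fcomp n (th i (cmp deg n t)).
  by move=> /key + nt; rewrite (cmp_homog n nt) eqxx.
pose Z : set T := [set t | Fcomp n (th i (cmp deg n t) : F)].
have sF : is_subspace Z.
  have l : linear (fun t => th i (cmp deg n t)).
    exact: (linear_comp (linear_theta pi HR i) (linear_cmp _ n)).
  have [f fE] := linear_funE l.
  have -> : Z = f @^-1` (Fcomp n : set rF).
    by apply/seteqP; split=> u; rewrite /Z /= fE.
  exact: subspace_preim (subspace_Fcomp n).
have sub := tprod_min (S := setT) (V := J R i) sF.
move=> {}t; apply: sub t => u s _ Js.
have sV : is_subspace [set x | Z (x * s)] := subspace_mulr s sF.
suff Zw w : Z (<< w >> * s) by exact: (malg_subspace (x := u) sV (fun w _ => Zw w)).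
rewrite /Z /= cmpM.
have [wn|nw] := leqP (word_deg deg w) n; last first.
  rewrite big1 ?(lin_fun0 (linear_theta pi HR i)); first exact: grading0 Fcomp_grading n.
  by move=> p _; rewrite cmpU; case: eqP => [E|_]; rewrite ?mul0r //; move: (ltn_ord p); rewrite -E ltnS leqNgt nw.
rewrite -ltnS in wn; rewrite (bigD1 (Ordinal wn)) //= cmpU eqxx big1 ?addr0; last first.
  by move=> p; rewrite -val_eqE /= cmpU eq_sym => /negPf ->; rewrite mul0r.
rewrite (theta_mul pi HR _ (gJ _ _ Js)).
have -> : n%:Z = wd w + (n - word_deg deg w)%N%:Z by rewrite -PoszD subnKC.
apply: tp_homog; last exact: homog_cmp.
by case: HA => _ _; apply=> v; rewrite msuppU1 inE => /eqP ->.
Qed.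

Lemma mlin_gr_hom (M : grmod A) (g : W -> M) (d : int) :
  (forall w, grmod_comp (wd w + d) (g w)) -> gr_hom (N := Fgr) d (mlin g).
Proof.
have gM := grmod_grading M.
move=> gd; split=> [a x y|n x nx]; first exact: mlin_is_linear.
rewrite /mlin; elim/big_ind: _ => [|u v|w _]; [exact: grading0 gM _ | |].
  by move=> hu hv; exact: (gradingD gM hu hv).
have := nx w; case E : (n - wd w) => [m|m] /=; last first.
  by move=> ->; rewrite scale0r; exact: grading0 gM _.
have -> : n = m%:Z + wd w by rewrite -E subrK.
by rewrite -addrA => mx; apply: grmod_act.
Qed.

Lemma homog_word w : homog deg (wd w) (<< w >> : T).
Proof. by move=> v; rewrite msuppU1 inE => /eqP ->. Qed.

Lemma cga_comp1 : cga_comp 0 (1 : A).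
Proof. by rewrite cga_connected; exists 1; rewrite ?scale1r. Qed.

Lemma prF_hom i : gr_hom (N := Fgr) (N' := Fgr) 0 (pF i).
Proof.
apply: mlin_gr_hom => w; rewrite addr0.
have H := tp_homog cga_comp1 (@pr_homog _ _ _ _ HR i _ _ (@homog_word w)).
by rewrite add0r in H.
Qed.

Lemma AJ_submodule i : gr_submodule (M := Fgr) (SJ i).
Proof.
split; first exact: subspace_AJ.
move=> n x Sx; rewrite /AJ /=.
have := gc_hom n x (prF_hom i); rewrite addr0 => <-.
by rewrite [pF i x]Sx.
Qed.

Lemma AJ_prF i x : SJ i (pF i x).
Proof.
rewrite [x](@tp_decomp k X A) (lin_fun_sum _ _ (@linear_prF k X deg R A HR i)).
apply: (subspace_sum (subspace_AJ A HR i)) => w _ _.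
by rewrite prF_tp; apply: AJ_tp; exact: pr_J.
Qed.

Definition Qmod i : grmod A := sub_grmod (AJ_submodule i).

Definition Qproj i (x : Fgr) : Qmod i := sub_mk (AJ_submodule i) (AJ_prF i x).

End GradedComplex.

Section KoszulResolution.
Variables (k : fieldType) (X : choiceType) (deg : X -> nat) (R : set (tensalg k X)).
Variables (A : cgalg k) (pi : {lrmorphism (tensalg k X) -> A}).
Local Notation W := {fmonom X}.
Local Notation T := (tensalg k X).
Local Notation F := {malg A[W]}.
Local Notation "W1 \ox W2" := (tprod W1 W2) (at level 40, left associativity).
Local Notation Lge n := (@len_ge k X n).
Hypotheses (deg_gt0 : forall x, (0 < deg x)%N) (HR : space_of_relations deg R).
Hypothesis HA : presents deg R pi.
Local Notation th := (theta pi HR).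
Local Notation dd := (dF pi HR).
Implicit Types (a b : A) (t : T) (w : W).

Local Notation SJ i := (AJ HR i).
Local Notation wd w := (word_deg deg w)%:Z.
Local Notation pF i := (@prF k X deg R A HR i).
Local Notation FM := (@Fgr k X deg A).
Local Notation Q i := (@Qmod k X deg R A HR i).
Local Notation Qp i := (@Qproj k X deg R A HR i).
Local Notation qv i := (@sub_val k A FM (SJ i) (AJ_submodule A HR i)).
Local Notation triv := (triv_grmod A).

Lemma Qproj_hom i : gr_hom (N := FM) (N' := Q i) 0 (Qp i).
Proof. exact: sub_mk_hom (@prF_hom k X deg R A HR i). Qed.

Lemma sub_val_Qproj i x : qv i (Qp i x) = pF i x.
Proof. by []. Qed.

Lemma Qproj_val i (u : Q i) : Qp i (qv i u) = u.
Proof. by apply: sub_val_inj; rewrite sub_val_Qproj; exact: (sub_valP u). Qed.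

(** A (x) J_i is a graded retract of A (x) T(V), which is free on the words: lift the images of
    words and restrict. *)
Lemma Qmod_projective i : gr_projective (Q i).
Proof.
move=> M N g f hg gsurj hf.
have hfp : gr_hom (N := FM) 0 (fun x => f (Qp i x)).
  exact: gr_hom_comp0 hf (@Qproj_hom i).
have ex w : exists m : M, grmod_comp (wd w) m /\ g m = f (Qp i << w >>).
  have [|m wm gm] := homog_lift (n := wd w) hg (gsurj (f (Qp i << w >>))).
    have [_ fd] := hfp; rewrite -[X in grmod_comp X]addr0; apply: fd.
    by have := @Fcomp_word k X deg A 0 1 w (cga_comp1 A); rewrite add0r.
  by exists m.
have [m mP] := choice ex.
have hm : gr_hom (N := FM) (N' := M) 0 (mlin m).
  by apply: mlin_gr_hom => w; rewrite addr0; case: (mP w).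
have gmE x : g (mlin m x) = f (Qp i x).
  move: x; apply: (@lin_ext A W N (fun x => g (mlin m x)) (fun x => f (Qp i x))).
  - exact: (gr_hom_linear (gr_hom_comp0 hg hm)).
  - exact: (gr_hom_linear hfp).
  by move=> w; rewrite (@mlinU1 A); case: (mP w).
exists (fun u => mlin m (qv i u)).
  exact: gr_hom_comp0 hm (sub_val_hom _).
by move=> u; rewrite gmE Qproj_val.
Qed.

Definition dQ i (u : Q i.+1) : Q i :=
  sub_mk (AJ_submodule A HR i) (theta_TJ_AJ deg_gt0 HA (sub_valP u)).1.

(** [theta] is arbitrary off T J_i, so [dF] may fail to respect degrees off A (x) J_(i+1). Its
    composite [h] with the projector respects them everywhere and agrees with it on A (x)
    J_(i+1). *)
Lemma dF_homog i n x : SJ i.+1 x -> Fcomp deg n x -> Fcomp deg n (dd i x).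
Proof.
move=> Sx nx; pose h : F -> F := mlin (fun w : W => th i (pr HR i.+1 << w >>) : F).
have hh : gr_hom (N := FM) (N' := FM) 0 h.
  apply: mlin_gr_hom => w; rewrite addr0.
  apply: theta_homog => //; last exact: (pr_homog (@homog_word k X deg w)).
  exact: (TJ_succ HR (J_sub_TJ (pr_J HR _ _))).
have -> : dd i x = h x.
  rewrite -[in LHS]Sx; move: x {Sx nx}.
  apply: (@lin_ext A W F (fun x => dd i (pF i.+1 x)) h).
  - exact: (linear_comp (linear_dF pi HR i) (@linear_prF k X deg R A HR i.+1)).
  - exact: (gr_hom_linear hh).
  move=> w; rewrite /h (@mlinU1 A) -(@tp_word k X A) prF_tp dF_tp.
  exact: scale1r.
by have [_ hd] := hh; have := hd _ _ nx; rewrite addr0.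
Qed.

Lemma dQ_hom i : gr_hom 0 (@dQ i).
Proof.
split=> [a u v|n u nu].
  have lv j := gr_hom_linear (sub_val_hom (AJ_submodule A HR j)).
  apply: sub_val_inj; refine (etrans (congr1 (dd i) (lv i.+1 a u v)) _).
  refine (etrans (linear_dF pi HR i a (qv i.+1 u) (qv i.+1 v)) (esym _)).
  exact: (lv i a (dQ u) (dQ v)).
by rewrite addr0; apply: dF_homog => //; exact: (sub_valP u).
Qed.

Definition augQ (u : Q 0) : triv := augF (qv 0 u).

Lemma augF_hom : gr_hom (N := FM) (N' := triv) 0 (@augF k X A : F -> triv).
Proof.
split=> [a x y|n x nx].
  by refine (etrans (augFD _ _) _); congr (_ + _); exact: augFZ.
rewrite addr0 /= => n0; have := nx mone; rewrite word_deg1 subr0 /augF.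
case: n n0 {nx} => [[|n]|n] //= _; last by move=> ->; rewrite rmorph0.
exact: cga_eps_pos.
Qed.

Lemma augQ_hom : gr_hom 0 augQ.
Proof. exact: gr_hom_comp0 augF_hom (sub_val_hom _). Qed.

Lemma augQ_surj c : exists u, augQ u = c.
Proof.
exists (Qp 0 (tp (c : k)%:A 1)); rewrite /augQ sub_val_Qproj prF_tp pr_id; last exact: tscal1.
by rewrite augF_tp mcoeff1 eqxx mul1r cga_eps_scal.
Qed.

(** A_+ acts by 0 on k, so a map to k kills A_+ (x) J_i. *)
Lemma hom_kill i d (f : Q i -> triv) t (St : SJ i (th i t)) : gr_hom d f ->
  (Lge 1 \ox J R i) t -> f (sub_mk (AJ_submodule A HR i) St) = 0.
Proof.
move=> hf t1.
have hF : gr_hom (N := FM) d (fun x => f (Qp i x)) := gr_hom_comp0 hf (@Qproj_hom i).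
have -> : sub_mk (AJ_submodule A HR i) St = Qp i (th i t).
  by rewrite -[LHS]Qproj_val.
move: t t1 {St}; apply: (@tprod_lin_eq _ _ k^o (fun t => f (Qp i (th i t)) : k^o) (fun=> 0)).
- move=> c t s; rewrite linear_theta (gr_hom_linear hF c%:A); congr (_ + _).
  by rewrite /GRing.scale /= /triv_scale cga_eps_scal.
- exact: linear_zero.
move=> u s u1 Js; rewrite (theta_mul pi HR u Js) -[pi u]mulr1 -tpZ.
rewrite (gr_homZ hF) /GRing.scale /= /triv_scale (eps_pi_len deg_gt0 HA u1) mul0r //.
Qed.

End KoszulResolution.

(** * Comparison with a projective resolution *)

Section Comparison.
Variables (k : fieldType) (A : cgalg k) (N : grmod A).

Record aug_complex := AugComplex {
  ac_mod : nat -> grmod A;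
  ac_diff : forall i, ac_mod i.+1 -> ac_mod i;
  ac_aug : ac_mod 0 -> N;
  ac_diff_hom : forall i, gr_hom 0 (@ac_diff i);
  ac_aug_hom : gr_hom 0 ac_aug;
  ac_projective : forall i, gr_projective (ac_mod i);
  ac_diff0 : forall x, ac_aug (@ac_diff 0 x) = 0;
  ac_diffS : forall i x, @ac_diff i (@ac_diff i.+1 x) = 0
}.

Implicit Types (E : aug_complex).

(* The modules of the complex, shifted by one so that [N] is the module of index 0. *)
Definition am E (i : nat) : grmod A := if i is j.+1 then ac_mod E j else N.

Definition ad E (i : nat) : am E i.+1 -> am E i :=
  match i with 0 => @ac_aug E | j.+1 => @ac_diff E j end.
Arguments ad E i : clear implicits.

Definition acycle E (i : nat) : am E i -> Prop :=
  match i with 0 => fun=> True | j.+1 => fun x => ad E j x = 0 end.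

Definition exact_at E (i : nat) := forall x : am E i, acycle x -> exists y, ad E i y = x.

Lemma ad_hom E i : gr_hom 0 (ad E i).
Proof. by case: i => [|i]; [exact: ac_aug_hom | exact: ac_diff_hom]. Qed.

Lemma adad E i x : ad E i (ad E i.+1 x) = 0.
Proof. by case: i x => [|i] x; [exact: ac_diff0 | exact: ac_diffS]. Qed.

Lemma am_projective E i : gr_projective (am E i.+1).
Proof. exact: ac_projective. Qed.

(* [psi phi - 1] and [phi psi - 1] are null-homotopic; only the consequence of
   this at index [i] that is needed to go on is recorded. *)
Definition comparison E E' (i : nat) : Prop :=
  exists (phi0 : am E i -> am E' i) (phi1 : am E i.+1 -> am E' i.+1)
    (psi0 : am E' i -> am E i) (psi1 : am E' i.+1 -> am E i.+1)
    (h : am E i -> am E i.+1) (h' : am E' i -> am E' i.+1),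
  [/\ [/\ gr_hom 0 phi0, gr_hom 0 phi1, gr_hom 0 psi0 & gr_hom 0 psi1],
      gr_hom 0 h /\ gr_hom 0 h',
      (forall x, ad E' i (phi1 x) = phi0 (ad E i x)) /\
      (forall x, ad E i (psi1 x) = psi0 (ad E' i x)),
      (forall x, ad E i (psi1 (phi1 x) - x - h (ad E i x)) = 0) /\
      (forall x, ad E' i (phi1 (psi1 x) - x - h' (ad E' i x)) = 0)
    & i = 0%N -> (forall x, h x = 0) /\ (forall x, h' x = 0)].

Lemma null_hom E E' i (phi1 : am E i.+1 -> am E' i.+1) (psi1 : am E' i.+1 -> am E i.+1)
    (h : am E i -> am E i.+1) :
  gr_hom 0 phi1 -> gr_hom 0 psi1 -> gr_hom 0 h ->
  gr_hom 0 (fun x => psi1 (phi1 x) - x - h (ad E i x)).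
Proof.
move=> hphi hpsi hh; apply: gr_hom_sub.
  apply: gr_hom_sub; [exact: gr_hom_comp0 hpsi hphi | exact: gr_hom_id].
exact: gr_hom_comp0 hh (ad_hom E i).
Qed.

Lemma chain_lift E E' i (phi0 : am E i -> am E' i) (phi1 : am E i.+1 -> am E' i.+1) :
  exact_at E' i.+1 -> gr_hom 0 phi0 -> gr_hom 0 phi1 ->
  (forall x, ad E' i (phi1 x) = phi0 (ad E i x)) ->
  exists2 phi2, gr_hom 0 phi2 & forall x, ad E' i.+1 (phi2 x) = phi1 (ad E i.+1 x).
Proof.
move=> ex h0 h1 comm.
apply: (projective_lift (@am_projective E i.+1) (ad_hom E' i.+1)).
  exact: gr_hom_comp0 h1 (ad_hom E i.+1).
by move=> x; apply: ex; rewrite /= comm adad (gr_hom_0 h0).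
Qed.

(** The map psi1 phi1 - 1 - h d takes values in cycles, hence lifts through d to h1. Then d kills
    psi2 phi2 - 1 - h1 d, because psi and phi commute with d and d d = 0. *)
Lemma homotopy_step E E' i (phi1 : am E i.+1 -> am E' i.+1) (psi1 : am E' i.+1 -> am E i.+1)
    (phi2 : am E i.+2 -> am E' i.+2) (psi2 : am E' i.+2 -> am E i.+2)
    (h : am E i -> am E i.+1) : exact_at E i.+1 ->
  gr_hom 0 phi1 -> gr_hom 0 psi1 -> gr_hom 0 h ->
  (forall x, ad E' i.+1 (phi2 x) = phi1 (ad E i.+1 x)) ->
  (forall x, ad E i.+1 (psi2 x) = psi1 (ad E' i.+1 x)) ->
  (forall x, ad E i (psi1 (phi1 x) - x - h (ad E i x)) = 0) ->
  exists2 h1 : am E i.+1 -> am E i.+2, gr_hom 0 h1 &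
    forall x, ad E i.+1 (psi2 (phi2 x) - x - h1 (ad E i.+1 x)) = 0.
Proof.
move=> ex hphi hpsi hh cphi cpsi H.
have [h1 hh1 h1E] : exists2 h1 : am E i.+1 -> am E i.+2, gr_hom 0 h1 &
    forall x, ad E i.+1 (h1 x) = psi1 (phi1 x) - x - h (ad E i x).
  apply: (projective_lift (@am_projective E i) (ad_hom E i.+1)).
    exact: null_hom.
  by move=> x; exact: ex (H x).
exists h1 => // x; have hD := ad_hom E i.+1.
rewrite !(gr_homB hD) cpsi cphi h1E adad (gr_hom_0 hh) subr0.
by rewrite subrr.
Qed.

(** Lifts into [E'] use its exactness no further than the index reached. So the Koszul complex can
    be compared with a resolution while its exactness is still being proved by induction. *)
Lemma comparison_exists E E' n : (forall i, exact_at E i) ->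
  (forall i, (i <= n)%N -> exact_at E' i) -> forall i, (i <= n)%N -> comparison E E' i.
Proof.
move=> exE exE'; elim=> [|i IH] ni.
  have [phi1 hphi phiE] : exists2 phi1 : am E 1 -> am E' 1, gr_hom 0 phi1 &
      forall x, ad E' 0 (phi1 x) = ad E 0 x.
    apply: (projective_lift (@am_projective E 0) (ad_hom E' 0) (ad_hom E 0)) => x.
    exact: exE' ni _ _.
  have [psi1 hpsi psiE] : exists2 psi1 : am E' 1 -> am E 1, gr_hom 0 psi1 &
      forall x, ad E 0 (psi1 x) = ad E' 0 x.
    apply: (projective_lift (@am_projective E' 0) (ad_hom E 0) (ad_hom E' 0)) => x.
    exact: exE 0%N _ _.
  (* Over [N] the comparison is the identity, with zero homotopies. This vanishing is recorded
     because in Ext^0 the only coboundary is 0. *)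
  exists id, phi1, id, psi1, (fun=> 0), (fun=> 0).
  have hD := ad_hom E 0; have hD' := ad_hom E' 0.
  split=> //.
  - by split=> //; exact: gr_hom_id.
  - by split; exact: gr_hom_zero.
  - split=> x; first by rewrite !(gr_homB hD) psiE phiE (gr_hom_0 hD) subr0 subrr.
    by rewrite !(gr_homB hD') phiE psiE (gr_hom_0 hD') subr0 subrr.
have [phi0 [phi1 [psi0 [psi1 [h [h' [[h0 h1 h2 h3] [hh hh'] [c c'] [H H'] _]]]]]]] :=
  IH (ltnW ni).
have [phi2 hphi2 cphi2] := chain_lift (exE' _ ni) h0 h1 c.
have [psi2 hpsi2 cpsi2] := chain_lift (exE _) h2 h3 c'.
have [k1 hk1 K1] := homotopy_step (exE _) h1 h3 hh cphi2 cpsi2 H.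
have [k1' hk1' K1'] := homotopy_step (exE' _ ni) h3 h1 hh' cpsi2 cphi2 H'.
by exists phi1, phi2, psi1, psi2, k1, k1'; split.
Qed.

End Comparison.
Arguments ad {k A N} E i.

Lemma kernel_submodule (k : fieldType) (A : cgalg k) (M N : grmod A) (f : M -> N) :
  gr_hom 0 f -> gr_submodule [set x | f x = 0].
Proof.
move=> hf; split; last by move=> n x fx0; rewrite /= -(gc_hom _ _ hf) fx0; exact: gcomp0.
split=> [|c x y fx fy]; first exact: gr_hom_0 hf.
by rewrite /= (gr_hom_linear hf) fx fy scaler0 addr0.
Qed.

(** * Ext computed from a partly exact minimal complex *)

Section ExtComparison.
Variables (k : fieldType) (A : cgalg k).
Local Notation triv := (triv_grmod A).
Variable P : gr_proj_resolution triv.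

Fact res_diff0 (x : P 1) : res_aug (res_diff x) = 0.
Proof. by apply/res_exact0; exists x. Qed.

Fact res_diffS i (x : P i.+2) : res_diff (res_diff x) = 0.
Proof. by apply/res_exact; exists x. Qed.

Definition res_complex : aug_complex triv :=
  @AugComplex k A triv P (@res_diff _ _ _ P) (@res_aug _ _ _ P) (@res_diff_hom _ _ _ P)
    (res_aug_hom P) (res_projective (g:=P)) res_diff0 res_diffS.

Local Notation E := res_complex.

Lemma res_complex_exact i : exact_at E i.
Proof.
case: i => [|[|i]] x Zx; first exact: (res_aug_surj P x).
  by apply/res_exact0.
by apply/res_exact.
Qed.

Variable E' : aug_complex triv.
Hypothesis minE' : forall i d (f : am E' i.+1 -> triv), gr_hom d f ->
  forall x, ad E' i x = 0 -> f x = 0.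

Lemma hom_boundary i d (V : am E' i -> triv) x :
  gr_hom d V -> (i = 0%N -> forall y, V y = 0) -> V (ad E' i x) = 0.
Proof.
case: i V x => [|i] V x hV V0; first by rewrite V0.
by apply: (minE' hV); exact: (@adad _ _ _ E' i x).
Qed.

Lemma coboundaryP i d (f : P i -> triv) : coboundary d f <->
  exists2 g : am E i -> triv, gr_hom d g /\ (i = 0%N -> forall y, g y = 0) &
    forall x, f x = g (ad E i x).
Proof.
case: i f => [|i] f; split.
- by move=> f0; exists (fun=> 0); [split=> //; exact: gr_hom_zero | exact: f0].
- by move=> [g [_ g0] fg] x; rewrite fg g0.
- by move=> [g hg fg]; exists g.
- by move=> [g [hg _] fg]; exists g.
Qed.

(** The map is f |-> f psi. Given U, U phi is a cocycle and U phi psi = U, because U kills phi psi -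
    1 - h' d, whose values are cycles, and U h' kills boundaries. Injectivity modulo coboundaries
    uses that [P] is exact, so that psi phi - 1 - h d has values in boundaries, which f kills. *)
Lemma ext_hom i : comparison E E' i ->
  exists2 psi : am E' i.+1 -> P i, gr_hom 0 psi & forall d,
  (forall U : am E' i.+1 -> triv, gr_hom d U ->
     exists2 f : P i -> triv, cocycle d f & forall x, f (psi x) = U x) /\
  (forall f : P i -> triv, cocycle d f -> (forall x, f (psi x) = 0) <-> coboundary d f).
Proof.
move=> [phi0 [phi1 [psi0 [psi1 [h [h' [[hp0 hp1 hs0 hs1] [hh hh'] [cphi cpsi] [H H'] z0]]]]]]].
exists psi1 => // d; split=> [U hU|f [hf fD]].
  exists (fun x => U (phi1 x)).
    split=> [|x]; first exact: gr_hom_comp0 hU hp1.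
    apply: (minE' hU); rewrite cphi (_ : ad E i (res_diff x) = 0).
      exact: gr_hom_0 hp0.
    exact: (@adad _ _ _ E i x).
  move=> x; have := minE' hU (H' x); rewrite !(gr_homB hU) => /eqP.
  rewrite subr_eq0 => /eqP.
  rewrite (hom_boundary x (gr_hom_comp0 hU hh')); last first.
    by move=> i0 y; rewrite (z0 i0).2; exact: gr_hom_0 hU.
  by move=> /eqP; rewrite subr_eq0 => /eqP.
apply: iff_trans (iff_sym (coboundaryP d f)); split=> [f0|[g [hg g0] fg] x]; last first.
  rewrite fg cpsi (hom_boundary x (gr_hom_comp0 hg hs0)) // => i0 y.
  exact: g0.
(* From f (psi phi x - x - h d x) = 0 and f psi = 0 one gets f x = - f (h d x). *)
exists (fun x => 0 - f (h x)).
  split; first exact: gr_hom_sub (gr_hom_zero _ _ _) (gr_hom_comp0 hf hh).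
  by move=> i0 y; rewrite (z0 i0).1 (gr_hom_0 hf) subr0.
move=> x; have [y yE] := res_complex_exact (i := i.+1) (H x).
have := fD y; rewrite -[res_diff y]/(ad E i.+1 y) yE !(gr_homB hf) f0 sub0r => /eqP.
by rewrite subr_eq0 => /eqP <-; rewrite sub0r opprK.
Qed.

Definition cycles i : grmod A := sub_grmod (kernel_submodule (ad_hom E' i)).

Lemma cycles_hom i d (g : cycles i -> triv) (kap : am E' i.+1 -> am E' i.+1)
    (hk : gr_hom 0 kap) (kK : forall x, ad E' i (kap x) = 0) x :
  gr_hom d g -> ad E' i x = 0 ->
  g (sub_mk (kernel_submodule (ad_hom E' i)) (kK x)) = 0.
Proof.
move=> hg; apply: (minE' (f := fun x => g (sub_mk (kernel_submodule (ad_hom E' i)) (kK x)))).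
exact: gr_hom_comp0 hg (sub_mk_hom (kernel_submodule (ad_hom E' i)) (f := kap) kK hk).
Qed.

(** The map Hom(Z_i, k) -> Ext^(i+1) is composition with phi d, which has values in Z_i, and it is
    injective although [E'] need not be exact at Z_i: any cycle z is phi(d p), with d p = psi z, up
    to a map E'_i -> Z_i evaluated at z. If g phi d = g' d, then g' psi and g composed with that map
    are cochains on E'_i, so both vanish at z. *)
Lemma ext_cycles i : comparison E E' i ->
  exists2 phi : P i.+1 -> cycles i, gr_hom 0 phi & forall d (g : cycles i -> triv),
    gr_hom d g -> cocycle d (fun x => g (phi x)) /\
    (coboundary d (fun x => g (phi x)) -> forall z, g z = 0).
Proof.
move=> [phi0 [phi1 [psi0 [psi1 [h [h' [[hp0 hp1 hs0 hs1] [hh hh'] [cphi cpsi] [H H'] z0]]]]]]].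
have hD := ad_hom E i.+1.
have KD (x : am E i.+2) : ad E' i (phi1 (ad E i.+1 x)) = 0.
  by rewrite cphi adad (gr_hom_0 hp0).
pose hS := kernel_submodule (ad_hom E' i).
pose phi (x : am E i.+2) : cycles i := sub_mk hS (KD x).
have hphi : gr_hom 0 phi by exact: (sub_mk_hom hS (f := fun x => phi1 (ad E i.+1 x)) KD (gr_hom_comp0 hp1 hD)).
exists phi => // d g hg; split.
  split=> [|x]; first exact: gr_hom_comp0 hg hphi.
  have -> : phi (res_diff x) = 0.
    apply: sub_val_inj; rewrite sub_mkK (@adad _ _ _ E i.+1 x) (gr_hom_0 hp1).
    by rewrite (gr_hom_0 (sub_val_hom _)).
  exact: gr_hom_0 hg.
move=> [g' hg' gg'] z.
have Dz : ad E' i (sub_val z) = 0 := sub_valP z.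
have [p pE] : exists p, ad E i.+1 p = psi1 (sub_val z).
  by apply: res_complex_exact; rewrite /= cpsi Dz; exact: gr_hom_0 hs0.
have gp : g (phi p) = 0.
  rewrite gg' -[res_diff p]/(ad E i.+1 p) pE.
  exact: (minE' (gr_hom_comp0 hg' hs1)).
have hkap := null_hom hs1 hp1 hh'.

(* [phi p] is phi1 (psi1 z), and the homotopy term disappears since d z = 0. *)
have -> : z = phi p - sub_mk hS (H' (sub_val z)).
  apply: sub_val_inj; rewrite (gr_homB (sub_val_hom _)) !sub_mkK pE Dz.
  rewrite (gr_hom_0 hh') subr0 opprB addrC subrK //.
rewrite (gr_homB hg) gp sub0r; apply/eqP; rewrite oppr_eq0; apply/eqP.
exact: (cycles_hom hkap H' hg Dz).
Qed.

End ExtComparison.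

(** * Finite dimensional linear algebra *)

(** A dimension count: [Phi] embeds [H] in k^m, and evaluation at the points [e j] maps [H] onto
    k^m, so this evaluation is injective. *)
Lemma finite_dual_surj (k : fieldType) (Z : Type) (H : set (Z -> k)) m (e : 'I_m -> Z)
    (Phi : (Z -> k) -> 'I_m -> k) :
  H (fun=> 0) ->
  (forall c f g, H f -> H g -> H (fun z => c * f z + g z)) ->
  (forall c f g, H f -> H g -> forall j, Phi (fun z => c * f z + g z) j = c * Phi f j + Phi g j) ->
  (forall f, H f -> (forall j, Phi f j = 0) -> forall z, f z = 0) ->
  (forall l, exists2 f, H f & forall j, f (e j) = (j == l)%:R) ->
  forall f, H f -> (forall j, f (e j) = 0) -> forall z, f z = 0.
Proof.
move=> H0 HD PhiD Phi0 dual f Hf fe.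
have ex l : exists g, H g /\ forall j, g (e j) = (j == l)%:R.
  by have [g] := dual l; exists g.
have [g gP] := choice ex.
pose comb (c : 'rV[k]_m) (r : seq 'I_m) (g0 : Z -> k) z := \sum_(l <- r) c 0 l * g l z + g0 z.
have combP c r g0 : H g0 -> H (comb c r g0) /\
    forall j, Phi (comb c r g0) j = \sum_(l <- r) c 0 l * Phi (g l) j + Phi g0 j.
  move=> Hg0; elim: r => [|l r [IH1 IH2]].
    have -> : comb c [::] g0 = g0 by apply/funext => z; rewrite /comb big_nil add0r.
    by split=> // j; rewrite big_nil add0r.
  have -> : comb c (l :: r) g0 = fun z => c 0 l * g l z + comb c r g0 z.
    by apply/funext => z; rewrite /comb big_cons addrA.
  split=> [|j]; first by apply: HD => //; case: (gP l).
  by rewrite PhiD ?big_cons ?IH2 ?addrA //; case: (gP l).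
have comb_e c g0 j : comb c (enum 'I_m) g0 (e j) = c 0 j + g0 (e j).
  rewrite /comb big_enum /= (bigD1 j) //= (gP j).2 eqxx mulr1 big1 ?addr0 // => l lj.
  by rewrite (gP l).2 eq_sym (negPf lj) mulr0.
pose M : 'M[k]_m := \matrix_(l, j) Phi (g l) j.
have PhiM c g0 j : H g0 -> Phi (comb c (enum 'I_m) g0) j = (c *m M) 0 j + Phi g0 j.
  move=> Hg0; rewrite (combP _ _ _ Hg0).2 big_enum /= mxE; congr (_ + _).
  by apply: eq_bigr => l _; rewrite mxE.
have Phi00 j : Phi (fun=> 0) j = 0.
  have := PhiD 1 _ _ H0 H0 j.
  have -> : (fun _ : Z => 1 * 0 + 0) = (fun=> 0 : k) by apply/funext => z; rewrite mulr0 addr0.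
  rewrite mul1r => E.
  by apply: (addrI (Phi (fun=> 0) j)); rewrite -E addr0.
have M_unit : M \in unitmx.
  rewrite -row_free_unit; apply: inj_row_free => c cM.
  apply/rowP => j; rewrite mxE -[LHS]addr0 -(comb_e c (fun=> 0) j).
  apply: Phi0; first exact: (combP _ _ _ H0).1.
  by move=> l; rewrite PhiM // cM mxE Phi00 addr0.
(* Chosen so that f + sum_l c_l g_l is killed by [Phi], hence is 0; its values at the [e j] then
   give c = 0, and so f = 0. *)
pose c : 'rV[k]_m := - (\row_j Phi f j) *m invmx M.
have comb0 z : comb c (enum 'I_m) f z = 0.
  apply: Phi0; first exact: (combP _ _ _ Hf).1.
  by move=> j; rewrite PhiM // /c mulmxKV // !mxE addNr.
have c0 : c = 0.
  apply/rowP => j; have := comb0 (e j).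
  by rewrite comb_e fe addr0 => ->; rewrite mxE.
move=> z; have := comb0 z; rewrite /comb big1 ?add0r // => l _.
by rewrite c0 mxE mul0r.
Qed.

(** Take a matrix of maximal rank among those whose row space lies in [S]; adjoining a vector of [S]
    cannot raise the rank. *)
Lemma subspace_rowspace (k : fieldType) n (S : set 'rV[k]_n) : is_subspace S ->
  exists B : 'M[k]_n, forall x, S x <-> (x <= B)%MS.
Proof.
move=> sS; pose ok (B : 'M[k]_n) := forall x : 'rV_n, (x <= B)%MS -> S x.
pose Pr r := `[< exists2 B, ok B & \rank B = r >].
have ex0 : exists r, Pr r.
  exists 0%N; apply/asboolP; exists 0; last exact: mxrank0.
  by move=> x; rewrite submx0 => /eqP ->; exact: subspace0 sS.
have bd r : Pr r -> (r <= n)%N by move=> /asboolP[B _ <-]; exact: rank_leq_col.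
case: (ex_maxnP ex0 bd) => r /asboolP[B okB rB] maxB.
exists B => x; split=> [Sx|]; last exact: okB.
have okBx : ok (B + x)%MS.
  move=> y /sub_addsmxP[[u v] /= ->]; apply: (subspaceD sS).
    by apply: okB; exact: submxMl.
  by rewrite [v]mx11_scalar mul_scalar_mx; exact: subspaceZ sS Sx.
have le_r : (\rank (B + x)%MS <= \rank B)%N.
  by rewrite rB; apply: maxB; apply/asboolP; exists (B + x)%MS.
apply: submx_trans (addsmxSr B x) _.
by have := mxrank_leqif_sup (addsmxSl B x); case=> le1 <-; rewrite eqn_leq le1.
Qed.

(** Coefficients along [s] identify [H] with a row space, and [row_base] is a basis of it. The
    pseudo-inverse extends the coordinates [y] linearly to the whole free module. *)
Lemma finite_basis (k : fieldType) (K : choiceType) (s : seq K) (H : set {malg k[K]}) :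
  is_subspace H -> (forall x, H x -> {subset msupp x <= s}) ->
  exists m (b : 'I_m -> {malg k[K]}) (y : 'I_m -> {malg k[K]} -> k),
    [/\ forall j, H (b j), forall j c x x', y j (c *: x + x') = c * y j x + y j x',
        forall x, H x -> x = \sum_j y j x *: b j
      & forall j l, y l (b j) = (j == l)%:R].
Proof.
move=> sH supp; pose n := size (undup s).
pose w (j : 'I_n) : K := tnth (in_tuple (undup s)) j.
have winj : injective w by apply/tuple_uniqP/undup_uniq.
pose inv (r : 'rV[k]_n) : {malg k[K]} := \sum_j r 0 j *: << w j >>.
pose co (x : {malg k[K]}) : 'rV[k]_n := \row_j x@_(w j).
have linv : linear inv.
  move=> c r r'; rewrite /inv scaler_sumr -big_split; apply: eq_bigr => j _.
  by rewrite !mxE scalerDl scalerA.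
have lco : linear co.
  by move=> c x y; apply/rowP => j; rewrite !mxE mcoeffD mcoeffZ.
have coK r : co (inv r) = r.
  have E l j : (r 0 l *: << w l >> : {malg k[K]})@_(w j) = r 0 l * (w l == w j)%:R.
    by rewrite mcoeffZ mcoeffU.
  apply/rowP => j; rewrite mxE raddf_sum (bigD1 j) //= E eqxx mulr1.
  rewrite big1 ?addr0 // => l lj.
  by rewrite E (inj_eq winj) (negPf lj) mulr0.
have invK x : H x -> inv (co x) = x.
  move=> Hx; apply/malgP => v; rewrite raddf_sum /=.
  have E j : (co x 0 j *: << w j >> : {malg k[K]})@_v = x@_v * (w j == v)%:R.
    rewrite mcoeffZ mcoeffU mxE; case: eqP => [->//|_].
    by rewrite !mulr0.
  under eq_bigr do rewrite E.
  have [vx|/mcoeff_outdom ->] := boolP (v \in msupp x); last first.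
    by rewrite big1 // => j _; rewrite mul0r.
  have /tnthP[j jv] : v \in in_tuple (undup s) by rewrite mem_undup; exact: supp Hx _ vx.
  rewrite (bigD1 j) //= /w -jv eqxx mulr1 big1 ?addr0 // => l lj.
  by rewrite jv (inj_eq winj) (negPf lj) mulr0.
pose S : set 'rV[k]_n := [set r | H (inv r)].
have sS : is_subspace S.
  split=> [|c r r' Sr Sr']; first by rewrite /S /= lin_fun0 //; exact: subspace0 sH.
  by rewrite /S /= linv; exact: sH.2.
have [B BP] := subspace_rowspace sS.
pose B' := row_base B.
have B'P r : S r <-> (r <= B')%MS by rewrite eq_row_base; exact: BP.
have free : row_free B' := row_base_free B.
pose y (j : 'I_(\rank B)) (x : {malg k[K]}) : k := (co x *m pinvmx B') 0 j.
exists (\rank B), (fun j => inv (row j B')), y; split.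
- by move=> j; apply/B'P; exact: row_sub.
- by move=> j c x x'; rewrite /y lco mulmxDl -scalemxAl !mxE.
- move=> x Hx; have Sx : S (co x) by rewrite /S /= invK.
  have := mulmxKpV (iffLR (B'P _) Sx); rewrite -{3}(invK x Hx) => {1}<-.
  rewrite mulmx_sum_row (lin_fun_sum _ _ linv); apply: eq_bigr => j _.
  exact: lin_funZ _ _ linv.
move=> j l; rewrite /y coK rowE -mulmxA mulmxVp // mulmx1.
by rewrite mxE eqxx eq_sym.
Qed.

(** * Nakayama's lemma and the theorem *)

Section Nakayama.
Variables (k : fieldType) (A : cgalg k) (M : grmod A).
Local Notation eps := (cga_eps A).
Local Notation ga := (gcomp (cga_grading A)).
Implicit Types (a : A) (x y z : M).

Lemma eps_gcomp0 a : eps (ga 0%N a) = eps a.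
Proof.
have [Ga [s [us fs as_]]] := gcompP (cga_grading A) a.
have e0 m : m != 0%N -> eps (ga m a) = 0.
  by move=> m0; apply: cga_eps_pos (Ga m); rewrite lt0n.
rewrite [in RHS]as_ rmorph_sum /=; have [s0|ns0] := boolP (0%N \in s).
  by rewrite (bigD1_seq 0%N) //= big1 ?addr0.
rewrite fs // rmorph0 big_seq big1 // => m ms; apply: e0.
by apply: contraNneq ns0 => <-.
Qed.

Lemma gcomp0_eps0 a : eps a = 0 -> ga 0%N a = 0.
Proof.
move=> a0; have := gcomp_in (cga_grading A) 0%N a; have := eps_gcomp0 a.
rewrite a0 cga_connected => + [c _ cE]; rewrite -cE cga_eps_scal => ->.
exact: scale0r.
Qed.

(* A_+ M *)
Definition posm : set M := span [set y | exists a z, eps a = 0 /\ y = a *: z].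

Lemma gc_eps_scale n (c : k) x : gc n (c%:A *: x) = c%:A *: gc n x.
Proof.
have c0 : cga_comp 0 (c%:A : A) by rewrite cga_connected; exists c.
by rewrite -{1}[n]add0r; exact: gc_act c0.
Qed.

Lemma gcD n x y : gc n (x + y) = gc n x + gc n y.
Proof. exact: gcompD. Qed.

(** An element of augmentation 0 has no component of degree 0, so a component of an element of A_+ M
    involves only strictly lower degrees of [M]. *)
Lemma posm_gc_ind (Z : set M) n : is_subspace Z ->
  (forall (m : nat) a z, (0 < m)%N -> cga_comp m a -> Z (a *: gc (n - m%:Z) z)) ->
  forall x, posm x -> Z (gc n x).
Proof.
move=> sZ H x; elim=> [|c _ y [a [z [a0 ->]]] _ IH].
  by rewrite /gc gcomp0; exact: subspace0 sZ.
rewrite gcD; apply: (subspaceD sZ) IH; rewrite scalerA.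
have ca0 : eps (c * a) = 0 by rewrite rmorphM /= a0 mulr0.
move: (c * a) ca0 => {c a0}b b0; have [s _ bs] := gcomp_sum (cga_grading A) b.
rewrite {1}bs scaler_suml /gc.
have -> : gcomp (grmod_grading M) n (\sum_(m <- s) ga m b *: z) =
    \sum_(m <- s) gc n (ga m b *: z).
  by apply: (big_morph (gcomp (grmod_grading M) n)); [exact: gcompD | exact: gcomp0].
apply: (subspace_sum sZ) => m _ _; case: m => [|m].
  by rewrite gcomp0_eps0 // scale0r /gc gcomp0; exact: subspace0 sZ.
have bm := gcomp_in (cga_grading A) m.+1 b.
have E := gc_act (n - m.+1%:Z) z bm; rewrite addrC subrK in E.
by rewrite E; exact: H.
Qed.

(** Strong induction on the degree, started by the vanishing in negative degrees: the correction in
    A_+ M involves only lower degrees, already in [N]. *)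
Lemma nakayama (N : set M) : gr_submodule N ->
  (forall n x, (n < 0)%R -> grmod_comp n x -> x = 0) ->
  (forall n x, grmod_comp n x -> exists2 p, posm p & N (x - p)) -> forall x, N x.
Proof.
move=> [sN gN] neg H.
suff key n x : grmod_comp n x -> N x.
  move=> x; have [s _ ->] := gcomp_sum (grmod_grading M) x.
  by apply: (subspace_sum sN) => n _ _; apply: (key n); exact: gcomp_in.
case: n x => [n|n] x nx; last by rewrite (neg _ _ _ nx) //; exact: subspace0 sN.
elim/ltn_ind: n x nx => n IH x nx; have [p pp Np] := H _ _ nx.
have -> : x = gc n (x - p) + gc n p.
  by rewrite -gcD subrK /gc (gcomp_homog _ _ nx) eqxx.
apply: (subspaceD sN); first exact: gN.
apply: (posm_gc_ind sN) pp => m a z m0 _; apply: (subspaceZ _ sN).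
have zc := gcomp_in (grmod_grading M) (n%:Z - m%:Z) z; rewrite -/(gc _ _) in zc.
have [mn|nm] := leqP m n.
  move: zc; rewrite subzn //; apply: IH.
  by rewrite ltn_subrL m0 (leq_trans m0 mn).
by rewrite (neg _ _ _ zc) ?subr_lt0 //; exact: subspace0 sN.
Qed.

(** A_+ M is graded, so [g] taken on degree e components still vanishes on it, and modulo A_+ M an
    element a acts as eps(a). This is A-linearity with values in k. *)
Lemma functional_gr_hom (e : int) (g : resc M -> k^o) : linear g ->
  (forall p, posm p -> g p = 0) ->
  gr_hom (N' := triv_grmod A) (- e) (fun z => g (gc e z)).
Proof.
move=> lg g0; have gpos p : posm p -> g (gc e p) = 0.
  move=> pp; apply/g0; move: p pp; apply: posm_gc_ind; first exact: subspace_span.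
  move=> m a z m0 ma; apply: sub_span; exists a, (gc (e - m%:Z) z); split=> //.
  exact: cga_eps_pos ma.
split=> [a x y|n x nx]; last first.
  move=> ne0; have ne : n != e by rewrite -subr_eq0.
  rewrite /gc (gcomp_homog _ _ nx) eq_sym (negPf ne).
  exact: lin_fun0 lg.
have ax : a *: x = (a - (eps a)%:A) *: x + (eps a)%:A *: x by rewrite -scalerDl subrK.
rewrite gcD ax gcD gc_eps_scale (lin_funD _ _ lg); congr (_ + _).
rewrite (lin_funD _ _ lg) gpos ?add0r; first exact: (lin_funZ (eps a) _ lg).
apply: sub_span; exists (a - (eps a)%:A), x; split=> //.
by rewrite rmorphB /= cga_eps_scal subrr.
Qed.

End Nakayama.

Lemma functional_extend (k : fieldType) (M : lmodType k) (S : set M)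
    (u : {x | S x} -> k) : is_subspace S -> functional_on S u ->
  exists2 f : M -> k^o, linear f & forall x, f (sval x) = u x.
Proof.
move=> sS fu.
pose G : set (M * k^o)%type := [set p | exists x, sval x = p.1 /\ u x = p.2].
have fu2 c x y z : sval z = c *: sval x + sval y -> u z = c * u x + u y by exact: fu.
have sG : is_subspace G.
  split=> [|c p q [x [x1 x2]] [y [y1 y2]]].
    pose o : {x | S x} := exist _ 0 (subspace0 sS); exists o; split=> //.
    (* The relation 0 = - 0 + 0 gives u(0) = - u(0) + u(0) = 0. *)
    have := fu2 (-1) o o o; rewrite /= scaler0 addr0 => /(_ erefl).
    by rewrite mulN1r addNr.
  exists (exist _ (c *: sval x + sval y) (sS.2 c _ _ (svalP x) (svalP y))).
  by split; [rewrite /= x1 y1 | rewrite (fu2 c x y) //= x2 y2].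
have G0 y : G (0, y) -> y = 0.
  move=> [x [/= x0 <-]]; have := fu2 (-1) x x x; rewrite x0 scaler0 addr0 => /(_ erefl).
  by rewrite mulN1r addNr.
have [f [fG _]] := linear_extension sG G0.
exists f; first exact: linearP.
by move=> x; apply: fG; exists x.
Qed.

Lemma subspace_separation (k : fieldType) (M : lmodType k) (S : set M) x :
  is_subspace S -> ~ S x ->
  exists2 f : M -> k^o, linear f & (forall y, S y -> f y = 0) /\ f x = 1.
Proof.
move=> sS Sx; pose G : set (M * k^o)%type := [set p | S (p.1 - p.2 *: x)].
have sG : is_subspace G.
  split=> [|c [y a] [z b] Gy Gz]; first by rewrite /G /= scale0r subr0; exact: subspace0 sS.
  rewrite /G /= scalerDl opprD addrACA -scalerA -scalerBr.
  exact: sS.2 Gy Gz.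
have G0 y : G (0, y) -> y = 0.
  rewrite /G /= sub0r => /(subspaceN sS); rewrite opprK => Syx.
  apply: contrapT => /eqP y0; apply: Sx.
  by rewrite -[x]scale1r -(mulVf y0) -scalerA; exact: subspaceZ sS Syx.
have [f [fG _]] := linear_extension sG G0.
exists f; first exact: linearP.
split=> [y Sy|]; apply: fG; first by rewrite /G /= scale0r subr0.
by rewrite /G /= scale1r subrr; exact: subspace0 sS.
Qed.

Lemma preim_submodule (k : fieldType) (A : cgalg k) (M N : grmod A) (f : M -> N) (S : set N) :
  gr_hom 0 f -> gr_submodule S -> gr_submodule (f @^-1` S).
Proof.
move=> hf [sS gS]; split; last first.
  by move=> n x Sx; rewrite /preimage /= -(gc_hom _ _ hf) addr0; exact: gS.
split=> [|c x y Sx Sy]; first by rewrite /preimage /= (gr_hom_0 hf); exact: subspace0 sS.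
by rewrite /preimage /= (gr_hom_linear hf); exact: sS.2.
Qed.

(** A word of degree n has at most n letters, all of degree at most n, since letters have positive
    degree. *)
Lemma finite_words (X : choiceType) (deg : X -> nat) :
  (forall x, (0 < deg x)%N) ->
  (forall n, exists s : seq X, forall x, deg x = n -> x \in s) ->
  forall n, exists s : seq {fmonom X}, forall w, word_deg deg w = n -> w \in s.
Proof.
move=> deg_gt0 deg_fin n.
have [L LP] : exists L : seq X, forall x, (deg x <= n)%N -> x \in L.
  elim: n => [|n [L LP]].
    by have [s sP] := deg_fin 0%N; exists s => x; rewrite leqn0 => /eqP; exact: sP.
  have [s sP] := deg_fin n.+1; exists (s ++ L) => x; rewrite mem_cat leq_eqVlt.
  by move=> /orP[/eqP/sP -> //|/LP ->]; rewrite orbT.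
have [S SP] : exists S : seq (seq X), forall w : seq X,
    (size w <= n)%N -> {subset w <= L} -> w \in S.
  elim: n {LP} => [|n [S SP]].
    by exists [:: [::]] => -[].
  exists ([::] :: [seq x :: w | x <- L, w <- S]) => -[|x w] //= wn xw.
  rewrite inE; apply/orP; right; apply/allpairsP; exists (x, w); split=> //=.
    by apply: xw; rewrite inE eqxx.
  by apply: SP => // y yw; apply: xw; rewrite inE yw orbT.
exists [seq FMonom w | w <- S] => -[w] wn; apply: map_f; move: wn; rewrite /word_deg /= => wn.
apply: SP.
  rewrite -wn; elim: w {wn} => [|x w IH]; first by rewrite big_nil.
  by rewrite big_cons /= -add1n; exact: leq_add.
move=> x xw; apply: LP; rewrite -wn (big_rem x) //=; exact: leq_addr.
Qed.

(** * The Koszul complex, its maps to k and its cycles *)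

Section KoszulExt.
Variables (k : fieldType) (X : choiceType) (deg : X -> nat) (R : set (tensalg k X)).
Variables (A : cgalg k) (pi : {lrmorphism (tensalg k X) -> A}).
Local Notation W := {fmonom X}.
Local Notation T := (tensalg k X).
Local Notation F := {malg A[W]}.
Hypotheses (deg_gt0 : forall x, (0 < deg x)%N) (HR : space_of_relations deg R).
Hypothesis HA : presents deg R pi.
Local Notation th := (theta pi HR).
Implicit Types (a b : A) (t s : T) (w : W).

Local Notation SJ i := (AJ HR i).
Local Notation cyc := (cycle pi HR).
Local Notation wd w := (word_deg deg w)%:Z.
Local Notation FM := (@Fgr k X deg A).
Local Notation Q i := (@Qmod k X deg R A HR i).
Local Notation Qp i := (@Qproj k X deg R A HR i).
Local Notation qv i := (@sub_val k A FM (SJ i) (AJ_submodule A HR i)).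
Local Notation triv := (triv_grmod A).
Local Notation D i := (@dQ k X deg R A pi deg_gt0 HR HA i).

Let qv0 i : qv i 0 = 0.
Proof. exact: gr_hom_0 (sub_val_hom (AJ_submodule A HR i)). Qed.

Fact dQ_aug (u : Q 1) : augQ (D 0 u) = 0.
Proof. exact: (theta_TJ_AJ deg_gt0 HA (sub_valP u)).2. Qed.

Fact dQ_dQ i (u : Q i.+2) : D i (D i.+1 u) = 0.
Proof.
apply: sub_val_inj; refine (etrans _ (esym (qv0 i))).
exact: (@theta_TJ_AJ k X deg R A pi deg_gt0 HR HA i.+1 _ (sub_valP u)).2.
Qed.

Definition koszul_complex : aug_complex triv :=
  @AugComplex k A triv (fun i => Q i) (fun i => D i) (@augQ k X deg R A HR)
    (dQ_hom deg_gt0 HR HA) (@augQ_hom k X deg R A HR) (@Qmod_projective k X deg R A HR)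
    dQ_aug dQ_dQ.

Local Notation KQ := koszul_complex.

Lemma koszul_cycle i (u : Q i) : ad KQ i u = 0 <-> cyc i (qv i u).
Proof.
case: i u => [|i] u; split=> [du|[_ du]].
- by split=> //; exact: (sub_valP u).
- exact: du.
- split; first exact: (sub_valP u).
  exact: (etrans (congr1 (qv i) (du : D i u = 0)) (qv0 i)).
by apply: sub_val_inj; refine (etrans _ (esym (qv0 i))); exact: du.
Qed.

Lemma koszul_minimal i d (f : am KQ i.+1 -> triv) : gr_hom d f ->
  forall x, ad KQ i x = 0 -> f x = 0.
Proof.
move=> hf u /koszul_cycle cu.
have [t t1 tu] := (minimal_separated deg_gt0 HR HA i).1 _ cu.
have St : SJ i (th i t) by rewrite tu; exact: (sub_valP u).
rewrite -(hom_kill deg_gt0 HA St hf t1); congr f.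
by apply: sub_val_inj; rewrite sub_mkK.
Qed.

Lemma koszul_exact : acyclic pi HR <-> forall i, exact_at KQ i.
Proof.
split=> [acyc [|i] u du|ex i x cx]; first exact: augQ_surj.
  have [y Sy dy] := acyc i _ (iffLR (koszul_cycle u) du).
  exists (sub_mk (AJ_submodule A HR i.+1) Sy); apply: sub_val_inj.
  exact: dy.
have [Sx _] := cx.
have [y yE] := ex i.+1 _ (iffRL (koszul_cycle (sub_mk (AJ_submodule A HR i) Sx)) cx).
exists (qv i.+1 y); first exact: sub_valP.
refine (etrans _ (congr1 (qv i) (yE : D i y = sub_mk (AJ_submodule A HR i) Sx))).
by [].
Qed.

(** The generators 1 (x) s of A (x) J_i: restriction to them identifies the maps of degree d to k
    with the functionals on the degree -d part of J_i. *)
Definition dual_elt i (s : T) : Q i := Qp i (tp 1 s : F).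

Lemma dual_elt_val i s : J R i s -> qv i (dual_elt i s) = tp 1 s.
Proof. by move=> Js; rewrite /dual_elt sub_val_Qproj prF_tp pr_id. Qed.

(** k sits in degree 0, so a map of degree d vanishes on every 1 (x) w with w not of degree -d. *)
Lemma hom_dual_inj i d (U : Q i -> triv) : gr_hom d U ->
  (forall s, hcomp deg (J R i) (- d) s -> U (dual_elt i s) = 0) -> forall q, U q = 0.
Proof.
move=> hU U0.
have hV : gr_hom (N := FM) d (fun x => U (Qp i x)).
  exact: gr_hom_comp0 hU (@Qproj_hom k X deg R A HR i).
suff V0 (x : F) : U (Qp i x) = 0 by move=> q; rewrite -[q]Qproj_val V0.
move: x; apply: (@lin_ext A W triv (fun x => U (Qp i x)) (fun=> 0)).
- exact: (gr_hom_linear hV).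
- exact: linear_zero.
move=> w; have [wd_d|wd_d] := eqVneq (wd w) (- d).
  rewrite -(@tp_word k X A 1 w).
  have -> : Qp i (tp 1 << w >>) = dual_elt i (pr HR i << w >>).
    apply: sub_val_inj; refine (etrans (prF_tp HR i 1 << w >>) (esym _)).
    exact: dual_elt_val (pr_J HR i _).
  apply: U0; split; first exact: pr_J.
  by rewrite -wd_d; apply: pr_homog; exact: homog_word.
have [_ Vd] := hV; have := Vd (wd w) (<< w >> : F); apply.
  by have := @Fcomp_word k X deg A 0 1 w (cga_comp1 A); rewrite add0r.
by rewrite addr_eq0.
Qed.

Lemma hom_dual_surj i d (u : {s | hcomp deg (J R i) (- d) s} -> k) : graded_dual u ->
  exists2 U : Q i -> triv, gr_hom d U & forall v, U (dual_elt i (sval v)) = u v.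
Proof.
move=> gu.
have sH : is_subspace (hcomp deg (J R i) (- d)).
  exact: (subspaceI (subspace_J HR i) (@subspace_homog k X deg (- d))).
have [f lf fu] := functional_extend sH gu.
pose g (w : W) : triv := if wd w == - d then f (pr HR i << w >>) else 0.
have hg : gr_hom (N := FM) d (mlin g : F -> triv).
  apply: mlin_gr_hom => w; rewrite /g; case: eqP => [-> /eqP|_ _] //.
  by rewrite addNr.
exists (fun q => mlin g (qv i q)).
  exact: gr_hom_comp0 hg (sub_val_hom _).
move=> s; have [Js hs] := svalP s.
rewrite (dual_elt_val Js) -fu -{2}(pr_id HR Js).
move: (sval s) hs => t ht.
apply: (@wset_lin_eq k X [pred w | wd w == - d] k^o (fun t => mlin g (tp 1 t : F) : k^o)
  (fun t => f (pr HR i t))) => [||w|w /ht /eqP] //.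
- move=> c x y; rewrite linear_tp; refine (etrans (gr_hom_linear hg c%:A _ _) _).
  by congr (_ + _); rewrite /GRing.scale /= /triv_scale cga_eps_scal.
- exact: linear_comp lf (linear_pr HR i).
by rewrite /= => wdd; rewrite tp_word (@mlinU1 A) /g wdd.
Qed.

End KoszulExt.

Section KoszulExtDual.
Variables (k : fieldType) (X : choiceType) (deg : X -> nat) (R : set (tensalg k X)).
Variables (A : cgalg k) (pi : {lrmorphism (tensalg k X) -> A}).
Local Notation W := {fmonom X}.
Local Notation T := (tensalg k X).
Local Notation F := {malg A[W]}.
Hypotheses (deg_gt0 : forall x, (0 < deg x)%N) (HR : space_of_relations deg R).
Hypothesis HA : presents deg R pi.
Local Notation th := (theta pi HR).
Local Notation dd := (dF pi HR).
Implicit Types (a b : A) (t s : T) (w : W).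

Local Notation SJ i := (AJ HR i).
Local Notation FM := (@Fgr k X deg A).
Local Notation Q i := (@Qmod k X deg R A HR i).
Local Notation qv i := (@sub_val k A FM (SJ i) (AJ_submodule A HR i)).
Local Notation triv := (triv_grmod A).
Local Notation KQ := (koszul_complex deg_gt0 HR HA).
Local Notation elt i := (@dual_elt k X deg R A HR i).
Hypothesis deg_fin : forall n, exists s : seq X, forall x, deg x = n -> x \in s.
Variable P : gr_proj_resolution triv.
Local Notation E := (res_complex P).

Lemma triv_scaleE c (v : triv) : c%:A *: v = c * v :> k.
Proof. by rewrite /GRing.scale /= /triv_scale cga_eps_scal. Qed.

Lemma triv_hom_lin (M : grmod A) d c (f g : M -> triv) :
  gr_hom d f -> gr_hom d g -> gr_hom (N' := triv) d (fun z => c * f z + g z).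
Proof.
move=> [fl fd] [gl gd]; split=> [a u v|n u nu nd]; last first.
  by rewrite (fd _ _ nu nd) (gd _ _ nu nd) mulr0 addr0.
have E (e x y x' y' : k) : c * (e * x + y) + (e * x' + y') = e * (c * x + x') + (c * y + y').
  by rewrite mulrDr addrACA mulrCA -mulrDr.
by rewrite fl gl; exact: E.
Qed.

Lemma dual_eltD i c s t : elt i (c *: s + t) = c%:A *: elt i s + elt i t.
Proof.
rewrite /dual_elt linear_tp.
exact: (gr_hom_linear (@Qproj_hom k X deg R A HR i) c%:A (tp 1 s : F) (tp 1 t : F)).
Qed.

(** The isomorphism sends a cocycle f to the restriction of f psi to 1 (x) J_i. *)
Lemma koszul_ext i : comparison E KQ i -> Ext_iso_dual triv P deg i (J R i).
Proof.
move=> cmp_i d.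
have [psi hpsi /(_ d)[surj ker]] := ext_hom (@koszul_minimal k X deg R A pi deg_gt0 HR HA) cmp_i.
exists (fun f v => f (psi (elt i (sval v)))); split.
- move=> f [hf _] c x y z zE; rewrite zE dual_eltD.
  rewrite (gr_hom_linear hpsi) (gr_hom_linear hf).
  by congr (_ + _); exact: triv_scaleE.
- by move=> c f g _ _ v; congr (_ + _); exact: triv_scaleE.
- move=> u gu; have [U hU Uu] := hom_dual_surj A HR gu.
  have [f cf fU] := surj U hU; exists f => // v.
  by rewrite fU Uu.
move=> f cf; rewrite -(ker f cf); split=> f0 v; last exact: f0.
have [hf _] := cf.
apply: (hom_dual_inj (gr_hom_comp0 hf hpsi)) => s hs.
exact: (f0 (exist _ s hs)).
Qed.

Local Notation Z i := (cycles KQ i).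
Local Notation zv i := (@sub_val k A (am KQ i.+1) _ (kernel_submodule (ad_hom KQ i))).
Local Notation fv z := (qv _ (zv _ z)).

Lemma theta_elt i s : J R i.+1 s -> {z : Z i | fv z = th i s}.
Proof.
move=> Js; have cs := theta_cycle deg_gt0 HR HA Js.
pose u : Q i := sub_mk (AJ_submodule A HR i) cs.1.
have du : ad KQ i u = 0 by apply/koszul_cycle.
by exists (sub_mk (kernel_submodule (ad_hom KQ i)) du).
Qed.

Lemma fv_hom i : gr_hom (N' := FM) 0 (fun z : Z i => fv z).
Proof.
apply: (gr_hom_comp0 (N := Q i)); exact: sub_val_hom.
Qed.

Lemma fv_inj i (y z : Z i) : (fv y : F) = fv z -> y = z.
Proof.
move=> yz; apply: sub_val_inj.
exact: (@sub_val_inj _ _ _ _ (AJ_submodule A HR i)) yz.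
Qed.

Lemma posm_cycle i (z : Z i) : posm z -> pos_cycle pi HR i (fv z).
Proof.
have lfv := gr_hom_linear (@fv_hom i).
elim=> [|c _ y [a [v [a0 ->]]] _ IH].
  by rewrite (lin_fun0 lfv); exact: span_zero.
rewrite lfv; apply: span_add IH; exists a, (fv v); split=> //.
by apply/koszul_cycle; exact: (sub_valP v).
Qed.

Lemma cycles_neg i n (z : Z i) : (n < 0)%R -> grmod_comp n z -> z = 0.
Proof.
move=> n0 nz; apply: fv_inj; rewrite (gr_hom_0 (@fv_hom i)).
apply/malgP => w; rewrite mcoeff0.
have := nz w; rewrite -/(fv z); case E: (n - _) => [m|m] // _.
have : (n - (word_deg deg w)%:Z < 0)%R by rewrite subr_lt0 (Order.POrderTheory.lt_le_trans n0).
by rewrite E.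
Qed.

Lemma theta_comp i (n : nat) s (z : Z i) :
  hcomp deg (J R i.+1) n s -> fv z = th i s -> grmod_comp n%:Z z.
Proof.
move=> [Js hs] zE; rewrite -[grmod_comp _ _]/(Fcomp deg n%:Z (fv z)) zE.
exact: (theta_homog HR HA (TJ_succ HR (J_sub_TJ Js)) hs).
Qed.

(** Prescribe y on theta(J_(i+1)) and 0 on A_+ Z_i; this is consistent by [separated]. A linear
    extension to Z_i becomes a graded map once composed with the projection to degree n. *)
Lemma theta_hom_extend i (n : nat) (y : T -> k^o) : linear y ->
  exists2 f : Z i -> triv, gr_hom (- n%:Z) f &
    forall s z, hcomp deg (J R i.+1) n s -> fv z = th i s -> f z = y s.
Proof.
move=> ly; have lfv := gr_hom_linear (@fv_hom i).
pose G : set (resc (Z i) * k^o)%type := [set p |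
  exists s z, [/\ J R i.+1 s, fv z = th i s, posm (p.1 - z) & p.2 = y s]].
have sJ := subspace_J HR i.+1.
have G00 (p : Z i) : posm p -> G (p, 0).
  move=> pp; exists 0, 0; split; [exact: subspace0 sJ | | by rewrite subr0 | by rewrite (lin_fun0 ly)].
  by rewrite (lin_fun0 lfv) (lin_fun0 (linear_theta pi HR i)).
have sG : is_subspace G.
  split=> [|c [p a] [q b] [s [z [Js zE pz aE]]] [t [v [Jt vE qv bE]]]].
    by apply: G00; exact: span_zero.
  exists (c *: s + t), (c%:A *: z + v); split.
  - exact: sJ.2.
  - by rewrite lfv zE vE (linear_theta pi HR i).
  - rewrite /= in pz qv *.
    have -> : (c *: p : resc (Z i)) + q - (c%:A *: z + v) = c%:A *: ((p : Z i) - z) + ((q : Z i) - v).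
      by rewrite opprD addrACA scalerBr.
    exact: (subspace_span _).2.
  - by rewrite /= in aE bE *; rewrite aE bE ly.
have funG v : G (0, v) -> v = 0.
  move=> [s [z [Js zE]]] /=; rewrite sub0r => /(subspaceN (subspace_span _)).
  rewrite opprK => /posm_cycle; rewrite zE => sz ->.
  by rewrite ((minimal_separated deg_gt0 HR HA i).2 s Js sz) (lin_fun0 ly).
have [g [gG _]] := linear_extension sG funG.
have lg : linear g by exact: linearP.
exists (fun z => g (gc n%:Z z)).
  by apply: functional_gr_hom => // p /G00/gG.
move=> s z hs zE; have nz := theta_comp hs zE.
rewrite /gc (gcomp_homog _ _ nz) eqxx; apply: gG.
by exists s, z; split=> //=; [case: hs | rewrite subrr; exact: span_zero].
Qed.

Section Step.
Variable i : nat.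
Hypothesis cmp_i : comparison E KQ i.
Hypothesis ext_i : Ext_iso_dual triv P deg i.+1 (J R i.+1).

(** The dimension count. [Phi] embeds the maps Z_i -> k of degree -n in k^m through Ext^(i+1) and
    the given isomorphism, m being the dimension of the degree n part of J_(i+1). Evaluation at
    theta of a basis of that part is onto by [theta_hom_extend], hence injective. *)
Lemma theta_hom_vanish (n : nat) (f : Z i -> triv) : gr_hom (- n%:Z) f ->
  (forall s z, hcomp deg (J R i.+1) n s -> fv z = th i s -> f z = 0) ->
  forall z, f z = 0.
Proof.
set d := - n%:Z; have dn : - d = n by rewrite opprK.
move=> hf f0.
have [phi hphi Hphi] := ext_cycles (@koszul_minimal k X deg R A pi deg_gt0 HR HA) cmp_i.
have [Psi [Psi_dual PsiD _ Psi_ker]] := ext_i d.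
have sH : is_subspace (hcomp deg (J R i.+1) (- d)).
  exact: (subspaceI (subspace_J HR i.+1) (@subspace_homog k X deg (- d))).
have [ws wsP] := finite_words deg_gt0 deg_fin n.
have suppH x : hcomp deg (J R i.+1) (- d) x -> {subset msupp x <= ws}.
  by move=> [_ hx] w /hx; rewrite dn => -[/wsP].
have [m [b [y [bH ylin ydec yb]]]] := finite_basis sH suppH.
have ex j : exists z : Z i, fv z = th i (b j).
  by have [z zE] := theta_elt (bH j).1; exists z.
have [e eP] := choice ex.
apply: (@finite_dual_surj k (Z i) [set f | gr_hom (N' := triv) d f] m e
  (fun f j => Psi (fun p => f (phi p)) (exist _ (b j) (bH j)))) => //.
- exact: gr_hom_zero.
- by move=> c g h; exact: triv_hom_lin.
- move=> c g h hg hh j.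
  rewrite -PsiD; [|exact: (Hphi d g hg).1|exact: (Hphi d h hh).1].
  by congr (Psi _ _); apply/funext => p; rewrite triv_scaleE.
- move=> g hg g0; have [cg cob] := Hphi d g hg; apply/cob/Psi_ker => // x.
  have [u lu uE] := functional_extend sH (Psi_dual _ cg).
  rewrite -uE (ydec _ (svalP x)) (lin_fun_sum _ _ lu) big1 // => j _.
  rewrite (lin_funZ _ _ lu) -[b j]/(sval (exist _ (b j) (bH j))) uE g0.
  exact: scaler0.
- move=> l; have [h hh hE] := theta_hom_extend i n (ylin l).
  exists h => // j; rewrite (hE _ _ _ (eP j)) ?yb //.
  by have := bH j; rewrite dn.
move=> j; apply: f0 (eP j).
by have := bH j; rewrite dn.
Qed.

(** By Nakayama it is enough that boundaries and A_+ Z_i together span Z_i. Otherwise some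
    functional vanishes on both but not on Z_i; it gives a nonzero map Z_i -> k that vanishes on
    theta(J_(i+1)), against [theta_hom_vanish]. *)
Lemma koszul_step : exact_at KQ i.+1.
Proof.
pose N : set (Z i) := zv i @^-1` range (ad KQ i.+1).
have hN : gr_submodule N.
  exact: preim_submodule (sub_val_hom _) (image_submodule (ad_hom KQ i.+1)).
suff NT z : N z.
  move=> x dx; have [y _ yE] := NT (sub_mk (kernel_submodule (ad_hom KQ i)) dx).
  by exists y.
move: z; apply: (nakayama hN (@cycles_neg i)) => n z nz.
case: n nz => [n|n] nz; last first.
  rewrite (cycles_neg _ nz) //; exists 0; first exact: span_zero.
  by rewrite subr0; exact: subspace0 hN.1.
apply: contrapT => nSz.
pose S : set (resc (Z i)) := [set x | exists2 p : Z i, posm p & N ((x : Z i) - p)].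
have sS : is_subspace S.
  split=> [|c x y [p pp Np] [q pq Nq]].
    by exists 0; [exact: span_zero | rewrite subr0; exact: subspace0 hN.1].
  exists (c%:A *: p + q); first exact: (subspace_span _).2.
  have -> : (c *: x + y : resc (Z i)) - (c%:A *: p + q) = c%:A *: ((x : Z i) - p) + ((y : Z i) - q).
    by rewrite opprD addrACA scalerBr.
  exact: hN.1.2.
have [g lg [gS g1]] := subspace_separation sS nSz.
have hg : gr_hom (N' := triv) (- n%:Z) (fun z : Z i => g (gc n%:Z z)).
  apply: functional_gr_hom => // p pp; apply: gS; exists p => //.
  by rewrite subrr; exact: subspace0 hN.1.
have := theta_hom_vanish hg; suff H : forall s v, hcomp deg (J R i.+1) n s ->
    fv v = th i s -> g (gc n%:Z v) = 0.
  move=> /(_ H z); rewrite /gc (gcomp_homog _ _ nz) eqxx g1 => /eqP.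
  by rewrite oner_eq0.
move=> s v hs vE; rewrite /gc (gcomp_homog _ _ (theta_comp hs vE)) eqxx.
apply: gS; exists 0; first exact: span_zero.
(* theta(s) is the boundary of 1 (x) s. *)
rewrite subr0; exists (elt i.+1 s) => //; apply: sub_val_inj.
refine (etrans _ (esym vE)).
refine (etrans (congr1 (dd i) (dual_elt_val A HR hs.1)) _).
by refine (etrans (dF_tp _ _ _ _ _) _); exact: scale1r.
Qed.

End Step.

Lemma multi_koszul_ext :
  multi_koszul R pi <-> (forall i, Ext_iso_dual triv P deg i (J R i)).
Proof.
rewrite (multi_koszul_acyclic deg_gt0 HR HA) (koszul_exact deg_gt0 HR HA).
have exE : forall i, exact_at E i by exact: res_complex_exact.
split=> [ex i|ext i].
  exact: koszul_ext (comparison_exists exE (fun i _ => ex i) (leqnn i)).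
(* Index i+1 of the shifted complex is homological degree i: exactness at indices up to i gives the
   comparison at i, and Ext^(i+1) then gives exactness at index i+1. *)
elim/ltn_ind: i => -[|i] IH; first by move=> c _; exact: augQ_surj.
apply: koszul_step (ext i.+1).
exact: (comparison_exists exE (fun j ji => IH j ji) (leqnn i)).
Qed.

End KoszulExtDual.

Theorem proposition3p24 (k : fieldType)
    (X : choiceType) (deg : X -> nat) (R : set (tensalg k X))
    (A : cgalg k) (pi : {lrmorphism (tensalg k X) -> A})
    (P : gr_proj_resolution (triv_grmod A))
    (deg_gt0 : forall x, (0 < deg x)%N)
    (deg_fin : forall n, exists s : seq X, forall x, deg x = n -> x \in s)
    (HR : space_of_relations deg R)
    (HA : presents deg R pi) :
  multi_koszul R pi <->
  (forall i : nat, Ext_iso_dual (triv_grmod A) P deg i (J R i)).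
Proof. exact: multi_koszul_ext. Qed.
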